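(* Let $\mathbb{K}$ be a topological ring with dense unit group, let $V,W$ be Hausdorff topological $\mathbb{K}$-modules, and let $M,N$ be Hausdorff $C^1_{\mathbb{K}}$-manifolds modelled on $V$, resp. on $W$. Then: (1) For every open $U\subset V$, a $C^1_{\mathbb{K}}$-map $f:U\to W$ induces a morphism of groupoids $f^{\{1\}}:U^{\{1\}}\to W^{\{1\}}$, $(x,v,t)\mapsto (f(x),f^{[1]}(x,v,t),t)$, over $f\times \mathrm{id}_{\mathbb{K}}$. (2) To the manifold $M$ one can associate a bi-bundle $\pi_0,\pi_1:M^{\{1\}}\rightrightarrows M\times\mathbb{K}$ (obtained by gluing, see context), carrying a canonical continuous groupoid structure (that is, one given in every chart by the groupoid structure $\ast$ of the local model). (3) The groupoid $M^{\{1\}}$ is a bundle of groupoids over $\mathbb{K}$, and hence, for all $t\in\mathbb{K}$, the fiber $M_t$ over $t$ is a continuous groupoid with object set $M$. (4) The groupoid $M_0$ is the usual tangent bundle of $M$ (additive group bundle), and $M_1$ is isomorphic to the pair groupoid over $M$. More generally, the groupoid $(M^{\{1\}})^\times$ (the part of $M^{\{1\}}$ lying over $\mathbb{K}^\times$) is naturally isomorphic to the direct product of the pair groupoid of $M$ with the trivial groupoid of $\mathbb{K}^\times$. If $\mathbb{K}$ is a field, then $M^{\{1\}}$ is the disjoint union of that groupoid with the tangent bundle. (5) Let $f:M\to N$ be a map. Then $f$ is of class $C^1_{\mathbb{K}}$ if, and only if, it extends to a continuous morphism of groupoids $f^{\{1\}}:M^{\{1\}}\to N^{\{1\}}$ (with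 map on objects $f\times\mathrm{id}_{\mathbb{K}}$). Put differently, there is a 1:1-correspondence between $C^1_{\mathbb{K}}$-maps $M\to N$ and continuous groupoid morphisms $M^{\{1\}}\to N^{\{1\}}$ of the first kind. (6) There is a natural homeomorphism of bundles over $M\times N\times\mathbb{K}$ $$(M\times N)^{\{1\}}\;\cong\; M^{\{1\}}\times_{\mathbb{K}}N^{\{1\}}.$$ In other words, for all $t\in\mathbb{K}$, $(M\times N)_t\cong M_t\times N_t$.
   Context: $\mathbb{K}$ is a ring with unit, not assumed commutative; modules are right $\mathbb{K}$-modules; $\mathbb{K}^\times$ is the unit group. Local model. For a $\mathbb{K}$-module $V$ and nonempty $U\subset V$, put $U^{\{1\}}=U^{[1]}=\{(x,v,t)\in V\times V\times\mathbb{K}\mid x\in U,\ x+vt\in U\}$, with $\pi_0(x,v,t)=(x,t)$, $\pi_1(x,v,t)=(x+vt,t)$ (maps $U^{\{1\}}\to U\times\mathbb{K}$), $z(x,t)=(x,0,t)$, and $(x',v',t)\ast(x,v,t)=(x,v'+v,t)$ whenever $x'=x+vt$. This is a groupoid with object set $U\times\mathbb{K}$, morphism set $U^{\{1\}}$, source $\pi_0$, target $\pi_1$, units $z$. A difference factorizer of $f:U\to W$ is a map $f^{[1]}:U^{[1]}\to W$ with $f(x+vt)-f(x)=f^{[1]}(x,v,t)\,t$ on $U^{[1]}$. For $U$ open in a topological $\mathbb{K}$-module $V$ and $W$ a topological $\mathbb{K}$-module, $f:U\to W$ is of class $C^1_{\mathbb{K}}$ if it admits a continuous difference factorizer (unique,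 since $\mathbb{K}^\times$ is dense). One writes $f^{\{1\}}(x,v,t)=(f(x),f^{[1]}(x,v,t),t)$. Manifolds. A Hausdorff $C^1_{\mathbb{K}}$-manifold $M$ modelled on $V$ is a Hausdorff topological space with a maximal atlas of charts $\phi_i:U_i\to V_i$, i.e. homeomorphisms from nonempty open sets $U_i$ covering $M$ onto open sets $V_i\subset V$ (chart domains need not be connected), with transition maps $\phi_{ij}=\phi_i\circ\phi_j^{-1}:V_{ji}\to V_{ij}$ of class $C^1_{\mathbb{K}}$, where $V_{ij}=\phi_j(U_i\cap U_j)$ with indices arranged so that $V_{ji}$ is the domain and $V_{ij}$ the image of $\phi_{ij}$. A map between manifolds is $C^1_{\mathbb{K}}$ if it is continuous and is $C^1_{\mathbb{K}}$ in charts. The space $M^{\{1\}}$ is the quotient of the disjoint union of the sets $V_i^{\{1\}}$ by the relation $(i,a)\sim(j,b)$ iff $b\in (V_{ji})^{\{1\}}$ and $(\phi_{ij})^{\{1\}}(b)=a$; its topology is generated by the images of the open subsets of the $V_i^{\{1\}}$. The local maps $\pi_0,\pi_1,z$ induce maps $\pi_0,\pi_1:M^{\{1\}}\to M\times\mathbb{K}$ and $z:M\times\mathbb{K}\to M^{\{1\}}$. $M_t$ denotes the part of $M^{\{1\}}$ over $M\times\{t\}$. A continuous groupoid is a groupoid whose sets of objects and morphisms are topological spaces and whose structure maps are continuous. A bundle of groupoids over a set $I$ is an indexed family of groupoids $(M_i)_{i\in I}$ (its total space is again a groupoid). The pair groupoid of a set $A$ has objects $A$, morphisms $A\times A$, $\pi_0(x,y)=y$,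 $\pi_1(x,y)=x$, units $(x,x)$, composition $(x,y)\circ(y,z)=(x,z)$. The trivial groupoid of a set has only identity morphisms. A group bundle is a groupoid whose source and target maps coincide. A groupoid morphism $M^{\{1\}}\to N^{\{1\}}$ is of the first kind if its map on objects has the form $f\times\mathrm{id}_{\mathbb{K}}$.
   Formalization: Parts (2)–(6) assume, for M (and for N in (5), (6)), that K is a field with continuous inversion and the model space is nonzero, or that any three points lie in a common chart; else false: for V = 0 and M two discrete points, M_1 has 2 arrows, the pair groupoid 4. *)

(* Defs.v *)
From HB Require Import structures.
From mathcomp Require Import all_boot all_order all_algebra.
From mathcomp Require Import all_classical.
From mathcomp Require Import topology pseudometric_normed_Zmodule.

Set Implicit Arguments.
Unset Strict Implicit.
Unset Printing Implicit Defensive.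

Import GRing.Theory.

Local Open Scope classical_set_scope.
Local Open Scope ring_scope.

HB.mixin Record isTopRing K & PreTopologicalZmodule K & GRing.PzRing K := {
  ring_add_continuous : continuous (fun p : K * K => p.1 + p.2);
  ring_opp_continuous : continuous (fun s : K => - s);
  ring_mul_continuous : continuous (fun p : K * K => p.1 * p.2)
}.

#[short(type="topRingType")]
HB.structure Definition TopRing :=
  {K of PreTopologicalZmodule K & GRing.PzRing K & isTopRing K}.

(** A right module over [K] is a left module over the converse ring [K^c]. *)
HB.mixin Record isRightTopModule (K : topRingType) V
    & PreTopologicalZmodule V & GRing.Lmodule K^c V := {
  rmod_add_continuous : continuous (fun p : V * V => p.1 + p.2);
  rmod_opp_continuous : continuous (fun v : V => - v);
  rmod_scale_continuous :
    continuous (fun p : V * K => (p.2 : K^c) *: p.1)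
}.

#[short(type="rightTopModType")]
HB.structure Definition RightTopModule (K : topRingType) :=
  {V of PreTopologicalZmodule V & GRing.Lmodule K^c V & isRightTopModule K V}.

Definition rscale (K : topRingType) (V : rightTopModType K) (v : V) (t : K) : V :=
  (t : K^c) *: v.

Notation "v *^ t" := (rscale v t) (at level 40, left associativity) : ring_scope.

Section ProductModule.
Variables (K : topRingType) (V W : rightTopModType K).

Lemma prod_rmod_add_continuous :
  continuous (fun p : (V * W) * (V * W) => p.1 + p.2).
Proof.
move=> p; apply: cvg_pair.
  apply: (@continuous_comp _ _ _
    (fun q : (V * W) * (V * W) => (q.1.1, q.2.1)) (fun q => q.1 + q.2)).
    by apply: cvg_pair; apply: continuous_comp;
      [exact: cvg_fst|exact: cvg_fst|exact: cvg_snd|exact: cvg_fst].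
  exact: rmod_add_continuous.
apply: (@continuous_comp _ _ _
  (fun q : (V * W) * (V * W) => (q.1.2, q.2.2)) (fun q => q.1 + q.2)).
  by apply: cvg_pair; apply: continuous_comp;
    [exact: cvg_fst|exact: cvg_snd|exact: cvg_snd|exact: cvg_snd].
exact: rmod_add_continuous.
Qed.

Lemma prod_rmod_opp_continuous : continuous (fun v : V * W => - v).
Proof.
move=> p; apply: cvg_pair; apply: continuous_comp.
- exact: cvg_fst.
- exact: rmod_opp_continuous.
- exact: cvg_snd.
- exact: rmod_opp_continuous.
Qed.

Lemma prod_rmod_scale_continuous :
  continuous (fun p : (V * W) * K => (p.2 : K^c) *: p.1).
Proof.
move=> p; apply: cvg_pair.
  apply: (@continuous_comp _ _ _
    (fun q : (V * W) * K => (q.1.1, q.2)) (fun q => (q.2 : K^c) *: q.1)).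
    apply: cvg_pair; last exact: cvg_snd.
    by apply: continuous_comp; [exact: cvg_fst|exact: cvg_fst].
  exact: rmod_scale_continuous.
apply: (@continuous_comp _ _ _
  (fun q : (V * W) * K => (q.1.2, q.2)) (fun q => (q.2 : K^c) *: q.1)).
  apply: cvg_pair; last exact: cvg_snd.
  by apply: continuous_comp; [exact: cvg_fst|exact: cvg_snd].
exact: rmod_scale_continuous.
Qed.

HB.instance Definition _ := isRightTopModule.Build K (V * W)%type
  prod_rmod_add_continuous prod_rmod_opp_continuous prod_rmod_scale_continuous.

End ProductModule.

(** MathComp's [GRing.unit] is only available for nontrivial rings with a
    chosen inverse, hence this explicit form. *)
Definition units (K : topRingType) : set K :=
  [set t | exists s, s * t = 1 /\ t * s = 1].

(** Commutativity is not required. *)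
Definition is_field (K : topRingType) : Prop :=
  (1 : K) <> 0 /\ forall t : K, t <> 0 -> units t.

Definition continuous_inversion (K : topRingType) : Prop :=
  exists i : K -> K,
    (forall t, units t -> i t * t = 1 /\ t * i t = 1) /\
    {within @units K, continuous i}.

Definition homeo_pair (X Y : topologicalType) (A : set X) (B : set Y)
    (f : X -> Y) (g : Y -> X) : Prop :=
  [/\ set_fun A B f, set_fun B A g, {in A, cancel f g}, {in B, cancel g f}
    & {within A, continuous f} /\ {within B, continuous g}].

Definition homeomorphism (X Y : topologicalType) (A : set X) (B : set Y)
    (f : X -> Y) : Prop :=
  exists g, homeo_pair A B f g.

(** Objects and morphisms are subsets [obj], [mor] of ambient types; all
    operations are total functions, meaningful only on these subsets, and
    [comp g' g] (first [g], then [g']) only when [src g' = tgt g]. *)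
Record groupoid_data (Ob Mor : Type) := GroupoidData {
  obj : set Ob;
  mor : set Mor;
  src : Mor -> Ob;
  tgt : Mor -> Ob;
  one : Ob -> Mor;
  comp : Mor -> Mor -> Mor;
  inv : Mor -> Mor
}.

Definition composable Ob Mor (G : groupoid_data Ob Mor) : set (Mor * Mor) :=
  [set p | [/\ mor G p.1, mor G p.2 & src G p.1 = tgt G p.2]].

Record is_groupoid Ob Mor (G : groupoid_data Ob Mor) : Prop := IsGroupoid {
  src_obj : forall g, mor G g -> obj G (src G g);
  tgt_obj : forall g, mor G g -> obj G (tgt G g);
  one_mor : forall x, obj G x -> mor G (one G x);
  comp_mor : forall g' g, composable G (g', g) -> mor G (comp G g' g);
  inv_mor : forall g, mor G g -> mor G (inv G g);
  src_one : forall x, obj G x -> src G (one G x) = x;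
  tgt_one : forall x, obj G x -> tgt G (one G x) = x;
  src_comp : forall g' g, composable G (g', g) -> src G (comp G g' g) = src G g;
  tgt_comp : forall g' g, composable G (g', g) -> tgt G (comp G g' g) = tgt G g';
  src_inv : forall g, mor G g -> src G (inv G g) = tgt G g;
  tgt_inv : forall g, mor G g -> tgt G (inv G g) = src G g;
  compA : forall g'' g' g, composable G (g'', g') -> composable G (g', g) ->
    comp G g'' (comp G g' g) = comp G (comp G g'' g') g;
  comp1g : forall g, mor G g -> comp G (one G (tgt G g)) g = g;
  compg1 : forall g, mor G g -> comp G g (one G (src G g)) = g;
  compVg : forall g, mor G g -> comp G (inv G g) g = one G (src G g);
  compgV : forall g, mor G g -> comp G g (inv G g) = one G (tgt G g)
}.

Definition continuous_groupoid (Ob Mor : topologicalType)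
    (G : groupoid_data Ob Mor) : Prop :=
  is_groupoid G /\
  [/\ {within mor G, continuous (src G)},
      {within mor G, continuous (tgt G)},
      {within obj G, continuous (one G)},
      {within composable G, continuous (fun p => comp G p.1 p.2)}
    & {within mor G, continuous (inv G)}].

Record is_morphism Ob Mor Ob' Mor' (G : groupoid_data Ob Mor)
    (H : groupoid_data Ob' Mor') (fo : Ob -> Ob') (fm : Mor -> Mor') : Prop :=
  IsMorphism {
  morph_obj : forall x, obj G x -> obj H (fo x);
  morph_mor : forall g, mor G g -> mor H (fm g);
  morph_src : forall g, mor G g -> src H (fm g) = fo (src G g);
  morph_tgt : forall g, mor G g -> tgt H (fm g) = fo (tgt G g);
  morph_one : forall x, obj G x -> fm (one G x) = one H (fo x);
  morph_comp : forall g' g, composable G (g', g) ->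
    fm (comp G g' g) = comp H (fm g') (fm g)
}.

Definition continuous_morphism (Ob Mor Ob' Mor' : topologicalType)
    (G : groupoid_data Ob Mor) (H : groupoid_data Ob' Mor')
    (fo : Ob -> Ob') (fm : Mor -> Mor') : Prop :=
  [/\ is_morphism G H fo fm, {within obj G, continuous fo}
    & {within mor G, continuous fm}].

Definition is_iso Ob Mor Ob' Mor' (G : groupoid_data Ob Mor)
    (H : groupoid_data Ob' Mor') (fo : Ob -> Ob') (fm : Mor -> Mor') : Prop :=
  [/\ is_morphism G H fo fm, set_bij (obj G) (obj H) fo
    & set_bij (mor G) (mor H) fm].

Definition is_continuous_iso (Ob Mor Ob' Mor' : topologicalType)
    (G : groupoid_data Ob Mor) (H : groupoid_data Ob' Mor')
    (fo : Ob -> Ob') (fm : Mor -> Mor') : Prop :=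
  [/\ is_morphism G H fo fm, homeomorphism (obj G) (obj H) fo
    & homeomorphism (mor G) (mor H) fm].

Definition is_group_bundle Ob Mor (G : groupoid_data Ob Mor) : Prop :=
  is_groupoid G /\ forall g, mor G g -> src G g = tgt G g.

Definition pair_groupoid (T : Type) (A : set T) : groupoid_data T (T * T) :=
  GroupoidData A (A `*` A) snd fst (fun x => (x, x))
    (fun p q => (p.1, q.2)) (fun p => (p.2, p.1)).

Definition trivial_groupoid (T : Type) (A : set T) : groupoid_data T T :=
  GroupoidData A A id id id (fun x _ => x) id.

Definition prod_groupoid Ob Mor Ob' Mor' (G : groupoid_data Ob Mor)
    (H : groupoid_data Ob' Mor') : groupoid_data (Ob * Ob') (Mor * Mor') :=
  GroupoidData (obj G `*` obj H) (mor G `*` mor H)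
    (fun g => (src G g.1, src H g.2)) (fun g => (tgt G g.1, tgt H g.2))
    (fun x => (one G x.1, one H x.2))
    (fun g' g => (comp G g'.1 g.1, comp H g'.2 g.2))
    (fun g => (inv G g.1, inv H g.2)).

Definition sum_groupoid Ob Mor Ob' Mor' (G : groupoid_data Ob Mor)
    (H : groupoid_data Ob' Mor') : groupoid_data (Ob + Ob') (Mor + Mor') :=
  GroupoidData
    [set x | match x with inl y => obj G y | inr y => obj H y end]
    [set g | match g with inl h => mor G h | inr h => mor H h end]
    (fun g => match g with inl h => inl (src G h) | inr h => inr (src H h) end)
    (fun g => match g with inl h => inl (tgt G h) | inr h => inr (tgt H h) end)
    (fun x => match x with inl y => inl (one G y) | inr y => inr (one H y) end)
    (fun g' g => match g', g with
       | inl h', inl h => inl (comp G h' h)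
       | inr h', inr h => inr (comp H h' h)
       | _, _ => g
       end)
    (fun g => match g with inl h => inl (inv G h) | inr h => inr (inv H h) end).

Definition bundle_total (I Ob Mor : Type) (G : I -> groupoid_data Ob Mor) :
    groupoid_data (Ob * I) (Mor * I) :=
  GroupoidData [set x | obj (G x.2) x.1] [set g | mor (G g.2) g.1]
    (fun g => (src (G g.2) g.1, g.2)) (fun g => (tgt (G g.2) g.1, g.2))
    (fun x => (one (G x.2) x.1, x.2))
    (fun g' g => (comp (G g.2) g'.1 g.1, g.2))
    (fun g => (inv (G g.2) g.1, g.2)).

Definition full_subgroupoid Ob Mor (G : groupoid_data Ob Mor) (O : set Ob) :
    groupoid_data Ob Mor :=
  GroupoidData (obj G `&` O)
    [set g | [/\ mor G g, O (src G g) & O (tgt G g)]]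
    (src G) (tgt G) (one G) (comp G) (inv G).

Section LocalModel.
Variables (K : topRingType) (V : rightTopModType K).

(** [U^{1} = U^[1]]; the triple [(x, v, t)] is [((x, v), t)]. *)
Definition ext1 (U : set V) : set (V * V * K) :=
  [set p | U p.1.1 /\ U (p.1.1 + p.1.2 *^ p.2)].

Definition local_groupoid (U : set V) : groupoid_data (V * K) (V * V * K) :=
  GroupoidData (U `*` setT) (ext1 U)
    (fun p => (p.1.1, p.2))
    (fun p => (p.1.1 + p.1.2 *^ p.2, p.2))
    (fun q => (q.1, 0, q.2))
    (fun p' p => (p.1.1, p'.1.2 + p.1.2, p.2))
    (fun p => (p.1.1 + p.1.2 *^ p.2, - p.1.2, p.2)).

Lemma ext1_nonempty (U : set V) : U !=set0 -> ext1 U !=set0.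
Proof. by case=> x Ux; exists (x, 0, 0); split; rewrite //= /rscale scaler0 addr0. Qed.

Variable W : rightTopModType K.

Definition difference_factorizer (U : set V) (f : V -> W)
    (f1 : V * V * K -> W) : Prop :=
  forall x v t, ext1 U (x, v, t) -> f (x + v *^ t) - f x = f1 (x, v, t) *^ t.

Definition continuous_factorizers (U : set V) (f : V -> W) :
    set (V * V * K -> W) :=
  [set f1 | difference_factorizer U f f1 /\ {within ext1 U, continuous f1}].

(** To be used for open [U] only; values of [f] outside [U] are irrelevant. *)
Definition C1_on (U : set V) (f : V -> W) : Prop :=
  continuous_factorizers U f !=set0.

(** The continuous difference factorizer [f^[1]] (unique on [ext1 U] if [U] is
    open, [W] Hausdorff and the units are dense; arbitrary if there is none). *)
Definition slope (U : set V) (f : V -> W) : V * V * K -> W :=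
  xget (fun=> 0) (continuous_factorizers U f).

(** [f^{1} (x, v, t) = (f x, f^[1] (x, v, t), t)] *)
Definition tangent1 (U : set V) (f : V -> W) (p : V * V * K) : W * W * K :=
  (f p.1.1, slope U f p, p.2).

(** [T f (x, v) = (f x, df(x) v)] with [df(x) v = f^[1] (x, v, 0)] *)
Definition tangent0 (U : set V) (f : V -> W) (p : V * V) : W * W :=
  (f p.1, slope U f (p.1, p.2, 0)).

End LocalModel.

(** A chart [fwd : dom -> cod] with inverse [bwd]; both are total functions
    whose values outside [dom], resp. [cod], are irrelevant. *)
Record chart (T V : Type) := Chart {
  dom : set T;
  cod : set V;
  fwd : T -> V;
  bwd : V -> T
}.

Definition is_chart (T V : topologicalType) (c : chart T V) : Prop :=
  [/\ dom c !=set0, open (dom c), open (cod c)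
    & homeo_pair (dom c) (cod c) (fwd c) (bwd c)].

(** [overlap i j] is [phi_j (U_i `&` U_j)], the domain of the transition map
    [transition i j = phi_i \o phi_j^-1]. *)
Definition overlap (T V : Type) (i j : chart T V) : set V :=
  fwd j @` (dom i `&` dom j).

Definition transition (T V : Type) (i j : chart T V) : V -> V :=
  fwd i \o bwd j.

Definition C1_compatible (K : topRingType) (V : rightTopModType K)
    (T : topologicalType) (i j : chart T V) : Prop :=
  C1_on (overlap i j) (transition i j) /\ C1_on (overlap j i) (transition j i).

Record manifold (K : topRingType) (V : rightTopModType K)
    (T : topologicalType) := Manifold {
  atlas : set (chart T V);
  atlas_chart : forall c, atlas c -> is_chart c;
  atlas_cover : forall p : T, exists c, atlas c /\ dom c p;
  atlas_compatible : forall c d, atlas c -> atlas d -> C1_compatible c d;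
  atlas_maximal : forall c, is_chart c ->
    (forall d, atlas d -> C1_compatible c d) -> atlas c
}.

Definition C1_map (K : topRingType) (V W : rightTopModType K)
    (TM TN : topologicalType) (M : manifold V TM) (N : manifold W TN)
    (f : TM -> TN) : Prop :=
  continuous f /\
  forall c d, atlas M c -> atlas N d ->
    C1_on (fwd c @` (dom c `&` f @^-1` dom d)) (fwd d \o f \o bwd c).

(** The groupoid composition of [M^{1}] is given by [*] in a chart whose domain
    contains the source, the middle point and the target of the two arrows, so
    one needs such charts. *)
Definition common_charts (K : topRingType) (V : rightTopModType K)
    (T : topologicalType) (M : manifold V T) : Prop :=
  forall p q r : T, exists c, atlas M c /\ [/\ dom c p, dom c q & dom c r].

(** Over a field, and for [V <> 0], common charts of a Hausdorff manifold are
    provided by the maximality of the atlas: chart domains need not be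
    connected, and class C^1 is a local property, so that disjoint unions of
    charts with disjoint images are charts.  This fails for [V = 0] (a discrete
    space with two points) and over general rings (e.g. [R * R]), where
    class C^1 is not local; there common charts have to be assumed. *)
Definition enough_charts (K : topRingType) (V : rightTopModType K)
    (T : topologicalType) (M : manifold V T) : Prop :=
  [/\ is_field K, continuous_inversion K & exists v : V, v <> 0] \/
  common_charts M.

Definition prod_chart (TM V TN W : Type) (c : chart TM V) (d : chart TN W) :
    chart (TM * TN) (V * W) :=
  Chart (dom c `*` dom d) (cod c `*` cod d)
    (fun p => (fwd c p.1, fwd d p.2)) (fun q => (bwd c q.1, bwd d q.2)).

(** As class C^1 need not be local, C^1-compatibility need not be transitive,
    and a maximal atlas containing the product charts need not be unique. *)
Definition is_product_manifold (K : topRingType) (V W : rightTopModType K)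
    (TM TN : topologicalType) (M : manifold V TM) (N : manifold W TN)
    (P : manifold (V * W)%type (TM * TN)%type) : Prop :=
  forall c d, atlas M c -> atlas N d -> atlas P (prod_chart c d).

(** Quotient of the disjoint union of the [piece i] by the relation
    [(i, a) ~ (j, b)] iff [glue_dom i j b] and [glue i j b = a]. *)
Record gluing := Gluing {
  index : Type;
  model : topologicalType;
  piece : index -> set model;
  piece_nonempty : forall i, piece i !=set0;
  glue_dom : index -> index -> set model;
  glue : index -> index -> model -> model
}.

Section Gluing.
Variable D : gluing.

Definition glue_class (j : index D) (b : model D) : set (index D * model D) :=
  [set q | glue_dom q.1 j b /\ glue q.1 j b = q.2].

Definition is_glue_class (A : set (index D * model D)) : Prop :=
  exists p : index D * model D, piece p.1 p.2 /\ A = glue_class p.1 p.2.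

Definition glued : Type := {A | is_glue_class A}.

Definition glued_rep (g : glued) : index D * model D := proj1_sig (cid (proj2_sig g)).

Definition piece_point (i : index D) : model D := sval (cid (piece_nonempty i)).

Definition in_piece (i : index D) (a : model D) : model D :=
  if pselect (piece i a) then a else piece_point i.

Lemma in_pieceP i a : is_glue_class (glue_class i (in_piece i a)).
Proof.
exists (i, in_piece i a); split=> //=; rewrite /in_piece.
by case: pselect => // npa; exact: (svalP (cid (piece_nonempty i))).
Qed.

(** The canonical map [piece i -> glued] (a junk value outside [piece i]). *)
Definition glued_in (i : index D) (a : model D) : glued :=
  exist _ _ (in_pieceP i a).

Definition glued_images : set (set glued) :=
  [set A | exists i (O : set (model D)),
    open O /\ A = glued_in i @` (piece i `&` O)].

HB.instance Definition _ := gen_eqMixin glued.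
HB.instance Definition _ := gen_choiceMixin glued.
HB.instance Definition _ := isSubBaseTopological.Build glued glued_images id.

End Gluing.

Section Extension.
Variables (K : topRingType) (V : rightTopModType K) (T : topologicalType).
Variable M : manifold V T.

Lemma cod_nonempty (c : atlas M) : cod (val c) !=set0.
Proof.
have [[x cx] _ _ [fc _ _ _ _]] := atlas_chart (set_mem (valP c)).
by exists (fwd (val c) x); exact: fc.
Qed.

Definition ext_gluing : gluing :=
  @Gluing (atlas M) (V * V * K)%type
    (fun c => ext1 (cod (val c)))
    (fun c => ext1_nonempty (cod_nonempty c))
    (fun c d => ext1 (overlap (val c) (val d)))
    (fun c d => tangent1 (overlap (val c) (val d)) (transition (val c) (val d))).

(** The space [M^{1}] *)
Definition ext : topologicalType := glued ext_gluing.

Definition ext_in (c : atlas M) (a : V * V * K) : ext := @glued_in ext_gluing c a.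

Definition ext_src (g : ext) : T * K :=
  let: (c, (x, v, t)) := glued_rep g in (bwd (val c) x, t).

Definition ext_tgt (g : ext) : T * K :=
  let: (c, (x, v, t)) := glued_rep g in (bwd (val c) (x + v *^ t), t).

Lemma atlas_at (p : T) : exists c : atlas M, dom (val c) p.
Proof. by have [c [Mc cp]] := atlas_cover M p; exists (SigSub (mem_set Mc)). Qed.

Definition ext_one (q : T * K) : ext :=
  let c := sval (cid (atlas_at q.1)) in ext_in c (fwd (val c) q.1, 0, q.2).

Definition ext_inv (g : ext) : ext :=
  let: (c, (x, v, t)) := glued_rep g in ext_in c (x + v *^ t, - v, t).

Definition ext_compose (g' g h : ext) : Prop :=
  exists c x v v' t,
    [/\ ext1 (cod (val c)) (x, v, t),
        ext1 (cod (val c)) (x + v *^ t, v', t),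
        g = ext_in c (x, v, t),
        g' = ext_in c (x + v *^ t, v', t)
      & h = ext_in c (x, v' + v, t)].

Definition ext_comp (g' g : ext) : ext := xget g (ext_compose g' g).

Definition ext_groupoid : groupoid_data (T * K)%type ext :=
  GroupoidData setT setT ext_src ext_tgt ext_one ext_comp ext_inv.

(** The fiber [M_t], with object set [M] *)
Definition ext_fiber (t : K) : groupoid_data T ext :=
  GroupoidData setT [set g | (ext_src g).2 = t]
    (fun g => (ext_src g).1) (fun g => (ext_tgt g).1)
    (fun x => ext_one (x, t)) ext_comp ext_inv.

(** [(M^{1})^x] *)
Definition ext_units : groupoid_data (T * K)%type ext :=
  full_subgroupoid ext_groupoid (setT `*` @units K).

(** The tangent bundle is glued from the [V_i * V] by the tangent maps
    [(x, v) |-> (phi_ij x, dphi_ij(x) v)]. *)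
Lemma cylinder_nonempty (c : atlas M) : (cod (val c) `*` [set: V]) !=set0.
Proof. by have [x cx] := cod_nonempty c; exists (x, 0). Qed.

Definition tb_gluing : gluing :=
  @Gluing (atlas M) (V * V)%type
    (fun c => cod (val c) `*` setT)
    cylinder_nonempty
    (fun c d => overlap (val c) (val d) `*` setT)
    (fun c d => tangent0 (overlap (val c) (val d)) (transition (val c) (val d))).

Definition tangent_bundle : topologicalType := glued tb_gluing.

Definition tb_in (c : atlas M) (a : V * V) : tangent_bundle :=
  @glued_in tb_gluing c a.

Definition tb_base (g : tangent_bundle) : T :=
  let: (c, (x, v)) := glued_rep g in bwd (val c) x.

Definition tb_zero (p : T) : tangent_bundle :=
  let c := sval (cid (atlas_at p)) in tb_in c (fwd (val c) p, 0).

Definition tb_opp (g : tangent_bundle) : tangent_bundle :=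
  let: (c, (x, v)) := glued_rep g in tb_in c (x, - v).

Definition tb_sum (g' g h : tangent_bundle) : Prop :=
  exists c x v v',
    [/\ cod (val c) x, g = tb_in c (x, v), g' = tb_in c (x, v')
      & h = tb_in c (x, v' + v)].

Definition tb_add (g' g : tangent_bundle) : tangent_bundle :=
  xget g (tb_sum g' g).

Definition tb_groupoid : groupoid_data T tangent_bundle :=
  GroupoidData setT setT tb_base tb_base tb_zero tb_add tb_opp.

End Extension.

(** [F : M^{1} -> N^{1}] is a continuous groupoid morphism of the first kind
    over [f x id]. *)
Definition first_kind (K : topRingType) (V W : rightTopModType K)
    (TM TN : topologicalType) (M : manifold V TM) (N : manifold W TN)
    (f : TM -> TN) (F : ext M -> ext N) : Prop :=
  continuous_morphism (ext_groupoid M) (ext_groupoid N)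
    (fun p : TM * K => (f p.1, p.2)) F.

(* Main.v *)
(** The units being dense, a continuous difference factorizer on an open set is
    determined by difference quotients with invertible denominators.  This
    uniqueness yields the chain rule [(g \o f)^{1} = g^{1} \o f^{1}], hence the
    cocycle property of the transition maps [phi_ij^{1}] and the embedding of
    each [V_i^{1}] as an open subset of [M^{1}], namely the arrows whose source
    and target lie in the chart [i]; and it yields
    [f^[1](x, v' + v, t) = f^[1](x + vt, v', t) + f^[1](x, v, t)], so that the
    [phi_ij^{1}], and [f^{1}] for every [f] of class C^1, respect the local
    composition.  Conversely, the second component of a continuous morphism over
    [f x id] is, in charts, a continuous difference factorizer of [f].  For
    invertible [t], an arrow over [t] is determined by its source and target.

    All the groupoid operations are computed in a chart containing the points
    involved.  Over a field such charts exist: charts with disjoint domains can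
    be translated to have disjoint images, and their union is a chart, as a
    difference factorizer between two disjoint open sets is just a difference
    quotient. *)
From Pilot Require Import Defs.
From HB Require Import structures.
From mathcomp Require Import all_boot all_order all_algebra.
From mathcomp Require Import all_classical.
From mathcomp Require Import topology.

Set Implicit Arguments.
Unset Strict Implicit.
Unset Printing Implicit Defensive.

Import GRing.Theory.
(* [index], [glue], [comp] and [inv] are also names of MathComp constants. *)
Import Pilot.Defs.

Local Open Scope classical_set_scope.
Local Open Scope ring_scope.

(** * Continuity within a set *)

(** Composition, addition of tangent vectors and [f^{1}] are picked by choice among the values
    computed in charts, so each needs a proof that all charts give the same value. [slope] is itself
    a choice and depends on the set on which it is taken; such comparisons therefore go through an
    open set contained in all the domains involved. The main obstacle is that class C^1 is not
    local. A projection of a product is visibly C^1 in product charts, but a product atlas contains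
    other charts as well. Hence [f^{1}] is built from a supply of good pairs of charts, one around
    any three points, instead of from [C1_map]; three points are what one composition consumes
    (source, middle point, target). The product isomorphism is then the pair of the two extended
    projections. The tangent bundle is treated as the level [t = 0], where both ends of an arrow
    coincide, and its group laws are pulled back along the injection into [M^{1}]. When charts are
    united over a field, the translation must avoid two points at once. This needs a third point in
    [V], which density of the units provides. *)

Section WithinContinuity.
Variables X Y Z : topologicalType.

Lemma within_continuous_comp (A : set X) (B : set Y) (f : X -> Y) (g : Y -> Z) :
  {within A, continuous f} -> {within B, continuous g} -> set_fun A B f ->
  {within A, continuous (fun x => g (f x))}.
Proof.
move=> /subspace_continuousP fc /subspace_continuousP gc fAB.
apply/subspace_continuousP => x Ax.
move=> C gC.
have H : nbhs x (fun y => A y -> B (f y) -> C (g (f y))).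
  exact: fc x Ax _ (gc _ (fAB _ Ax) C gC).
change (nbhs x (fun y => A y -> C (g (f y)))).
by apply: filterS H => y h Ay; exact: h (fAB _ Ay).
Qed.

Lemma within_continuousT_comp (A : set X) (f : X -> Y) (g : Y -> Z) :
  {within A, continuous f} -> continuous g ->
  {within A, continuous (fun x => g (f x))}.
Proof.
move=> fc gc; apply: (@within_continuous_comp A setT) => //.
exact: continuous_subspaceT.
Qed.

Lemma within_continuous_pair (A : set X) (f : X -> Y) (g : X -> Z) :
  {within A, continuous f} -> {within A, continuous g} ->
  {within A, continuous (fun x => (f x, g x))}.
Proof.
move=> /subspace_continuousP fc /subspace_continuousP gc.
by apply/subspace_continuousP => x Ax; apply: cvg_pair; [exact: fc|exact: gc].
Qed.

Lemma within_continuous_id (A : set X) : {within A, continuous (fun x => x)}.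
Proof. by apply: continuous_subspaceT => x; exact: cvg_id. Qed.

Lemma within_continuous_cst (A : set X) (y : Y) :
  {within A, continuous (fun=> y)}.
Proof. by apply: continuous_subspaceT => x; exact: cvg_cst. Qed.

Lemma within_continuous_eq (A : set X) (f g : X -> Y) :
  (forall x, A x -> f x = g x) ->
  {within A, continuous f} -> {within A, continuous g}.
Proof. by move=> fg; apply: subspace_eq_continuous => x /set_mem; exact: fg. Qed.

Lemma within_continuous_local (A : set X) (f : X -> Y) :
  (forall x, A x ->
     exists O, [/\ open O, O x & {within A `&` O, continuous f}]) ->
  {within A, continuous f}.
Proof.
move=> loc; apply/subspace_continuousP => x Ax.
have [O [Oo Ox /subspace_continuousP/(_ x (conj Ax Ox)) fc]] := loc x Ax.
move=> C /fc h.
change (nbhs x (fun y => A y -> C (f y))).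
have {}h : nbhs x (fun y => (A `&` O) y -> C (f y)) by exact: h.
have : nbhs x O by exact: open_nbhs_nbhs.
by apply: filterS2 h => y h Oy Ay; exact: h.
Qed.

Lemma within_preimage_open (A : set X) (f : X -> Y) (B : set Y) :
  open A -> {within A, continuous f} -> open B -> open (A `&` f @^-1` B).
Proof.
by move=> Ao fc Bo; move: B Bo; apply/(continuous_inP f Ao); rewrite -continuous_open_subspace.
Qed.

End WithinContinuity.

Lemma within_continuous_fst (X Y Z : topologicalType) (A : set X)
    (f : X -> Y * Z) :
  {within A, continuous f} -> {within A, continuous (fun x => (f x).1)}.
Proof.
by move=> fc; apply: within_continuousT_comp fc _ => x; exact: cvg_fst.
Qed.

Lemma within_continuous_snd (X Y Z : topologicalType) (A : set X)
    (f : X -> Y * Z) :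
  {within A, continuous f} -> {within A, continuous (fun x => (f x).2)}.
Proof.
by move=> fc; apply: within_continuousT_comp fc _ => x; exact: cvg_snd.
Qed.

Section ModuleContinuity.
Variables (K : topRingType) (V : rightTopModType K) (X : topologicalType).
Implicit Types (A : set X).

Lemma within_continuous_add A (f g : X -> V) :
  {within A, continuous f} -> {within A, continuous g} ->
  {within A, continuous (fun x => f x + g x)}.
Proof.
move=> fc gc; apply: (within_continuousT_comp
  (f := fun x => (f x, g x)) (g := fun p => p.1 + p.2)).
  exact: within_continuous_pair.
exact: rmod_add_continuous.
Qed.

Lemma within_continuous_opp A (f : X -> V) :
  {within A, continuous f} -> {within A, continuous (fun x => - f x)}.
Proof.
move=> fc; apply: (within_continuousT_comp (g := fun p : V => - p)) => //.
exact: rmod_opp_continuous.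
Qed.

Lemma within_continuous_rscale A (f : X -> V) (g : X -> K) :
  {within A, continuous f} -> {within A, continuous g} ->
  {within A, continuous (fun x => f x *^ g x)}.
Proof.
move=> fc gc; apply: (within_continuousT_comp
  (f := fun x => (f x, g x)) (g := fun p : V * K => p.1 *^ p.2)).
  exact: within_continuous_pair.
exact: rmod_scale_continuous.
Qed.

End ModuleContinuity.

Section RightScaling.
Variables (K : topRingType) (V : rightTopModType K).
Implicit Types (u v : V) (s t : K).

Lemma rscaleDl u v t : (u + v) *^ t = u *^ t + v *^ t.
Proof. exact: scalerDr. Qed.

Lemma rscaleNl v t : (- v) *^ t = - (v *^ t).
Proof. exact: scalerN. Qed.

Lemma rscale0l t : (0 : V) *^ t = 0.
Proof. exact: scaler0. Qed.

Lemma rscale0r v : v *^ 0 = 0.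
Proof. exact: scale0r. Qed.

Lemma rscale1r v : v *^ 1 = v.
Proof. exact: scale1r. Qed.

Lemma rscaleA v s t : v *^ s *^ t = v *^ (s * t).
Proof. exact: scalerA. Qed.

Lemma rscale_unit_inj u v t : units t -> u *^ t = v *^ t -> u = v.
Proof.
move=> [s [_ ts]] /(congr1 (fun w => w *^ s)).
by rewrite !rscaleA ts !rscale1r.
Qed.

End RightScaling.

Ltac within_cont := repeat first
  [ assumption
  | exact: within_continuous_id | exact: within_continuous_cst
  | apply: within_continuous_add
  | apply: within_continuous_opp
  | apply: within_continuous_rscale
  | apply: within_continuous_pair
  | apply: within_continuous_fst
  | apply: within_continuous_snd
  | exact: (within_continuous_fst (f := fun x => x) (within_continuous_id _))
  | exact: (within_continuous_snd (f := fun x => x) (within_continuous_id _)) ].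

Lemma open_setX (X Y : topologicalType) (A : set X) (B : set Y) :
  open A -> open B -> open (A `*` B).
Proof.
move=> Ao Bo; have -> : A `*` B = (setT `&` fst @^-1` A) `&` (setT `&` snd @^-1` B).
  by rewrite !setTI.
by apply: openI; (apply: within_preimage_open; [exact: openT| |by []]); within_cont.
Qed.

Section Extension1.
Variables (K : topRingType) (V : rightTopModType K).
Implicit Types (U : set V) (a : V * V * K).

Lemma ext1_open U : open U -> open (ext1 U).
Proof.
move=> Uo.
have -> : ext1 U = (setT `&` (fun p => p.1.1) @^-1` U)
    `&` (setT `&` (fun p => p.1.1 + p.1.2 *^ p.2) @^-1` U).
  by rewrite !setTI.
by apply: openI; (apply: within_preimage_open; [exact: openT| |exact: Uo]);
  within_cont.
Qed.

Lemma ext1_sub U U' : U `<=` U' -> ext1 U `<=` ext1 U'.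
Proof. by move=> UU' a [/UU' ? /UU' ?]. Qed.

Lemma ext1I U U' : ext1 (U `&` U') = ext1 U `&` ext1 U'.
Proof. by apply/seteqP; split => a [] [? ?] [? ?]. Qed.

End Extension1.

(** Every neighbourhood of [a] contains a point [(a.1, t)] with [t] a unit. There [t] cancels and
    the two maps agree, so any neighbourhoods of [f a] and [g a] meet, and [W] is Hausdorff. Only
    the scalar coordinate is moved. *)
Lemma eq_within_units (K : topRingType) (W : rightTopModType K)
    (X : topologicalType) (A : set (X * K)) (f g : X * K -> W) :
  dense (@units K) -> hausdorff_space W -> open A ->
  {within A, continuous f} -> {within A, continuous g} ->
  (forall x t, A (x, t) -> units t -> f (x, t) *^ t = g (x, t) *^ t) ->
  forall a, A a -> f a = g a.
Proof.
move=> Kd Wh Ao fc gc fg a Aa; apply: Wh => B C fB gC.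
move: fc gc; rewrite !(continuous_open_subspace _ Ao).
move=> /(_ a (mem_set Aa)) fc /(_ a (mem_set Aa)) gc.
have nA : nbhs a A by exact: open_nbhs_nbhs.
have : nbhs a (f @^-1` B `&` g @^-1` C `&` A).
  by apply: filterI => //; apply: filterI; [exact: fc|exact: gc].
case=> [[P Q] /= [Pa Qa]] PQ.
have [t [Qt ut]] : (Q° `&` @units K) !=set0.
  apply: Kd; last exact: open_interior.
  by exists a.2; exact: Qa.
have [[Bf Cg] Aat] : (f @^-1` B `&` g @^-1` C `&` A) (a.1, t).
  by apply: PQ; split=> /=; [exact: nbhs_singleton|exact: interior_subset].
exists (f (a.1, t)); split=> //.
by rewrite /preimage /= (rscale_unit_inj ut (fg _ _ Aat ut)).
Qed.

Lemma homeomorphism_id (X : topologicalType) (A : set X) : homeomorphism A A id.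
Proof. by exists id; split=> //; split; exact: within_continuous_id. Qed.

(** * Difference factorizers *)

Section Factorizers.
Variable K : topRingType.
Hypothesis units_dense : dense (@units K).
Implicit Types V W Z : rightTopModType K.

Definition ext1_end V (a : V * V * K) : V := a.1.1 + a.1.2 *^ a.2.

Lemma slopeP V W (U : set V) (f : V -> W) :
  C1_on U f -> continuous_factorizers U f (slope U f).
Proof. exact: xgetPex. Qed.

Lemma factorizer_sub V W (U O : set V) (f : V -> W) f1 :
  O `<=` U -> continuous_factorizers U f f1 -> continuous_factorizers O f f1.
Proof.
move=> OU [df cf]; split; first by move=> x v t /(ext1_sub OU); exact: df.
exact: continuous_subspaceW (ext1_sub OU) cf.
Qed.

Lemma factorizer_eq V W (U : set V) (f g : V -> W) f1 :
  (forall x, U x -> f x = g x) ->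
  continuous_factorizers U f f1 -> continuous_factorizers U g f1.
Proof.
move=> fg [df cf]; split=> // x v t xvt.
by case: (xvt) => /= Ux Uy; rewrite -!fg//; exact: df.
Qed.

Lemma factorizer_end V W (U : set V) (f : V -> W) f1 a :
  continuous_factorizers U f f1 -> ext1 U a ->
  f (ext1_end a) = f a.1.1 + f1 a *^ a.2.
Proof. by case: a => -[x v] t [df _] Ua; rewrite -df // addrC subrK. Qed.

Lemma factorizer_unique V W (O : set V) (f g : V -> W) f1 g1 :
  hausdorff_space W -> open O ->
  continuous_factorizers O f f1 -> continuous_factorizers O g g1 ->
  (forall x, O x -> f x = g x) -> forall a, ext1 O a -> f1 a = g1 a.
Proof.
move=> Wh Oo ff1 gg1 fg.
apply: (eq_within_units units_dense Wh (ext1_open Oo) ff1.2 gg1.2).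
move=> -[x v] t xvt _; case: (xvt) => /= Ox Oy.
by rewrite -ff1.1 // -gg1.1 // !fg.
Qed.

(** At [t = 1] the factorizer gives [f y = f x + f1 (x, y - x, 1)]. One base point [x] serves all of
    [U], since every [y] in [U] is reached from it by the direction [y - x]. *)
Lemma factorizer_continuous V W (U : set V) (f : V -> W) f1 :
  continuous_factorizers U f f1 -> {within U, continuous f}.
Proof.
move=> [df cf]; have [[x Ux]|U0] := pselect (U !=set0); last first.
  apply: (within_continuous_eq (Y := W) (f := fun=> 0)) => [x Ux|].
    by case: U0; exists x.
  exact: within_continuous_cst.
have Uext y : U y -> ext1 U (x, y - x, 1).
  by move=> Uy; split=> //=; rewrite rscale1r addrC subrK.
apply: (within_continuous_eq (X := V) (Y := W) (f := fun y => f x + f1 (x, y - x, 1))).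
  move=> y Uy; rewrite -[f1 _](rscale1r (f1 (x, y - x, 1))) -df; last exact: Uext.
  by rewrite rscale1r [x + _]addrC subrK [f x + _]addrC subrK.
apply: within_continuous_add; first exact: within_continuous_cst.
apply: (within_continuous_comp (B := ext1 U)) cf _ => //.
by within_cont.
Qed.

(** The increment of [f] is [f1 a] scaled by the same [t], so [(f x, f1 a, t)] is again an
    admissible triple, now for [g]. This is the chain rule, without any limit. *)
Lemma factorizer_comp V W Z (U : set V) (U' : set W) (f : V -> W) (g : W -> Z)
    f1 g1 :
  continuous_factorizers U f f1 -> continuous_factorizers U' g g1 ->
  set_fun U U' f ->
  continuous_factorizers U (fun x => g (f x))
    (fun a => g1 (f a.1.1, f1 a, a.2)).
Proof.
move=> ff1 gg1 fU; have UU' a : ext1 U a -> ext1 U' (f a.1.1, f1 a, a.2).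
  move=> Ua; case: (Ua) => Ux Uy; split; first exact: fU.
  by rewrite /= -(factorizer_end ff1 Ua); exact: fU.
split=> [x v t xvt|].
  rewrite -gg1.1; last exact: (UU' (x, v, t)).
  by rewrite -(factorizer_end ff1 xvt).
apply: (within_continuous_comp (B := ext1 U')) gg1.2 UU'.
apply: within_continuous_pair; last by within_cont.
apply: within_continuous_pair; last exact: ff1.2.
apply: (within_continuous_comp (B := U)) (factorizer_continuous ff1) _.
  by within_cont.
by move=> a [].
Qed.

Lemma factorizer_id V (U : set V) : continuous_factorizers U id (fun a => a.1.2).
Proof. by split; [move=> x v t _; rewrite addrC addKr|within_cont]. Qed.

Lemma factorizer_prod V W V' W' (U : set V) (U' : set W) (f : V -> V')
    (g : W -> W') f1 g1 :
  continuous_factorizers U f f1 -> continuous_factorizers U' g g1 ->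
  continuous_factorizers (U `*` U') (fun z => (f z.1, g z.2))
    (fun a => (f1 (a.1.1.1, a.1.2.1, a.2), g1 (a.1.1.2, a.1.2.2, a.2))).
Proof.
move=> ff1 gg1; split=> [[x y] [v w] t [[/= Ux Uy] [/= Ux' Uy']]|].
  by apply/pair_equal_spec; split; [exact: ff1.1|exact: gg1.1].
apply: within_continuous_pair.
  apply: (within_continuous_comp (B := ext1 U)) ff1.2 _; first by within_cont.
  by move=> [[[x y] [v w]] t] [[/= Ux Uy] [/= Ux' Uy']].
apply: (within_continuous_comp (B := ext1 U')) gg1.2 _; first by within_cont.
by move=> [[[x y] [v w]] t] [[/= Ux Uy] [/= Ux' Uy']].
Qed.

Lemma C1_on_sub V W (U O : set V) (f : V -> W) :
  O `<=` U -> C1_on U f -> C1_on O f.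
Proof. by move=> OU [f1 h]; exists f1; exact: factorizer_sub OU h. Qed.

Lemma C1_on_eq V W (U : set V) (f g : V -> W) :
  (forall x, U x -> f x = g x) -> C1_on U f -> C1_on U g.
Proof. by move=> fg [f1 h]; exists f1; exact: factorizer_eq fg h. Qed.

Lemma C1_on_comp V W Z (U : set V) (U' : set W) (f : V -> W) (g : W -> Z) :
  C1_on U f -> C1_on U' g -> set_fun U U' f -> C1_on U (fun x => g (f x)).
Proof.
move=> [f1 hf] [g1 hg] fU; exists (fun a => g1 (f a.1.1, f1 a, a.2)).
exact: factorizer_comp hf hg fU.
Qed.

Lemma C1_on_id V (U : set V) : C1_on U id.
Proof. by exists (fun a => a.1.2); exact: factorizer_id. Qed.

Lemma C1_on_prod V W V' W' (U : set V) (U' : set W) (f : V -> V') (g : W -> W') :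
  C1_on U f -> C1_on U' g -> C1_on (U `*` U') (fun z => (f z.1, g z.2)).
Proof.
by move=> [f1 hf] [g1 hg]; eexists; exact: factorizer_prod hf hg.
Qed.

Lemma tangent1_end V W (U : set V) (f : V -> W) a :
  C1_on U f -> ext1 U a -> ext1_end (tangent1 U f a) = f (ext1_end a).
Proof. by move=> /slopeP ff1 Ua; rewrite (factorizer_end ff1 Ua). Qed.

Lemma ext1_tangent1 V W (U : set V) (U' : set W) (f : V -> W) a :
  C1_on U f -> set_fun U U' f -> ext1 U a -> ext1 U' (tangent1 U f a).
Proof.
move=> fC fU Ua; case: (Ua) => Ux Uy; split; first exact: fU.
by rewrite -/(ext1_end (tangent1 U f a)) tangent1_end //; exact: fU.
Qed.

Lemma tangent1_continuous V W (U : set V) (f : V -> W) :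
  C1_on U f -> {within ext1 U, continuous (tangent1 U f)}.
Proof.
move=> /slopeP ff1.
apply: within_continuous_pair; last by within_cont.
apply: within_continuous_pair; last exact: ff1.2.
apply: (within_continuous_comp (B := U)) (factorizer_continuous ff1) _.
  by within_cont.
by move=> a [].
Qed.

Section Hausdorff.
Variables (W : rightTopModType K) (W_hausdorff : hausdorff_space W).

(** Makes the chosen [slope] computable: on an open [O] it may be replaced by any continuous
    factorizer of any map that agrees with [f] on [O]. *)
Lemma tangent1_factorizer V (U O : set V) (f g : V -> W) g1 a :
  open O -> O `<=` U -> C1_on U f -> (forall x, O x -> f x = g x) ->
  continuous_factorizers O g g1 -> ext1 O a ->
  tangent1 U f a = (g a.1.1, g1 a, a.2).
Proof.
move=> Oo OU /slopeP/(factorizer_sub OU) hf fg hg Oa.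
by rewrite /tangent1 (factorizer_unique W_hausdorff Oo hf hg fg Oa) fg //; case: Oa.
Qed.

(** Each of the three maps keeps the domain on which its own slope is taken; they are compared only
    on a common open [O]. This is the form needed for transition maps, whose domains are different
    overlaps. *)
Lemma tangent1_comp V Z (O U'' : set V) (U' : set Z) (h : V -> W)
    (g : Z -> W) (U : set V) (f : V -> Z) a :
  open O -> O `<=` U -> set_fun O U' f -> O `<=` U'' ->
  C1_on U f -> C1_on U' g -> C1_on U'' h ->
  (forall x, O x -> h x = g (f x)) -> ext1 O a ->
  tangent1 U'' h a = tangent1 U' g (tangent1 U f a).
Proof.
move=> Oo OU fOU' OU'' /slopeP/(factorizer_sub OU) hf /slopeP hg hC hE.
exact: (tangent1_factorizer Oo OU'' hC hE (factorizer_comp hf hg fOU')).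
Qed.

End Hausdorff.

Lemma tangent1_id V (U O : set V) (f : V -> V) a :
  hausdorff_space V -> open O -> O `<=` U -> C1_on U f ->
  (forall x, O x -> f x = x) -> ext1 O a -> tangent1 U f a = a.
Proof.
move=> Vh Oo OU fC fE Oa.
rewrite (tangent1_factorizer Vh Oo OU fC fE (factorizer_id _) Oa).
by case: a {Oa} => -[].
Qed.

Lemma ext1_endD V (x v v' : V) t : x + (v' + v) *^ t = x + v *^ t + v' *^ t.
Proof. by rewrite rscaleDl [v' *^ t + _]addrC addrA. Qed.

Lemma ext1_endN V (x v : V) t : x + v *^ t + (- v) *^ t = x.
Proof. by rewrite rscaleNl addrK. Qed.

Lemma ext1_0 V (U : set V) x t : U x -> ext1 U (x, 0, t).
Proof. by split; rewrite //= rscale0l addr0. Qed.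

Lemma local_groupoidP V (U : set V) : is_groupoid (local_groupoid U).
Proof.
split=> /=.
- by move=> g [].
- by move=> g [].
- by move=> [x t] [/= Ux _]; exact: ext1_0.
- move=> [[x' v'] t'] [[x v] t] [/= [/= Ux' Uy'] [/= Ux Uy]] [? ?]; subst.
  by split; rewrite //= ext1_endD.
- by move=> [[x v] t] [/= Ux Uy]; split; rewrite //= ext1_endN.
- by case.
- by case=> x t _; rewrite rscale0l addr0.
- by move=> [[x' v'] t'] [[x v] t] _.
- move=> [[x' v'] t'] [[x v] t] [/= [/= Ux' Uy'] [/= Ux Uy]] [? ?]; subst.
  by rewrite ext1_endD.
- by case=> -[].
- by case=> -[x v] t _; rewrite ext1_endN.
- by move=> *; rewrite /= addrA.
- by case=> -[x v] t _; rewrite /= add0r.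
- by case=> -[x v] t _; rewrite /= addr0.
- by case=> -[x v] t _; rewrite /= addNr.
- by case=> -[x v] t _; rewrite /= addrN.
Qed.

(** * Additivity of the slope along composable arrows *)

Section SlopeCocycle.
Variables (V W : rightTopModType K) (W_hausdorff : hausdorff_space W).
Variables (U : set V) (f : V -> W).
Hypotheses (U_open : open U) (fC1 : C1_on U f).

(** Scaled by [t], both sides become the telescoping difference [f (x + v *^ t + v' *^ t) - f x]. To
    cancel [t] when it is not a unit, the whole composable pair is varied over an open set and
    [eq_within_units] is applied. *)
Lemma slopeD x v v' t :
  ext1 U (x, v, t) -> ext1 U (x + v *^ t, v', t) ->
  slope U f (x, v' + v, t) = slope U f (x + v *^ t, v', t) + slope U f (x, v, t).
Proof.
move=> Uv Uv'; have [df cf] := slopeP fC1.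
(* A quadruple [(x, v, v', t)] encodes a composable pair of arrows: [g3] is the first arrow, [g2]
   the second, [g1] their composite. *)
pose A := [set a : V * V * V * K | ext1 U (a.1.1.1, a.1.1.2, a.2)]
  `&` [set a : V * V * V * K | ext1 U (a.1.1.1 + a.1.1.2 *^ a.2, a.1.2, a.2)].
pose g1 (a : V * V * V * K) := (a.1.1.1, a.1.2 + a.1.1.2, a.2).
pose g2 (a : V * V * V * K) := (a.1.1.1 + a.1.1.2 *^ a.2, a.1.2, a.2).
pose g3 (a : V * V * V * K) := (a.1.1.1, a.1.1.2, a.2).
have A1 : set_fun A (ext1 U) g1.
  by move=> a [[/= ? ?] [/= ? ?]]; split; rewrite //= ext1_endD.
have A2 : set_fun A (ext1 U) g2 by move=> a [].
have A3 : set_fun A (ext1 U) g3 by move=> a [].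
apply: (@eq_within_units K W _ A (fun a => slope U f (g1 a))
  (fun a => slope U f (g2 a) + slope U f (g3 a)) units_dense W_hausdorff
  _ _ _ _ (x, v, v', t)) => //.
- have -> : A = (setT `&` g3 @^-1` ext1 U) `&` (setT `&` g2 @^-1` ext1 U).
    by rewrite !setTI.
  by apply: openI; (apply: within_preimage_open; [exact: openT| |exact: ext1_open]);
    within_cont.
- by apply: within_continuous_comp cf A1; within_cont.
- by apply: within_continuous_add;
    [apply: within_continuous_comp cf A2|apply: within_continuous_comp cf A3];
    within_cont.
move=> [[y w] w'] s [Uw Uw'] _; have Uww' := A1 (y, w, w', s) (conj Uw Uw').
rewrite /= rscaleDl -!df //=; rewrite /= in Uw Uw' Uww'.
by rewrite ext1_endD addrA subrK.
Qed.

(** Additivity for the composite of a unit with itself makes the slope equal to its own double. *)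
Lemma slope0 x t : U x -> slope U f (x, 0, t) = 0.
Proof.
move=> Ux; have h := ext1_0 t Ux.
have := @slopeD x 0 0 t h; rewrite rscale0l !addr0 => /(_ h) e.
by apply: (addrI (slope U f (x, 0, t))); rewrite addr0 -e.
Qed.

Lemma slopeN x v t :
  ext1 U (x, v, t) -> slope U f (x + v *^ t, - v, t) = - slope U f (x, v, t).
Proof.
move=> Uv; case: (Uv) => /= Ux Uy; apply/eqP; rewrite -addr_eq0 -slopeD //.
  by rewrite addNr slope0.
by split; rewrite //= ext1_endN.
Qed.

Lemma tangent1_morphism :
  is_morphism (local_groupoid U) (local_groupoid [set: W])
    (fun p : V * K => (f p.1, p.2)) (tangent1 U f).
Proof.
split=> //=.
- by move=> a Ua; congr (_, _); exact: tangent1_end.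
- by move=> x [Ux _]; rewrite /tangent1 slope0.
- move=> [[x' v'] t'] [[x v] t] [/= Ux' Ux] [? ?]; subst.
  by rewrite /tangent1 /= slopeD.
Qed.

End SlopeCocycle.

End Factorizers.

(** * Glued spaces *)

(** A [gluing] by itself only asks for nonempty pieces. These conditions make [glue_class] the class
    of an equivalence relation and each piece an open subspace of the quotient. *)
Record is_gluing (D : gluing) : Prop := IsGluing {
  piece_open : forall i : index D, open (piece i);
  glue_dom_open : forall i j : index D, open (glue_dom i j);
  glue_dom_piece : forall (i j : index D) b, glue_dom i j b -> piece j b;
  glue_piece : forall (i j : index D) b, glue_dom i j b -> piece i (glue i j b);
  glue_continuous : forall i j : index D,
    {within glue_dom i j, continuous (glue i j)};
  glue_refl : forall (i : index D) a, piece i a ->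
    glue_dom i i a /\ glue i i a = a;
  glue_sym : forall (i j : index D) b, glue_dom i j b ->
    glue_dom j i (glue i j b) /\ glue j i (glue i j b) = b;
  glue_trans : forall (i j k : index D) c, glue_dom j k c ->
    glue_dom i j (glue j k c) ->
    glue_dom i k c /\ glue i k c = glue i j (glue j k c)
}.

Section GluedSpace.
Variables (D : gluing) (DG : is_gluing D).
Implicit Types (i j : index D) (a b : model D) (g h : glued D) (X : topologicalType).

Lemma glued_val_inj g h : sval g = sval h -> g = h.
Proof. by case: g h => [A p] [B q] /=; exact: eq_exist. Qed.

Lemma in_piece_id i a : piece i a -> in_piece i a = a.
Proof. by rewrite /in_piece; case: pselect. Qed.

(** A point of the quotient is a set of pairs, so equality is tested on the pair [(i, a)], which
    lies in its own class by reflexivity. The converse is symmetry and transitivity of the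
    gluing. *)
Lemma glued_in_eqP i j a b : piece i a -> piece j b ->
  glued_in i a = glued_in j b <-> glue_dom i j b /\ glue i j b = a.
Proof.
move=> ia jb; split=> [/(congr1 (fun g => sval g (i, a)))|[ijb e]].
  rewrite /glued_in /glue_class /= !in_piece_id //= => <-.
  exact: glue_refl.
apply: glued_val_inj; rewrite /= !in_piece_id //; apply/seteqP; split => -[k c] [/= dk e'].
  by rewrite -e in dk e'; have [? ek] := glue_trans DG ijb dk; rewrite /glue_class/= ek.
have [ji ei] := glue_sym DG ijb; rewrite e in ji ei; rewrite -ei in dk e'.
by have [? ek] := glue_trans DG ji dk; rewrite /glue_class/= ek.
Qed.

Lemma glued_repP g :
  piece (glued_rep g).1 (glued_rep g).2 /\
  g = glued_in (glued_rep g).1 (glued_rep g).2.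
Proof.
rewrite /glued_rep; case: cid => -[i a] /= [ia e]; split=> //.
by apply: glued_val_inj; rewrite /= in_piece_id.
Qed.

Lemma gluedP g : exists i a, piece i a /\ g = glued_in i a.
Proof. by eexists; eexists; exact: glued_repP. Qed.

(** The chart of the quotient inverse to [glued_in i], with the junk value [piece_point i] outside
    [glued_dom i]. *)
Definition glued_coord i g : model D :=
  xget (piece_point i) [set a | piece i a /\ glued_in i a = g].

Definition glued_dom i : set (glued D) := glued_in i @` piece i.

Lemma glued_in_inj i a b : piece i a -> piece i b ->
  glued_in i a = glued_in i b -> a = b.
Proof.
move=> ia ib /(glued_in_eqP ia ib) [_ <-].
by have [] := glue_refl DG ib.
Qed.

Lemma glued_coordK i g : glued_dom i g ->
  piece i (glued_coord i g) /\ glued_in i (glued_coord i g) = g.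
Proof.
move=> [a ia e].
by have /(_ (ex_intro _ a (conj ia e))) :=
  @xgetPex _ (piece_point i) [set b | piece i b /\ glued_in i b = g].
Qed.

Lemma glued_inK i a : piece i a -> glued_coord i (glued_in i a) = a.
Proof.
move=> ia; have [//|? e] := @glued_coordK i (glued_in i a); first by exists a.
exact: glued_in_inj e.
Qed.

Lemma glued_in_open i (O : set (model D)) :
  open O -> open (glued_in i @` (piece i `&` O)).
Proof.
move=> Oo; exists [set glued_in i @` (piece i `&` O)]; last exact: bigcup_set1.
by move=> _ ->; apply: finI_from1; exists i, O.
Qed.

Lemma glued_dom_open i : open (glued_dom i).
Proof. by rewrite /glued_dom -[piece i]setIT; apply: glued_in_open; exact: openT. Qed.

(** The image of an open part of piece [j], read in piece [i], is its preimage under [glue j i] on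
    the open set [glue_dom j i], hence open. This settles the subbase. *)
Lemma glued_in_continuous i : {within piece i, continuous (glued_in i)}.
Proof.
have subbase (S : set (glued D)) :
    glued_images S -> open (piece i `&` glued_in i @^-1` S).
  move=> [j [O [Oo ->]]].
  have -> : piece i `&` glued_in i @^-1` (glued_in j @` (piece j `&` O)) =
      glue_dom j i `&` glue j i @^-1` O.
    apply/seteqP; split=> [a [ia [b [jb Ob]]]|a [jia Oa]].
      by move=> /(glued_in_eqP jb ia) [jia e]; rewrite -e in Ob; split.
    have ia := glue_dom_piece DG jia; have ja := glue_piece DG jia.
    split=> //; exists (glue j i a) => //.
    exact/(glued_in_eqP ja ia).
  by apply: within_preimage_open => //; [exact: glue_dom_open|exact: glue_continuous].
rewrite (continuous_open_subspace _ (piece_open DG i)); apply/(continuous_inP _ (piece_open DG i)).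
(* A general open set is a union of finite intersections of subbasic sets: [F] is the family of
   these intersections, [S] a finite family of subbasic sets giving one of them. *)
move=> B [F FI <-]; rewrite preimage_bigcup setI_bigcupr.
apply: bigcup_open => C /FI [S SI <-].
rewrite openE => a [ia Sa]; rewrite /interior.
apply: filterI; first exact: open_nbhs_nbhs (conj (piece_open DG i) ia).
rewrite preimage_bigcap; apply: filter_bigI => T TS.
have To : open (piece i `&` glued_in i @^-1` T).
  by apply: subbase; have := SI T TS; rewrite inE.
apply: (filterS (P := piece i `&` glued_in i @^-1` T)); first by move=> b [].
by apply: open_nbhs_nbhs; split=> //; split=> //; exact: Sa.
Qed.

Lemma glued_coord_continuous i : {within glued_dom i, continuous (glued_coord i)}.
Proof.
rewrite (continuous_open_subspace _ (glued_dom_open i)).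
apply/(continuous_inP _ (glued_dom_open i)) => O Oo.
have -> : glued_dom i `&` glued_coord i @^-1` O = glued_in i @` (piece i `&` O).
  apply/seteqP; split=> [g [/glued_coordK [ig <-]] Og|_ [a [ia Oa] <-]].
    by exists (glued_coord i g) => //; split=> //; rewrite -(glued_inK ig).
  by split; [exists a|rewrite /= glued_inK].
exact: glued_in_open.
Qed.

End GluedSpace.

(** Near [g] the map [F] factors through the continuous coordinate [glued_coord i], so its
    continuity may be checked on representatives in one piece. *)
Lemma glued_continuous (D : gluing) (DG : is_gluing D) (X : topologicalType)
    (A : set (glued D)) (F : glued D -> X) :
  (forall g, A g -> exists2 i, glued_dom i g &
     {within piece i `&` glued_in i @^-1` A, continuous (fun a => F (glued_in i a))}) ->
  {within A, continuous F}.
Proof.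
move=> loc; apply: within_continuous_local => g /loc [i ig Fc].
exists (glued_dom i); split=> //; first exact: glued_dom_open.
apply: (within_continuous_eq (f := fun h => F (glued_in i (glued_coord i h)))).
  by move=> h [_ /glued_coordK [_ ->]].
apply: (within_continuous_comp (B := piece i `&` glued_in i @^-1` A)
  (f := glued_coord i) (g := fun a => F (glued_in i a))) => //.
  by apply: continuous_subspaceW (glued_coord_continuous DG (i := i)) => h [].
by move=> h [Ah /glued_coordK [ih e]]; split=> //; rewrite /= e.
Qed.

(** A product of two glued spaces is not presented as a glued space, hence this form in two
    variables; it serves the continuity of composition. *)
Lemma glued_continuous2 (D E : gluing) (DG : is_gluing D) (EG : is_gluing E)
    (X : topologicalType) (A : set (glued D * glued E)) (F : glued D * glued E -> X) :
  (forall g h, A (g, h) -> exists i j, [/\ glued_dom i g, glued_dom j h &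
     {within [set ab | [/\ piece i ab.1, piece j ab.2 & A (glued_in i ab.1, glued_in j ab.2)]],
      continuous (fun ab => F (glued_in i ab.1, glued_in j ab.2))}]) ->
  {within A, continuous F}.
Proof.
move=> loc; apply: within_continuous_local => -[g h] /loc [i [j [ig jh Fc]]].
exists (glued_dom i `*` glued_dom j).
split=> //; first by apply: open_setX; exact: glued_dom_open.
pose B := [set ab | [/\ piece i ab.1, piece j ab.2 & A (glued_in i ab.1, glued_in j ab.2)]].
apply: (within_continuous_eq
  (f := fun h => F (glued_in i (glued_coord i h.1), glued_in j (glued_coord j h.2)))).
  by move=> [g' h'] [_ [/= /glued_coordK [_ ->] /glued_coordK [_ ->]]].
apply: (within_continuous_comp (B := B)
  (f := fun gh => (glued_coord i gh.1, glued_coord j gh.2))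
  (g := fun ab => F (glued_in i ab.1, glued_in j ab.2))) => //.
  apply: within_continuous_pair.
    apply: (within_continuous_comp (B := glued_dom i)); first by within_cont.
      exact: glued_coord_continuous.
    by move=> gh [_ []].
  apply: (within_continuous_comp (B := glued_dom j)); first by within_cont.
    exact: glued_coord_continuous.
  by move=> gh [_ []].
by move=> [g' h'] [Agh [/= /glued_coordK [ig' e] /glued_coordK [jh' e']]]; split;
  rewrite //= e e'.
Qed.

(** * Charts and the gluing of the extension *)

Section Charts.
Variables (T V : topologicalType).
Implicit Types c d : chart T V.

Lemma chart_fwd c p : is_chart c -> dom c p -> cod c (fwd c p).
Proof. by move=> [_ _ _ [h _ _ _ _]]; exact: h. Qed.

Lemma chart_bwd c x : is_chart c -> cod c x -> dom c (bwd c x).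
Proof. by move=> [_ _ _ [_ h _ _ _]]; exact: h. Qed.

Lemma chart_fwdK c p : is_chart c -> dom c p -> bwd c (fwd c p) = p.
Proof. by move=> [_ _ _ [_ _ h _ _]] cp; apply: h; exact: mem_set. Qed.

Lemma chart_bwdK c x : is_chart c -> cod c x -> fwd c (bwd c x) = x.
Proof. by move=> [_ _ _ [_ _ _ h _]] cx; apply: h; exact: mem_set. Qed.

Lemma chart_dom_open c : is_chart c -> open (dom c).
Proof. by case. Qed.

Lemma chart_cod_open c : is_chart c -> open (cod c).
Proof. by case. Qed.

Lemma chart_fwd_continuous c : is_chart c -> {within dom c, continuous (fwd c)}.
Proof. by case=> _ _ _ [_ _ _ _ []]. Qed.

Lemma chart_bwd_continuous c : is_chart c -> {within cod c, continuous (bwd c)}.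
Proof. by case=> _ _ _ [_ _ _ _ []]. Qed.

Lemma chart_bwd_inj c x y : is_chart c -> cod c x -> cod c y ->
  bwd c x = bwd c y -> x = y.
Proof. by move=> cP cx cy /(congr1 (fwd c)); rewrite !chart_bwdK. Qed.

(** Written as a preimage under [bwd d] instead of an image under [fwd d], the overlap is visibly
    open. *)
Lemma overlapE c d : is_chart d ->
  overlap c d = cod d `&` [set x | dom c (bwd d x)].
Proof.
move=> dP; apply/seteqP; split=> [_ [p [cp dp] <-]|x [dx cx]].
  by split; [exact: chart_fwd|rewrite /= chart_fwdK].
by exists (bwd d x); [split=> //; exact: chart_bwd|exact: chart_bwdK].
Qed.

Lemma overlap_open c d : is_chart c -> is_chart d -> open (overlap c d).
Proof.
move=> cP dP; rewrite overlapE //.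
by apply: (within_preimage_open (f := bwd d));
  [exact: chart_cod_open|exact: chart_bwd_continuous|exact: chart_dom_open].
Qed.

End Charts.

Section LocalRepresentative.
Variables (TM V TN W : topologicalType) (f : TM -> TN).
Implicit Types (c : chart TM V) (d : chart TN W).

Definition local_dom c d : set V := fwd c @` (dom c `&` f @^-1` dom d).

Definition local_map c d : V -> W := fwd d \o f \o bwd c.

Lemma local_domE c d : is_chart c ->
  local_dom c d = cod c `&` [set x | dom d (f (bwd c x))].
Proof.
move=> cP; apply/seteqP; split=> [_ [p [cp dp] <-]|x [cx dx]].
  by split; [exact: chart_fwd|rewrite /= chart_fwdK].
by exists (bwd c x); [split=> //; exact: chart_bwd|exact: chart_bwdK].
Qed.

Lemma local_dom_open c d :
  is_chart c -> is_chart d -> continuous f -> open (local_dom c d).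
Proof.
move=> cP dP fc; rewrite local_domE //.
apply: (within_preimage_open (f := fun x => f (bwd c x))).
- exact: chart_cod_open.
- by apply: within_continuousT_comp fc; exact: chart_bwd_continuous.
- exact: chart_dom_open.
Qed.

End LocalRepresentative.

Section ManifoldExtension.
Variables (K : topRingType) (V : rightTopModType K) (T : topologicalType).
Hypothesis units_dense : dense (@units K).
Hypothesis V_hausdorff : hausdorff_space V.
Variable M : manifold V T.
Implicit Types (c d e : atlas M) (g h : ext M) (a b : V * V * K) (p q : T).

Lemma atlasP c : is_chart (val c).
Proof. exact: atlas_chart (set_mem (valP c)). Qed.

Lemma atlas_pick (c0 : chart T V) : atlas M c0 -> exists c, val c = c0.
Proof. by move=> /mem_set Mc; exists (SigSub Mc). Qed.

Lemma transitionC1 c d :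
  C1_on (overlap (val c) (val d)) (transition (val c) (val d)).
Proof. by have [] := atlas_compatible (set_mem (valP c)) (set_mem (valP d)). Qed.

Definition tangent_transition c d :=
  tangent1 (overlap (val c) (val d)) (transition (val c) (val d)).

Lemma transition_overlap c d :
  set_fun (overlap (val c) (val d)) (overlap (val d) (val c))
    (transition (val c) (val d)).
Proof.
have cP := atlasP c; have dP := atlasP d; rewrite !overlapE // => x [dx cx].
by split; [exact: chart_fwd|rewrite /= chart_fwdK //; exact: chart_bwd].
Qed.

Lemma overlap_sub c d : overlap (val c) (val d) `<=` cod (val d).
Proof. by rewrite (overlapE _ (atlasP d)) => x []. Qed.

Lemma overlap_atlas_open c d : open (overlap (val c) (val d)).
Proof. exact: overlap_open (atlasP c) (atlasP d). Qed.

Lemma bwd_transition c d x : overlap (val c) (val d) x ->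
  bwd (val c) (transition (val c) (val d) x) = bwd (val d) x.
Proof.
by rewrite (overlapE _ (atlasP d)) => -[dx cx]; rewrite chart_fwdK //; exact: atlasP.
Qed.

Lemma ext_gluingP : is_gluing (ext_gluing M).
Proof.
split=> /=.
- by move=> c; apply: ext1_open; exact: chart_cod_open (atlasP c).
- by move=> c d; apply: ext1_open; exact: overlap_atlas_open.
- by move=> c d b; exact: ext1_sub (@overlap_sub c d) b.
- move=> c d b; apply: ext1_tangent1; first exact: transitionC1.
  by move=> x /(@transition_overlap c d) /(@overlap_sub d c).
- by move=> c d; apply: tangent1_continuous; exact: transitionC1.
- move=> c a ca.
  have E : overlap (val c) (val c) = cod (val c).
    rewrite overlapE; last exact: atlasP.
    apply: setIidl.
    by move=> x; exact: chart_bwd (atlasP c).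
  rewrite E; split=> //; apply: (tangent1_id units_dense V_hausdorff) ca => //.
  + exact: chart_cod_open (atlasP c).
  + by rewrite -{1}E; exact: transitionC1.
  + by move=> x cx; rewrite /transition /= chart_bwdK //; exact: atlasP.
- move=> c d b cdb; split.
    by apply: ext1_tangent1 cdb; [exact: transitionC1|exact: transition_overlap].
  (* The two transitions compose to the identity on the overlap. The extension of [id] is inserted
     so that one equality is the chain rule and the other is [tangent1_id]. *)
  transitivity (tangent1 (overlap (val c) (val d)) id b); last first.
    apply: (tangent1_id units_dense V_hausdorff) cdb => //.
      exact: overlap_atlas_open.
    exact: C1_on_id.
  apply/esym; apply: (tangent1_comp units_dense V_hausdorff) cdb => //;
    try by [exact: overlap_atlas_open|exact: transitionC1|exact: C1_on_id].
    exact: transition_overlap.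
  move=> x cdx; rewrite {1}/transition /= (bwd_transition cdx).
  by rewrite chart_bwdK //; [exact: atlasP|exact: overlap_sub cdx].
move=> c d e b deb cdb.
have ce x : overlap (val d) (val e) x ->
    overlap (val c) (val d) (transition (val d) (val e) x) ->
    overlap (val c) (val e) x.
  move=> dex; rewrite !(overlapE _ (atlasP _)) => -[_ /=].
  by rewrite bwd_transition //; split=> //; exact: overlap_sub dex.
(* The part of chart [e] that is also seen by [c] and [d]; the three slopes, taken on three larger
   sets, are compared here. By [ce] and [tangent1_end], both ends of [b] belong to it. *)
pose O := overlap (val d) (val e) `&` overlap (val c) (val e).
have Ob : ext1 O b.
  rewrite ext1I; split=> //; case: (deb) (cdb) => ? ? [? ?]; split; apply: ce => //.
  by have /= <- := tangent1_end (@transitionC1 d e) deb.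
split; first by move: Ob; rewrite ext1I => -[].
apply: (tangent1_comp units_dense V_hausdorff (O := O)) Ob;
  try by [move=> x []|exact: transitionC1|apply: openI; exact: overlap_atlas_open].
  move=> x [dex cex]; move: (cex); rewrite !(overlapE _ (atlasP _)) => -[_ ?].
  split=> /=; last by rewrite bwd_transition.
  exact: overlap_sub (transition_overlap dex).
by move=> x [dex cex]; rewrite {2}/transition /= bwd_transition.
Qed.

End ManifoldExtension.

(** * The structure maps of [M^{1}] read in charts *)

Section ExtensionMaps.
Variables (K : topRingType) (V : rightTopModType K) (T : topologicalType).
Hypothesis units_dense : dense (@units K).
Hypothesis V_hausdorff : hausdorff_space V.
Variable M : manifold V T.
Implicit Types (c d e : atlas M) (g h : ext M) (a b : V * V * K) (p q : T).

Let MG : is_gluing (ext_gluing M) := ext_gluingP units_dense V_hausdorff M.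

Lemma ext_inP c d a b : ext1 (cod (val c)) a -> ext1 (cod (val d)) b ->
  ext_in c a = ext_in d b <->
  ext1 (overlap (val c) (val d)) b /\ tangent_transition c d b = a.
Proof. exact: (@glued_in_eqP _ MG). Qed.

Lemma ext_in_inj c a b : ext1 (cod (val c)) a -> ext1 (cod (val c)) b ->
  ext_in c a = ext_in c b -> a = b.
Proof. exact: (@glued_in_inj _ MG). Qed.

Lemma extP g : exists c a, ext1 (cod (val c)) a /\ g = ext_in c a.
Proof. exact: (@gluedP (ext_gluing M)). Qed.

(** The source of chart independence: what a change of chart preserves here, units and composites,
    is well defined on [M^{1}]. *)
Lemma tangent_transition_morphism c d :
  is_morphism (local_groupoid (overlap (val c) (val d))) (local_groupoid [set: V])
    (fun q : V * K => (transition (val c) (val d) q.1, q.2)) (tangent_transition c d).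
Proof.
exact (tangent1_morphism units_dense V_hausdorff (@overlap_atlas_open _ _ _ M c d)
  (transitionC1 c d)).
Qed.

Lemma ext_in_transition c d b : ext1 (overlap (val c) (val d)) b ->
  ext1 (cod (val c)) (tangent_transition c d b) /\
  ext_in d b = ext_in c (tangent_transition c d b).
Proof.
move=> cdb; have ca := glue_piece MG cdb; split=> //.
by apply/esym/ext_inP => //; exact: ext1_sub (@overlap_sub _ _ _ M c d) _ cdb.
Qed.

Lemma bwd_tangent_transition c d b : ext1 (overlap (val c) (val d)) b ->
  bwd (val c) (tangent_transition c d b).1.1 = bwd (val d) b.1.1 /\
  bwd (val c) (ext1_end (tangent_transition c d b)) = bwd (val d) (ext1_end b).
Proof.
move=> cdb; case: (cdb) => cdx cdy; split; first exact: (bwd_transition cdx).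
by rewrite (tangent1_end (transitionC1 c d) cdb) (bwd_transition cdy).
Qed.

Lemma ext_srcE g : ext_src g =
  (bwd (val (glued_rep g).1) (glued_rep g).2.1.1, (glued_rep g).2.2).
Proof. by rewrite /ext_src; case: glued_rep => c [[x v] t]. Qed.

Lemma ext_tgtE g : ext_tgt g =
  (bwd (val (glued_rep g).1) (ext1_end (glued_rep g).2), (glued_rep g).2.2).
Proof. by rewrite /ext_tgt; case: glued_rep => c [[x v] t]. Qed.

Lemma ext_src_in c a : ext1 (cod (val c)) a ->
  ext_src (ext_in c a) = (bwd (val c) a.1.1, a.2).
Proof.
move=> ca; rewrite ext_srcE; have [pb] := glued_repP (ext_in c a).
move: pb; case: glued_rep => d b /= pb /(ext_inP ca pb) [cdb <-].
by rewrite (bwd_tangent_transition cdb).1.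
Qed.

Lemma ext_tgt_in c a : ext1 (cod (val c)) a ->
  ext_tgt (ext_in c a) = (bwd (val c) (ext1_end a), a.2).
Proof.
move=> ca; rewrite ext_tgtE; have [pb] := glued_repP (ext_in c a).
move: pb; case: glued_rep => d b /= pb /(ext_inP ca pb) [cdb <-].
by rewrite (bwd_tangent_transition cdb).2.
Qed.

Lemma ext_src_tgt2 g : (ext_tgt g).2 = (ext_src g).2.
Proof. by rewrite ext_srcE ext_tgtE. Qed.

(** Membership in [ext1] tests the two ends of a triple and nothing in between. A representative in
    another chart can therefore be moved to [c] once both ends lie in its domain. *)
Lemma ext_in_chart g c :
  dom (val c) (ext_src g).1 -> dom (val c) (ext_tgt g).1 ->
  exists2 a, ext1 (cod (val c)) a & g = ext_in c a.
Proof.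
have [d [b [db ->]]] := extP g; rewrite ext_src_in // ext_tgt_in //= => cx cy.
have cdb : ext1 (overlap (val c) (val d)) b.
  by case: (db) => dx dy; split; rewrite (overlapE _ (atlasP d)).
by have [? ->] := ext_in_transition cdb; exists (tangent_transition c d b).
Qed.

Lemma ext_domP g c : @glued_dom (ext_gluing M) c g <->
  dom (val c) (ext_src g).1 /\ dom (val c) (ext_tgt g).1.
Proof.
split=> [[a ca <-]|[cs ct]].
  have cP := atlasP c; case: (ca) => cx cy.
  by rewrite -/(ext_in c a) ext_src_in // ext_tgt_in //=; split; apply: chart_bwd.
by have [a ca ->] := ext_in_chart cs ct; exists a.
Qed.

Lemma ext_one_in c x t : cod (val c) x ->
  ext_one M (bwd (val c) x, t) = ext_in c (x, 0, t).
Proof.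
move=> cx; rewrite /ext_one /=; case: cid => d /= dx.
set y := fwd (val d) _.
have dP := atlasP d; have cP := atlasP c.
have cdy : overlap (val c) (val d) y.
  exists (bwd (val c) x) => //; split=> //; exact: chart_bwd.
have yE : transition (val c) (val d) y = x.
  by rewrite /transition /= chart_fwdK // chart_bwdK.
apply/esym/ext_inP.
- exact: ext1_0.
- by apply: ext1_0; exact: overlap_sub cdy.
split; first exact: ext1_0.
have := morph_one (tangent_transition_morphism c d) (x := (y, t)) (conj cdy I).
by rewrite /= yE.
Qed.

Lemma ext_inv_in c a : ext1 (cod (val c)) a ->
  ext_inv (ext_in c a) = ext_in c (inv (local_groupoid (cod (val c))) a).
Proof.
move=> ca.
have -> : forall g, ext_inv g = ext_in (glued_rep g).1
    (inv (local_groupoid (cod (val (glued_rep g).1))) (glued_rep g).2).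
  by move=> g; rewrite /ext_inv; case: glued_rep => d [[x v] t].
have [pb] := glued_repP (ext_in c a).
move: pb; case: glued_rep => d [[x v] t] /= pb /(ext_inP ca pb) [cdb <-].
have cdN : ext1 (overlap (val c) (val d)) (x + v *^ t, - v, t).
  by case: cdb => ? ?; split; rewrite //= ext1_endN.
have [_ ->] := ext_in_transition cdN; congr (ext_in c _).
rewrite /tangent_transition /tangent1 /=
  (slopeN units_dense V_hausdorff (@overlap_atlas_open _ _ _ M c d) (transitionC1 c d) cdb).
by have := tangent1_end (transitionC1 c d) cdb; rewrite /ext1_end /tangent1 /= => ->.
Qed.

(** [ext_comp] chooses among the composites computed in all charts. Transitions respect the local
    composition, so all these composites coincide and the choice is forced. *)
Lemma ext_comp_in c a' a :
  composable (local_groupoid (cod (val c))) (a', a) ->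
  ext_comp (ext_in c a') (ext_in c a) =
  ext_in c (comp (local_groupoid (cod (val c))) a' a).
Proof.
case: a' a => -[x' v'] t' [[x v] t] [/= ca' ca [ex et]]; subst x' t'.
rewrite /ext_comp; set P := ext_compose _ _.
have unique h : P h -> h = ext_in c (x, v' + v, t).
  move=> [d [y [w [w' [s [dw dw' eg eg' ->]]]]]].
  have [cdw eT] := (ext_inP ca dw).1 eg; have [cdw' eT'] := (ext_inP ca' dw').1 eg'.
  have cdD : ext1 (overlap (val c) (val d)) (y, w' + w, s).
    by case: cdw cdw' => ? ? [? ?]; split; rewrite //= ext1_endD.
  have [_ ->] := ext_in_transition cdD; congr (ext_in c _).
  have := morph_comp (tangent_transition_morphism c d)
    (g' := (y + w *^ s, w', s)) (g := (y, w, s)) (And3 cdw' cdw erefl).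
  by rewrite eT eT'.
have ex' : P (ext_in c (x, v' + v, t)) by exists c, x, v, v', t.
by apply: unique; exact: (xgetPex _ (ex_intro _ _ ex')).
Qed.

Lemma ext_composable_in c a' a :
  ext1 (cod (val c)) a' -> ext1 (cod (val c)) a ->
  ext_src (ext_in c a') = ext_tgt (ext_in c a) <->
  composable (local_groupoid (cod (val c))) (a', a).
Proof.
move=> ca' ca; rewrite ext_src_in // ext_tgt_in //; split=> [[e1 e2]|[_ _ /= [-> ->]]] //.
split=> //=; congr (_, _) => //.
by apply: (chart_bwd_inj (atlasP c)) e1; [case: ca'|case: ca].
Qed.

Lemma ext_src_continuous : {within setT, continuous (@ext_src _ _ _ M)}.
Proof.
apply: (glued_continuous MG) => g _; have [c [a [ca ->]]] := extP g.
exists c; first by exists a.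
apply: (within_continuous_eq (f := fun a => (bwd (val c) a.1.1, a.2))).
  by move=> b [cb _]; rewrite -/(ext_in c b) ext_src_in.
apply: within_continuous_pair; last by within_cont.
apply: (within_continuous_comp (B := cod (val c)));
  [by within_cont|exact: chart_bwd_continuous (atlasP c)|by move=> b [[]]].
Qed.

Lemma ext_tgt_continuous : {within setT, continuous (@ext_tgt _ _ _ M)}.
Proof.
apply: (glued_continuous MG) => g _; have [c [a [ca ->]]] := extP g.
exists c; first by exists a.
apply: (within_continuous_eq (f := fun a => (bwd (val c) (ext1_end a), a.2))).
  by move=> b [cb _]; rewrite -/(ext_in c b) ext_tgt_in.
apply: within_continuous_pair; last by within_cont.
apply: (within_continuous_comp (B := cod (val c)));
  [by rewrite /ext1_end; within_cont|exact: chart_bwd_continuous (atlasP c)|by move=> b [[]]].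
Qed.

Lemma ext_in_continuous c : {within ext1 (cod (val c)), continuous (ext_in c)}.
Proof. exact: (glued_in_continuous MG). Qed.

Lemma ext_one_continuous : {within setT, continuous (ext_one M)}.
Proof.
apply: within_continuous_local => -[p t] _.
have [c cp] := atlas_at M p; have cP := atlasP c.
exists (dom (val c) `*` setT); split=> //.
  by apply: open_setX; [exact: chart_dom_open|exact: openT].
apply: (within_continuous_eq
  (f := fun q : T * K => ext_in c (fwd (val c) q.1, 0, q.2))).
  move=> [q s] [_ [cq _]]; rewrite -ext_one_in ?chart_fwdK //.
  exact: chart_fwd.
apply: (within_continuous_comp (B := ext1 (cod (val c)))).
- apply: within_continuous_pair; last by within_cont.
  apply: within_continuous_pair; last by within_cont.
  apply: (within_continuous_comp (B := dom (val c))); first by within_cont.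
    exact: chart_fwd_continuous.
  by move=> q [_ []].
- exact: ext_in_continuous.
by move=> [q s] [_ [/= cq _]]; apply: ext1_0; exact: chart_fwd cP cq.
Qed.

Lemma ext_inv_continuous : {within setT, continuous (@ext_inv _ _ _ M)}.
Proof.
apply: (glued_continuous MG) => g _; have [c [a [ca ->]]] := extP g.
exists c; first by exists a.
apply: (within_continuous_eq
    (f := fun a => ext_in c (inv (local_groupoid (cod (val c))) a))).
  by move=> b [cb _]; rewrite -/(ext_in c b) ext_inv_in.
apply: (within_continuous_comp (B := ext1 (cod (val c)))).
- by rewrite /=; within_cont.
- exact: ext_in_continuous.
by move=> b [cb _]; exact (inv_mor (local_groupoidP (cod (val c))) cb).
Qed.

(** In a common chart, the second components of the two arrows have the same
    product with the third component. *)
Lemma ext_eq_dense (X : topologicalType) (A : set (X * K)) (F G : X * K -> ext M) :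
  (forall p q : T, exists c, dom (val c) p /\ dom (val c) q) ->
  open A -> {within A, continuous F} -> {within A, continuous G} ->
  (forall z, A z -> ext_src (F z) = ext_src (G z) /\ ext_tgt (F z) = ext_tgt (G z)) ->
  (forall z, A z -> (ext_src (F z)).2 = z.2) ->
  forall z, A z -> F z = G z.
Proof.
move=> common Ao Fc Gc FG F2 z Az.
have [c [cp cq]] := common (ext_src (F z)).1 (ext_tgt (F z)).1.
pose D := @glued_dom (ext_gluing M) c.
have Do : open D by exact: glued_dom_open.
pose B := A `&` F @^-1` D.
(* Whether an arrow lies in the chart [c] is decided by its ends, which [F] and [G] share; so both
   families enter [D] together. *)
have DP y : A y -> D (F y) -> D (G y).
  by move=> Ay /ext_domP; rewrite (FG y Ay).1 (FG y Ay).2 => ?; exact/ext_domP.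
have Bo : open B by exact: within_preimage_open.
have Bz : B z by split=> //; apply/ext_domP.
pose Fv y : V * V * K := @glued_coord (ext_gluing M) c (F y).
pose Gv y : V * V * K := @glued_coord (ext_gluing M) c (G y).
have Fvc : {within B, continuous Fv}.
  apply: (within_continuous_comp (B := D)) (glued_coord_continuous MG (i := c)) _.
    by apply: continuous_subspaceW Fc => y [].
  by move=> y [].
have Gvc : {within B, continuous Gv}.
  apply: (within_continuous_comp (B := D)) (glued_coord_continuous MG (i := c)) _.
    by apply: continuous_subspaceW Gc => y [].
  by move=> y [Ay /(DP y Ay)].
have FGE y : B y -> [/\ (Fv y).1.1 = (Gv y).1.1, (Fv y).2 = y.2, (Gv y).2 = y.2 &
    (Fv y).1.2 *^ y.2 = (Gv y).1.2 *^ y.2].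
  move=> [Ay Dy]; have [cF eF] := glued_coordK Dy; have [cG eG] := glued_coordK (DP y Ay Dy).
  have [es et] := FG y Ay; have := F2 y Ay; move: es et.
  rewrite -eF -eG -/(Fv y) -/(Gv y) -!/(ext_in c _) !ext_src_in // !ext_tgt_in //.
  move=> [e1 e2] [e3 _] /= e4.
  have cP := atlasP c; case: cF cG => /= Fx Fy [/= Gx Gy].
  have e5 := chart_bwd_inj cP Fx Gx e1; have e6 := chart_bwd_inj cP Fy Gy e3.
  rewrite -e2 e4; split=> //; apply: (addrI (Fv y).1.1).
  by rewrite {2}e5; move: e6; rewrite /ext1_end -e2 e4.
have vE : (Fv z).1.2 = (Gv z).1.2.
  apply: (@eq_within_units K V X B (fun y => (Fv y).1.2) (fun y => (Gv y).1.2)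
    units_dense V_hausdorff Bo _ _ _ z Bz); try by within_cont.
  by move=> x t Bxt _; have [] := FGE _ Bxt.
have [_ <-] := glued_coordK (Bz.2 : D (F z)).
have [_ <-] := glued_coordK (DP z Az Bz.2); congr (@glued_in (ext_gluing M) c _).
rewrite -/(Fv z) -/(Gv z); have [e1 e2 e3 _] := FGE z Bz; move: e1 e2 e3 vE.
by move: (Fv z) (Gv z) => [[x v] t] [[y w] s] /= -> -> -> ->.
Qed.

End ExtensionMaps.

(** * The groupoid structure *)

Lemma composableI (Ob Mor : Type) (G : groupoid_data Ob Mor) g' g :
  mor G g' -> mor G g -> src G g' = tgt G g -> composable G (g', g).
Proof. by []. Qed.

Section ExtensionGroupoid.
Variables (K : topRingType) (V : rightTopModType K) (T : topologicalType).
Hypothesis units_dense : dense (@units K).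
Hypothesis V_hausdorff : hausdorff_space V.
Variable M : manifold V T.
Hypothesis M_common : common_charts M.
Implicit Types (c d e : atlas M) (g h : ext M) (a b : V * V * K) (p q r : T).

Let MG : is_gluing (ext_gluing M) := ext_gluingP units_dense V_hausdorff M.
Let src_in := ext_src_in units_dense V_hausdorff (M := M).
Let tgt_in := ext_tgt_in units_dense V_hausdorff (M := M).

Lemma common_chart p q r :
  exists c, [/\ dom (val c) p, dom (val c) q & dom (val c) r].
Proof.
by have [c [Mc h]] := M_common p q r; exists (SigSub (mem_set Mc)).
Qed.

Lemma ext_in_morphism c :
  is_morphism (local_groupoid (cod (val c))) (ext_groupoid M)
    (fun p : V * K => (bwd (val c) p.1, p.2)) (ext_in c).
Proof.
split=> //.
- by move=> a ca; exact: src_in.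
- by move=> a ca; exact: tgt_in.
- by move=> [x t] [cx _]; apply/esym/ext_one_in.
- by move=> a' a caa; apply/esym/ext_comp_in.
Qed.

Lemma ext_composableP g' g : composable (ext_groupoid M) (g', g) ->
  exists c a' a, [/\ composable (local_groupoid (cod (val c))) (a', a),
    g' = ext_in c a' & g = ext_in c a].
Proof.
move=> [_ _ /= e].
have [c [cp cq cr]] := common_chart (ext_src g).1 (ext_tgt g).1 (ext_tgt g').1.
have [a ca ga] := ext_in_chart units_dense V_hausdorff cp cq.
have [|a' ca' ga'] := ext_in_chart units_dense V_hausdorff (g := g') (c := c) _ cr.
  by rewrite e.
exists c, a', a; split=> //.
by apply/(ext_composable_in units_dense V_hausdorff ca' ca); rewrite -ga -ga'.
Qed.

Lemma ext_src_comp g' g : composable (ext_groupoid M) (g', g) ->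
  ext_src (ext_comp g' g) = ext_src g.
Proof.
move=> /ext_composableP [c [a' [a [h -> ->]]]].
have cc := comp_mor (local_groupoidP _) h; have [_ ca _] := h.
by rewrite ext_comp_in // !src_in.
Qed.

Lemma ext_tgt_comp g' g : composable (ext_groupoid M) (g', g) ->
  ext_tgt (ext_comp g' g) = ext_tgt g'.
Proof.
move=> /ext_composableP [c [a' [a [h -> ->]]]].
have cc := comp_mor (local_groupoidP _) h; have [ca' _ _] := h.
have /= [e1 e2] := tgt_comp (local_groupoidP _) h.
by rewrite ext_comp_in // !tgt_in //= /ext1_end e1 e2.
Qed.

Lemma ext_comp_continuous : {within composable (ext_groupoid M),
  continuous (fun z => ext_comp z.1 z.2)}.
Proof.
apply: (glued_continuous2 MG MG) => g' g /[dup] h /ext_composableP.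
move=> [c [a' [a [[/= ca' ca _] ga' ga]]]].
exists c, c; split; [by exists a'|by exists a|].
set A := [set ab | _].
have AP ab : A ab -> composable (local_groupoid (cod (val c))) ab.
  by case: ab => b' b [/= cb' cb [_ _ e]]; apply/ext_composable_in.
apply: (within_continuous_eq (f := fun ab : (V * V * K) * (V * V * K) =>
    ext_in c (comp (local_groupoid (cod (val c))) ab.1 ab.2))).
  by move=> [b' b] /AP ?; apply/esym/ext_comp_in.
apply: (within_continuous_comp (B := ext1 (cod (val c)))).
- by rewrite /=; within_cont.
- exact: ext_in_continuous.
by move=> [b' b] /AP ?; exact: (comp_mor (local_groupoidP _)).
Qed.

Lemma transition_continuous c d : {within overlap (val c) (val d),
  continuous (transition (val c) (val d))}.
Proof. exact: factorizer_continuous (slopeP (transitionC1 c d)). Qed.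

(** With common charts for three points only, the four points involved need not
    lie in one chart; the general case follows by density. *)
Lemma ext_compA g'' g' g : composable (ext_groupoid M) (g'', g') ->
  composable (ext_groupoid M) (g', g) ->
  ext_comp g'' (ext_comp g' g) = ext_comp (ext_comp g'' g') g.
Proof.
move=> h'' /[dup] h' /ext_composableP [c [a' [a [ca gE' gE]]]].
(* The chart [c] holds [g] and [g']; the arrow [g''] gets its own chart [d]. *)
have [d [dp dq _]] := common_chart (ext_src g'').1 (ext_tgt g'').1 (ext_tgt g'').1.
have [a'' da gE''] := ext_in_chart units_dense V_hausdorff dp dq.
case: a a' a'' ca gE gE' da gE'' => [[x v] t] [[x' w] t'] [[z u] s].
move=> [/= ca' ca [ex et]] gE gE' da gE''; subst x' t'.
have cP := atlasP c; have dP := atlasP d.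
have [_ _ /= e''] := h''; rewrite gE' gE'' src_in // tgt_in // in e''.
case: e'' => ez es; subst s; rewrite /ext1_end /= in ez.
have dcy : overlap (val d) (val c) (x + v *^ t + w *^ t).
  rewrite (overlapE _ cP); split; first by case: ca'.
  by rewrite /= -ez; apply: chart_bwd => //; case: da.
have zE : z = transition (val d) (val c) (x + v *^ t + w *^ t).
  apply: (chart_bwd_inj dP); last by rewrite (bwd_transition dcy).
    by case: da.
  exact: overlap_sub (transition_overlap dcy).
subst z; clear ez.
(* Triples of composable arrows near the given one have parameters [(x, v, w, u, t)]: [g0] and [g1]
   are read in [c], [g2] in [d]. The start of [g2] is the end of [g1] transported by the transition,
   so composability is built in, and both bracketings become continuous families with the same
   source, target and level. *)
pose X := (V * V * V * V)%type.
pose y (k : X * K) := k.1.1.1.1 + k.1.1.1.2 *^ k.2 + k.1.1.2 *^ k.2.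
pose g0 (k : X * K) := (k.1.1.1.1, k.1.1.1.2, k.2).
pose g1 (k : X * K) := (k.1.1.1.1 + k.1.1.1.2 *^ k.2, k.1.1.2, k.2).
pose g2 (k : X * K) := (transition (val d) (val c) (y k), k.1.2, k.2).
pose B := (setT `&` g0 @^-1` ext1 (cod (val c))) `&`
  (setT `&` g1 @^-1` ext1 (cod (val c))) `&` (setT `&` y @^-1` overlap (val d) (val c)).
have Bo : open B.
  apply: openI; first apply: openI; (apply: within_preimage_open;
    [exact: openT|rewrite /y; within_cont|]).
  - by apply: ext1_open; exact: chart_cod_open.
  - by apply: ext1_open; exact: chart_cod_open.
  - exact: overlap_atlas_open.
have g2c : {within B, continuous g2}.
  apply: within_continuous_pair; last by within_cont.
  apply: within_continuous_pair; last by within_cont.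
  apply: (within_continuous_comp (B := overlap (val d) (val c)));
    [by rewrite /y; within_cont|exact: transition_continuous|].
  by move=> k [_ []].
pose A := B `&` g2 @^-1` ext1 (cod (val d)).
have Ao : open A.
  by apply: within_preimage_open => //; apply: ext1_open; exact: chart_cod_open.
have A0 k : A k -> ext1 (cod (val c)) (g0 k) by case=> [[[[]]]].
have A1 k : A k -> ext1 (cod (val c)) (g1 k) by case=> [[[_ []]]].
have A2 k : A k -> ext1 (cod (val d)) (g2 k) by case.
have A10 k : A k -> composable (ext_groupoid M) (ext_in c (g1 k), ext_in c (g0 k)).
  move=> Ak; have := A0 k Ak; have := A1 k Ak => k1 k0.
  by split=> //=; rewrite src_in // tgt_in.
have A21 k : A k -> composable (ext_groupoid M) (ext_in d (g2 k), ext_in c (g1 k)).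
  move=> Ak; have := A2 k Ak; have := A1 k Ak => k1 k2.
  split=> //=; rewrite src_in // tgt_in //=; congr (_, _).
  by rewrite bwd_transition //; case: Ak => [[_ []]].
have A2_10 k : A k -> composable (ext_groupoid M)
    (ext_in d (g2 k), ext_comp (ext_in c (g1 k)) (ext_in c (g0 k))).
  move=> Ak; have [_ _ e] := A21 k Ak; split=> //=.
  by rewrite ext_tgt_comp //; exact: A10.
have A21_0 k : A k -> composable (ext_groupoid M)
    (ext_comp (ext_in d (g2 k)) (ext_in c (g1 k)), ext_in c (g0 k)).
  move=> Ak; have [_ _ e] := A10 k Ak; split=> //=.
  by rewrite ext_src_comp //; exact: A21.
have A_sub : A `<=` B by move=> k [].
have c0 : {within A, continuous (fun k => ext_in c (g0 k))}.
  apply: (within_continuous_comp (B := ext1 (cod (val c)))) => //.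
    by within_cont.
  exact: ext_in_continuous.
have c1 : {within A, continuous (fun k => ext_in c (g1 k))}.
  apply: (within_continuous_comp (B := ext1 (cod (val c)))) => //.
    by within_cont.
  exact: ext_in_continuous.
have c2 : {within A, continuous (fun k => ext_in d (g2 k))}.
  apply: (within_continuous_comp (B := ext1 (cod (val d)))) => //.
    exact: continuous_subspaceW g2c.
  exact: ext_in_continuous.
have compc (F G : X * K -> ext M) : {within A, continuous F} -> {within A, continuous G} ->
    (forall k, A k -> composable (ext_groupoid M) (F k, G k)) ->
    {within A, continuous (fun k => ext_comp (F k) (G k))}.
  move=> Fc Gc FG; apply: (within_continuous_comp (f := fun k => (F k, G k))
    (g := fun z => ext_comp z.1 z.2)) ext_comp_continuous FG.
  exact: within_continuous_pair.
pose F k := ext_comp (ext_in d (g2 k)) (ext_comp (ext_in c (g1 k)) (ext_in c (g0 k))).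
pose G k := ext_comp (ext_comp (ext_in d (g2 k)) (ext_in c (g1 k))) (ext_in c (g0 k)).
have FG k : A k -> F k = G k.
  apply: (ext_eq_dense units_dense V_hausdorff (M := M)) => //.
  - by move=> p q; have [e [? ? ?]] := common_chart p q q; exists e.
  - exact: (compc _ _ c2 (compc _ _ c1 c0 A10) A2_10).
  - exact: (compc _ _ (compc _ _ c2 c1 A21) c0 A21_0).
  - move=> {}k Ak; have ? := A10 k Ak; have ? := A21 k Ak; have ? := A2_10 k Ak.
    by have ? := A21_0 k Ak; rewrite /F /G !ext_src_comp // !ext_tgt_comp.
  move=> {}k Ak; rewrite /F ext_src_comp; last exact: A2_10.
  by rewrite ext_src_comp; [rewrite src_in //; exact: A0|exact: A10].
rewrite gE gE' gE''.
exact (FG (x, v, w, u, t) (conj (conj (conj (conj I ca) (conj I ca')) (conj I dcy)) da)).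
Qed.

Lemma ext_src_one (q : T * K) : ext_src (ext_one M q) = q.
Proof.
case: q => p t; have [c cp] := atlas_at M p.
have cx := chart_fwd (atlasP c) cp; rewrite -{1}(chart_fwdK (atlasP c) cp).
rewrite ext_one_in // src_in /= ?chart_fwdK //; first exact: atlasP.
exact: ext1_0.
Qed.

Lemma ext_tgt_one (q : T * K) : ext_tgt (ext_one M q) = q.
Proof.
case: q => p t; have [c cp] := atlas_at M p.
have cx := chart_fwd (atlasP c) cp; rewrite -{1}(chart_fwdK (atlasP c) cp).
rewrite ext_one_in // tgt_in; last first.
  exact: ext1_0.
rewrite /ext1_end /= rscale0l addr0 chart_fwdK //; exact: atlasP.
Qed.

Lemma ext_src_inv g : ext_src (ext_inv g) = ext_tgt g.
Proof.
have [c [a [ca ->]]] := extP g.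
rewrite ext_inv_in // src_in; last exact: (inv_mor (local_groupoidP _) ca).
by rewrite tgt_in.
Qed.

Lemma ext_tgt_inv g : ext_tgt (ext_inv g) = ext_src g.
Proof.
have [c [a [ca ->]]] := extP g.
rewrite ext_inv_in // src_in // tgt_in; last exact: (inv_mor (local_groupoidP _) ca).
by rewrite /ext1_end /= ext1_endN.
Qed.

Lemma ext_groupoidP : is_groupoid (ext_groupoid M).
Proof.
have GP c := local_groupoidP (cod (val c)).
split=> //=; try by [exact: ext_src_one|exact: ext_tgt_one|exact: ext_src_comp|
  exact: ext_tgt_comp|exact: ext_compA].
- by move=> q _; exact: ext_src_one.
- by move=> q _; exact: ext_tgt_one.
- by move=> g _; exact: ext_src_inv.
- by move=> g _; exact: ext_tgt_inv.
- move=> g _; have [c [a [ca ->]]] := extP g.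
  rewrite tgt_in // ext_one_in //; last by case: ca.
  rewrite (ext_comp_in units_dense V_hausdorff).
    by congr (ext_in c _); exact: (comp1g (GP c) ca).
  have oa : ext1 (cod (val c)) (ext1_end a, 0, a.2) by apply: ext1_0; case: ca.
  exact: (composableI (G := local_groupoid (cod (val c))) oa ca erefl).
- move=> g _; have [c [a [ca ->]]] := extP g.
  rewrite src_in // ext_one_in //; last by case: ca.
  rewrite (ext_comp_in units_dense V_hausdorff).
    by congr (ext_in c _); exact: (compg1 (GP c) ca).
  have oa : ext1 (cod (val c)) (a.1.1, 0, a.2) by apply: ext1_0; case: ca.
  by apply: (composableI (G := local_groupoid (cod (val c))) ca oa); rewrite /= rscale0l addr0.
- move=> g _; have [c [a [ca ->]]] := extP g.
  rewrite ext_inv_in // src_in // ext_one_in //; last by case: ca.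
  have ia := inv_mor (GP c) ca.
  rewrite (ext_comp_in units_dense V_hausdorff).
    by congr (ext_in c _); exact: (compVg (GP c) ca).
  exact: (composableI (G := local_groupoid (cod (val c))) ia ca erefl).
- move=> g _; have [c [a [ca ->]]] := extP g.
  rewrite ext_inv_in // tgt_in // ext_one_in //; last by case: ca.
  have ia := inv_mor (GP c) ca.
  rewrite (ext_comp_in units_dense V_hausdorff).
    by congr (ext_in c _); exact: (compgV (GP c) ca).
  by apply: (composableI (G := local_groupoid (cod (val c))) ca ia); rewrite (tgt_inv (GP c) ca).
Qed.

Lemma ext_continuous_groupoid : continuous_groupoid (ext_groupoid M).
Proof.
split; first exact: ext_groupoidP.
split; [exact: ext_src_continuous|exact: ext_tgt_continuous|
  exact: ext_one_continuous|exact: ext_comp_continuous|exact: ext_inv_continuous].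
Qed.

(** In a fibre only the points of [M] are matched; the level [t] common to both arrows supplies the
    missing coordinate. *)
Lemma ext_fiber_composable t g' g : composable (ext_fiber M t) (g', g) ->
  composable (ext_groupoid M) (g', g).
Proof.
move=> [/= e1 e2 e3]; split=> //=.
rewrite [LHS]surjective_pairing [RHS]surjective_pairing e3 e1.
by rewrite ext_src_tgt2 e2.
Qed.

Lemma ext_bundle_iso :
  is_iso (ext_groupoid M) (bundle_total (ext_fiber M)) id
    (fun g => (g, (ext_src g).2)).
Proof.
split.
- split=> //=.
  + by move=> g _; rewrite -surjective_pairing.
  + by move=> g _; rewrite -ext_src_tgt2 -surjective_pairing.
  + by move=> q _; rewrite ext_src_one -surjective_pairing.
  + by move=> g' g gg; rewrite ext_src_comp.
- by split=> // q _; exists q.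
- split=> //; first by move=> g h _ _ [].
  by move=> [g t] /= <-; exists g.
Qed.

Lemma ext_fiberP t : is_groupoid (ext_fiber M t).
Proof.
have GP := ext_groupoidP; split=> //=.
- by move=> x _; rewrite ext_src_one.
- move=> g' g gg; rewrite ext_src_comp; last exact: ext_fiber_composable gg.
  by case: gg.
- by move=> g gt; rewrite ext_src_inv ext_src_tgt2.
- by move=> x _; rewrite ext_src_one.
- by move=> x _; rewrite ext_tgt_one.
- by move=> g' g gg; rewrite ext_src_comp //; exact: ext_fiber_composable gg.
- by move=> g' g gg; rewrite ext_tgt_comp //; exact: ext_fiber_composable gg.
- by move=> g _; rewrite ext_src_inv.
- by move=> g _; rewrite ext_tgt_inv.
- move=> g'' g' g gg gg'.
  exact: (ext_compA (ext_fiber_composable gg) (ext_fiber_composable gg')).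
- move=> g gt; rewrite -gt -ext_src_tgt2 -surjective_pairing; exact: (comp1g GP).
- move=> g gt; rewrite -gt -surjective_pairing; exact: (compg1 GP).
- move=> g gt; rewrite -gt -surjective_pairing; exact: (compVg GP).
- move=> g gt; rewrite -gt -ext_src_tgt2 -surjective_pairing; exact: (compgV GP).
Qed.

Lemma ext_fiber_continuous t : continuous_groupoid (ext_fiber M t).
Proof.
split; first exact: ext_fiberP.
have subT (A : set (ext M)) : A `<=` setT by [].
split=> /=.
- apply: within_continuous_fst; apply: continuous_subspaceW (subT _) _.
  exact: ext_src_continuous.
- apply: within_continuous_fst; apply: continuous_subspaceW (subT _) _.
  exact: ext_tgt_continuous.
- apply: (within_continuous_comp (B := setT) (f := fun x => (x, t))) => //.
    by within_cont.
  exact: ext_one_continuous.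
- apply: continuous_subspaceW ext_comp_continuous => -[g' g].
  exact: ext_fiber_composable.
- by apply: continuous_subspaceW (subT _) _; exact: ext_inv_continuous.
Qed.

End ExtensionGroupoid.

(** * The tangent bundle *)

Section TangentBundle.
Variables (K : topRingType) (V : rightTopModType K) (T : topologicalType).
Hypothesis units_dense : dense (@units K).
Hypothesis V_hausdorff : hausdorff_space V.
Variable M : manifold V T.
Implicit Types (c d e : atlas M) (g h : tangent_bundle M) (a b : V * V).

Let MG : is_gluing (ext_gluing M) := ext_gluingP units_dense V_hausdorff M.
Let src_in := ext_src_in units_dense V_hausdorff (M := M).
Let tgt_in := ext_tgt_in units_dense V_hausdorff (M := M).

Definition zero_level a : V * V * K := (a.1, a.2, 0).

Lemma zero_level_inj : injective zero_level.
Proof. by move=> [x v] [y w] [-> ->]. Qed.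

Lemma ext1_zero_level (U : set V) a : ext1 U (zero_level a) <-> (U `*` setT) a.
Proof.
split=> [[Ux _]|[Ux _]]; first by split.
by split; rewrite //= rscale0r addr0.
Qed.

Lemma tangent1_zero_level (U : set V) (f : V -> V) a :
  tangent1 U f (zero_level a) = zero_level (tangent0 U f a).
Proof. by case: a. Qed.

(** At [t = 0] the end of a triple is its base point, so [ext1 U] restricts to [U] times [V]. The
    tangent gluing is thus the level [0] of the gluing of [M^{1}] and inherits its laws along the
    injective map [zero_level]. *)
Lemma tb_gluingP : is_gluing (tb_gluing M).
Proof.
have E (U : set V) a : (U `*` setT) a = ext1 U (zero_level a).
  exact/esym/propext/ext1_zero_level.
have ED c d a : glue_dom (g := tb_gluing M) c d a =
  glue_dom (g := ext_gluing M) c d (zero_level a) := E _ a.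
have EP c a : piece (g := tb_gluing M) c a =
  piece (g := ext_gluing M) c (zero_level a) := E _ a.
have EG c d a : glue (g := ext_gluing M) c d (zero_level a) =
  zero_level (glue (g := tb_gluing M) c d a) := tangent1_zero_level _ _ _.
split.
- by move=> c; apply: open_setX; [exact: chart_cod_open (atlasP c)|exact: openT].
- by move=> c d; apply: open_setX; [exact: overlap_atlas_open|exact: openT].
- by move=> c d a; rewrite ED => h; rewrite EP; exact: (glue_dom_piece MG h).
- by move=> c d a; rewrite ED => h; rewrite EP -EG; exact: (glue_piece MG h).
- move=> c d; have fc := transitionC1 c d.
  apply: within_continuous_pair.
    apply: (within_continuous_comp (B := overlap (val c) (val d)));
      [by within_cont|exact: transition_continuous|by move=> a []].
  apply: (within_continuous_comp (B := ext1 (overlap (val c) (val d)))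
    (f := fun a : V * V => (a.1, a.2, 0)));
    [by within_cont|exact: (slopeP fc).2|by move=> a; rewrite ED].
- move=> c a; rewrite EP ED => /(glue_refl MG) [? e]; split=> //.
  by apply: zero_level_inj; rewrite -EG.
- move=> c d a; rewrite !ED -!EG => /(glue_sym MG) [? e]; split=> //.
  by apply: zero_level_inj; rewrite -!EG.
- move=> c d e a; rewrite !ED -!EG => ha hb.
  have [? h] := glue_trans MG ha hb; split=> //.
  by apply: zero_level_inj; rewrite -!EG.
Qed.

Let TG : is_gluing (tb_gluing M) := tb_gluingP.

Lemma tbP g : exists c x v, cod (val c) x /\ g = tb_in c (x, v).
Proof.
by have [c [[x v] [[cx _] ->]]] := @gluedP (tb_gluing M) g; exists c, x, v.
Qed.

Lemma tb_in_eqP c d x v y w : cod (val c) x -> cod (val d) y ->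
  tb_in c (x, v) = tb_in d (y, w) <-> ext_in c (x, v, 0) = ext_in d (y, w, 0).
Proof.
move=> cx dy.
have ca : piece (g := tb_gluing M) c (x, v) by [].
have db : piece (g := tb_gluing M) d (y, w) by [].
have ca' : ext1 (cod (val c)) (zero_level (x, v)) by apply/ext1_zero_level.
have db' : ext1 (cod (val d)) (zero_level (y, w)) by apply/ext1_zero_level.
apply: (iff_trans (glued_in_eqP TG ca db)).
apply: iff_trans (iff_sym (ext_inP units_dense V_hausdorff ca' db')).
rewrite /tangent_transition tangent1_zero_level.
split=> [[/ext1_zero_level h e]|[/ext1_zero_level h e]]; split=> //.
  by congr zero_level.
exact: zero_level_inj e.
Qed.

Definition tb_arrow g : ext M :=
  ext_in (glued_rep g).1 (zero_level (glued_rep g).2).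

(** Forgets the level of a chosen representative, hence meaningful only on arrows over [0]. *)
Definition arrow_tb (g : ext M) : tangent_bundle M :=
  tb_in (glued_rep g).1 (glued_rep g).2.1.

Lemma tb_arrow_in c x v : cod (val c) x ->
  tb_arrow (tb_in c (x, v)) = ext_in c (x, v, 0).
Proof.
move=> cx; rewrite /tb_arrow; have [pb] := glued_repP (tb_in c (x, v)).
case: glued_rep pb => d [y w] [/= dy _] e.
by apply/esym/(tb_in_eqP _ _ cx dy).
Qed.

Lemma arrow_tb_in c x v : cod (val c) x ->
  arrow_tb (ext_in c (x, v, 0)) = tb_in c (x, v).
Proof.
move=> cx; have ca : ext1 (cod (val c)) (x, v, 0).
  by apply/(ext1_zero_level _ (x, v)).
rewrite /arrow_tb; have [pb] := glued_repP (ext_in c (x, v, 0)).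
case: glued_rep pb => d [[y w] t] pb e.
have := src_in ca; rewrite [ext_in _ _]e -/(ext_in d _) src_in // => -[_ t0].
rewrite /= in t0; subst t; have dy : cod (val d) y by case: pb.
exact/esym/(tb_in_eqP _ _ cx dy).
Qed.

Lemma ext_fiber0P (g : ext M) : (ext_src g).2 = 0 ->
  exists c x v, cod (val c) x /\ g = ext_in c (x, v, 0).
Proof.
have [c [[[x v] t] [ca ->]]] := extP g; rewrite src_in //= => t0.
by rewrite t0 in ca *; exists c, x, v; case: ca.
Qed.

Lemma tb_arrowK g : arrow_tb (tb_arrow g) = g.
Proof. by have [c [x [v [cx ->]]]] := tbP g; rewrite tb_arrow_in // arrow_tb_in. Qed.

Lemma arrow_tbK (g : ext M) : (ext_src g).2 = 0 -> tb_arrow (arrow_tb g) = g.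
Proof.
by move=> /ext_fiber0P [c [x [v [cx ->]]]]; rewrite arrow_tb_in // tb_arrow_in.
Qed.

Lemma tb_arrow_src g : ext_src (tb_arrow g) = (tb_base g, 0).
Proof.
have [[/= px _] _] := glued_repP g.
rewrite /tb_arrow /tb_base; case: glued_rep px => c [x v] /= cx.
by rewrite src_in //; apply/ext1_zero_level.
Qed.

Lemma tb_arrow_tgt g : ext_tgt (tb_arrow g) = (tb_base g, 0).
Proof.
have [[/= px _] _] := glued_repP g.
rewrite /tb_arrow /tb_base; case: glued_rep px => c [x v] /= cx.
rewrite tgt_in; last exact/ext1_zero_level.
by rewrite /ext1_end /= rscale0r addr0.
Qed.

Lemma tb_arrow_zero p : tb_arrow (tb_zero M p) = ext_one M (p, 0).
Proof.
rewrite /tb_zero /ext_one /=; set c := sval _.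
have cp : dom (val c) p by exact: (svalP (cid (atlas_at M p))).
by rewrite tb_arrow_in //; exact: chart_fwd (atlasP c) cp.
Qed.

Lemma tb_arrow_opp g : tb_arrow (tb_opp g) = ext_inv (tb_arrow g).
Proof.
have [[/= px _] _] := glued_repP g.
rewrite [in RHS]/tb_arrow /tb_opp; case: glued_rep px => c [x v] /= cx.
rewrite tb_arrow_in // ext_inv_in //; last exact/ext1_zero_level.
by rewrite /= rscale0r addr0.
Qed.

Hypothesis M_common : common_charts M.

(** [tb_add] is a choice as well: every candidate sum is sent to the same composite, and a candidate
    exists because both vectors can be read in one chart around their common base point. *)
Lemma tb_arrow_add g' g : tb_base g' = tb_base g ->
  tb_arrow (tb_add g' g) = ext_comp (tb_arrow g') (tb_arrow g).
Proof.
move=> gg; have sumP h : tb_sum g' g h -> tb_arrow h = ext_comp (tb_arrow g') (tb_arrow g).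
  move=> [c [x [v [v' [cx -> -> ->]]]]]; rewrite !tb_arrow_in //.
  rewrite (ext_comp_in units_dense V_hausdorff) //.
  apply: (composableI (G := local_groupoid (cod (val c)))).
  - by apply/(ext1_zero_level _ (x, v')).
  - by apply/(ext1_zero_level _ (x, v)).
  - by rewrite /= rscale0r addr0.
apply: sumP; apply: (@xgetPex _ g (tb_sum g' g)).
have [c cp] := atlas_at M (tb_base g); have cP := atlasP c.
(* A vector changes chart as an arrow over [0]: its source and target are both the base point, so
   [ext_in_chart] applies. *)
have in_c h : tb_base h = tb_base g ->
    exists v, h = tb_in c (fwd (val c) (tb_base g), v).
  move=> hg; have [||[[x v] t] ca e] := @ext_in_chart _ _ _ units_dense V_hausdorff M
      (tb_arrow h) c; [by rewrite tb_arrow_src hg|by rewrite tb_arrow_tgt hg|].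
  have [cx _] := ca; have := tb_arrow_src h; rewrite e src_in //= hg => -[ex t0].
  rewrite t0 in e; exists v; rewrite -(tb_arrowK h) e arrow_tb_in // -ex chart_bwdK //.
have [v' e'] := in_c g' gg; have [v e] := in_c g erefl.
exists (tb_in c (fwd (val c) (tb_base g), v' + v)), c, (fwd (val c) (tb_base g)), v, v'.
by split=> //; exact: chart_fwd.
Qed.

Lemma tb_arrow_morphism : is_morphism (tb_groupoid M) (ext_fiber M 0) id tb_arrow.
Proof.
split=> //=.
- by move=> g _; rewrite tb_arrow_src.
- by move=> g _; rewrite tb_arrow_src.
- by move=> g _; rewrite tb_arrow_tgt.
- by move=> p _; rewrite tb_arrow_zero.
- by move=> g' g [_ _ /= gg]; rewrite tb_arrow_add.
Qed.

Lemma tb_arrow_inj : injective tb_arrow.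
Proof. exact: can_inj tb_arrowK. Qed.

Lemma tb_base_add g' g : tb_base g' = tb_base g ->
  tb_base (tb_add g' g) = tb_base g.
Proof.
move=> gg; have := tb_arrow_src (tb_add g' g); rewrite tb_arrow_add // ext_src_comp //.
  by rewrite tb_arrow_src => -[].
by split=> //=; rewrite tb_arrow_src tb_arrow_tgt gg.
Qed.

Lemma tb_base_zero p : tb_base (tb_zero M p) = p.
Proof.
by have := tb_arrow_src (tb_zero M p); rewrite tb_arrow_zero ext_src_one // => -[].
Qed.

Lemma tb_base_opp g : tb_base (tb_opp g) = tb_base g.
Proof.
have := tb_arrow_src (tb_opp g).
by rewrite tb_arrow_opp ext_src_inv // tb_arrow_tgt => -[].
Qed.

(** [tb_arrow] is injective and carries all operations to those of the fibre over [0], so every law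
    is pulled back from there. *)
Lemma tb_group_bundle : is_group_bundle (tb_groupoid M).
Proof.
split=> //; have FP := ext_fiberP units_dense V_hausdorff M_common 0.
have mP g : mor (ext_fiber M 0) (tb_arrow g) by rewrite /= tb_arrow_src.
have cP g' g : tb_base g' = tb_base g ->
    composable (ext_fiber M 0) (tb_arrow g', tb_arrow g).
  move=> e; apply: composableI; [exact: mP|exact: mP|].
  by rewrite /= tb_arrow_src tb_arrow_tgt /= e.
split=> //=.
- by move=> p _; rewrite tb_base_zero.
- by move=> p _; rewrite tb_base_zero.
- by move=> g' g [_ _ /= gg]; rewrite tb_base_add.
- by move=> g' g [_ _ /= gg]; rewrite tb_base_add.
- by move=> g _; rewrite tb_base_opp.
- by move=> g _; rewrite tb_base_opp.
- move=> g'' g' g [_ _ /= gg'] [_ _ /= gg].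
  apply: tb_arrow_inj; rewrite !tb_arrow_add ?tb_base_add //; last by rewrite gg'.
  exact: (compA FP (cP _ _ gg') (cP _ _ gg)).
- move=> g _; apply: tb_arrow_inj; rewrite tb_arrow_add ?tb_base_zero // tb_arrow_zero.
  by have := comp1g FP (mP g); rewrite /= tb_arrow_tgt.
- move=> g _; apply: tb_arrow_inj; rewrite tb_arrow_add ?tb_base_zero // tb_arrow_zero.
  by have := compg1 FP (mP g); rewrite /= tb_arrow_src.
- move=> g _; apply: tb_arrow_inj; rewrite tb_arrow_add ?tb_base_opp // tb_arrow_zero.
  by have := compVg FP (mP g); rewrite /= tb_arrow_src tb_arrow_opp.
- move=> g _; apply: tb_arrow_inj; rewrite tb_arrow_add ?tb_base_opp // tb_arrow_zero.
  by have := compgV FP (mP g); rewrite /= tb_arrow_tgt tb_arrow_opp.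
Qed.

Lemma tb_arrow_continuous : {within setT, continuous tb_arrow}.
Proof.
apply: (glued_continuous TG) => g _; have [c [x [v [cx ->]]]] := tbP g.
exists c; first by exists (x, v).
apply: (within_continuous_eq (f := fun a : V * V => ext_in c (zero_level a))).
  by move=> [y w] [[cy _] _]; rewrite -/(tb_in c _) tb_arrow_in.
apply: (within_continuous_comp (B := ext1 (cod (val c)))).
- by rewrite /zero_level; within_cont.
- exact: ext_in_continuous.
- by move=> a [ca _]; apply/ext1_zero_level.
Qed.

Lemma arrow_tb_continuous :
  {within mor (ext_fiber M 0), continuous arrow_tb}.
Proof.
apply: (glued_continuous MG) => g /ext_fiber0P [c [x [v [cx ->]]]].
exists c; first by exists (x, v, 0) => //; apply/(ext1_zero_level _ (x, v)).
apply: (within_continuous_eq (f := fun a : V * V * K => tb_in c a.1)).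
  move=> [[y w] t] [ca]; rewrite /= -/(ext_in c _) src_in //= => t0.
  by rewrite t0 arrow_tb_in //; case: ca.
apply: (within_continuous_comp (B := cod (val c) `*` setT)).
- by within_cont.
- exact: (glued_in_continuous TG).
- by move=> a [[ca _] _].
Qed.

Lemma tb_arrow_iso :
  is_continuous_iso (tb_groupoid M) (ext_fiber M 0) id tb_arrow.
Proof.
split; [exact: tb_arrow_morphism|exact: homeomorphism_id|].
exists arrow_tb; split=> //.
- by move=> g _ /=; rewrite tb_arrow_src.
- by move=> g _; exact: tb_arrowK.
- by move=> g /set_mem; exact: arrow_tbK.
- split; [exact: tb_arrow_continuous|exact: arrow_tb_continuous].
Qed.

Lemma field_unit0 : is_field K -> ~ units (0 : K).
Proof. by move=> [K1 _] [s [_]]; rewrite mul0r => /esym. Qed.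

(** Over a field each level is [0] or a unit, which gives surjectivity. No level is both, by [u0],
    which gives injectivity across the two summands. *)
Lemma units_tangent_sum : is_field K ->
  is_iso (sum_groupoid (ext_units M) (tb_groupoid M)) (ext_groupoid M)
    (fun x => match x with inl p => p | inr p => (p, 0) end)
    (fun k => match k with inl k => k | inr h => tb_arrow h end).
Proof.
move=> K_field; have u0 := field_unit0 K_field; split.
- split=> //=.
  + by case=> // g _; exact: tb_arrow_src.
  + by case=> // g _; exact: tb_arrow_tgt.
  + by case=> // p _; exact: tb_arrow_zero.
  + move=> [g'|g'] [g|g] [] //= _ _ [] // gg; exact: tb_arrow_add.
- split=> //.
  + move=> [p|p] [q|q] /set_mem /= pP /set_mem /= qP e; subst => //.
    * by case: pP => _ [_ /u0].
    * by case: qP => _ [_ /u0].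
    * by case: e => ->.
  + move=> [p t] _; have [->|/eqP t0] := eqVneq t 0; first by exists (inr p).
    by exists (inl (p, t)) => //; do 2!split=> //; exact: K_field.2.
- split=> //.
  + move=> [g|g] [h|h] /set_mem /= gP /set_mem /= hP e; subst => //.
    * by case: gP => _ [_]; rewrite tb_arrow_src => /u0.
    * by case: hP => _ [_]; rewrite tb_arrow_src => /u0.
    * by rewrite (tb_arrow_inj e).
  + move=> g _; have [t0|/eqP t0] := eqVneq (ext_src g).2 0.
      by exists (inr (arrow_tb g)) => //=; exact: arrow_tbK.
    exists (inl g) => //=; have ut := K_field.2 _ t0; split=> //; split=> //.
    by rewrite ext_src_tgt2.
Qed.

End TangentBundle.

(** * The pair groupoid *)

Section PairGroupoid.
Variables (K : topRingType) (V : rightTopModType K) (T : topologicalType).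
Hypothesis units_dense : dense (@units K).
Hypothesis V_hausdorff : hausdorff_space V.
Variable M : manifold V T.
Hypothesis M_common : common_charts M.
Implicit Types (c d e : atlas M) (g h : ext M) (p q r : T).

Let src_in := ext_src_in units_dense V_hausdorff (M := M).
Let tgt_in := ext_tgt_in units_dense V_hausdorff (M := M).

Lemma ext_unit_inj g h : units (ext_src g).2 ->
  ext_src g = ext_src h -> ext_tgt g = ext_tgt h -> g = h.
Proof.
have [c [cp cq _]] := common_chart M_common (ext_src g).1 (ext_tgt g).1 (ext_tgt g).1.
have [[[x v] t] ca gE] := ext_in_chart units_dense V_hausdorff cp cq.
move=> ut es et; rewrite es in cp; rewrite et in cq.
have [[[y w] s] cb hE] := ext_in_chart units_dense V_hausdorff cp cq.
move: ut es et; rewrite gE hE !src_in // !tgt_in //= => ut [exy ets] [exy' _].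
subst s; congr (ext_in c (_, _, _)).
  by apply: (chart_bwd_inj (atlasP c)) exy; [case: ca|case: cb].
have e1 : x = y by apply: (chart_bwd_inj (atlasP c)) exy; [case: ca|case: cb].
have e2 : x + v *^ t = y + w *^ t.
  by apply: (chart_bwd_inj (atlasP c)) exy'; [case: ca|case: cb].
by apply: (rscale_unit_inj ut); apply: (addrI x); rewrite e2 e1.
Qed.

(** The direction is the difference quotient: scalars act on the right, so scaling the displacement
    by [s] and then by [t] multiplies it by [s * t = 1]. *)
Lemma unit_arrow c p q (t s : K) : s * t = 1 -> dom (val c) p -> dom (val c) q ->
  let a := (fwd (val c) p, (fwd (val c) q - fwd (val c) p) *^ s, t) in
  [/\ ext1 (cod (val c)) a, ext_src (ext_in c a) = (p, t) &
      ext_tgt (ext_in c a) = (q, t)].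
Proof.
move=> st cp cq a; have cP := atlasP c.
have aE : ext1_end a = fwd (val c) q.
  by rewrite /ext1_end /= rscaleA st rscale1r addrC subrK.
have ca : ext1 (cod (val c)) a.
  by split; [exact: chart_fwd|rewrite -/(ext1_end a) aE; exact: chart_fwd].
by split=> //; [rewrite src_in //= chart_fwdK|rewrite tgt_in // aE chart_fwdK].
Qed.

Lemma fiber1_pair_iso :
  is_continuous_iso (ext_fiber M 1) (pair_groupoid [set: T]) id
    (fun g => ((ext_tgt g).1, (ext_src g).1)).
Proof.
split; last 1 first.
- pose chart_of (z : T * T) := sval (cid (common_chart M_common z.1 z.2 z.2)).
  pose arrow c (z : T * T) := ext_in c
    (fwd (val c) z.2, (fwd (val c) z.1 - fwd (val c) z.2) *^ 1, 1).
  have arrowP c z : dom (val c) z.1 -> dom (val c) z.2 ->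
      ext_src (arrow c z) = (z.2, 1) /\ ext_tgt (arrow c z) = (z.1, 1).
    by move=> c1 c2; have [] := unit_arrow (mul1r 1) c2 c1.
  have u1 : units (1 : K) by exists 1; rewrite mul1r.
  (* [chart_of] is an arbitrary choice and need not vary continuously. An arrow over [1] is
     determined by its ends, so near a given [z] one chart can be kept fixed; this yields the
     continuity of the inverse. *)
  have arrow_eq c d z : dom (val c) z.1 -> dom (val c) z.2 ->
      dom (val d) z.1 -> dom (val d) z.2 -> arrow c z = arrow d z.
    move=> c1 c2 d1 d2; have [s1 t1] := arrowP c z c1 c2.
    have [s2 t2] := arrowP d z d1 d2.
    by apply: ext_unit_inj; rewrite ?s1 ?s2 ?t1 ?t2.
  have chart_ofP z : dom (val (chart_of z)) z.1 /\ dom (val (chart_of z)) z.2.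
    by have [] := svalP (cid (common_chart M_common z.1 z.2 z.2)).
  exists (fun z => arrow (chart_of z) z); split.
  + by [].
  + by move=> z _ /=; have [c1 c2] := chart_ofP z; have [-> _] := arrowP _ _ c1 c2.
  + move=> g /set_mem /= g1; set z := (_, _).
    have [c1 c2] := chart_ofP z; have [s1 t1] := arrowP _ _ c1 c2.
    apply: ext_unit_inj; rewrite ?s1 ?t1 //=.
      by rewrite [RHS]surjective_pairing g1.
    by rewrite [RHS]surjective_pairing ext_src_tgt2 g1.
  + move=> z _; have [c1 c2] := chart_ofP z; have [s1 t1] := arrowP _ _ c1 c2.
    by rewrite s1 t1; case: (z).
  split.
    have subT (A : set (ext M)) : A `<=` setT by [].
    apply: within_continuous_pair; apply: within_continuous_fst;
      apply: continuous_subspaceW (subT _) _;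
      [exact: ext_tgt_continuous|exact: ext_src_continuous].
  apply: within_continuous_local => z _; have [c1 c2] := chart_ofP z.
  set c := chart_of z in c1 c2; exists (dom (val c) `*` dom (val c)).
  split=> //; first by apply: open_setX; exact: chart_dom_open (atlasP c).
  apply: (within_continuous_eq (f := fun z => arrow c z)).
    by move=> y [_ [y1 y2]]; apply: arrow_eq => //; exact: (chart_ofP y).1
      || exact: (chart_ofP y).2.
  apply: (within_continuous_comp (B := ext1 (cod (val c)))).
  + have fwd1 : {within setT `*` setT `&` dom (val c) `*` dom (val c),
        continuous (fun z : T * T => fwd (val c) z.1)}.
      apply: (within_continuous_comp (B := dom (val c)));
        [by within_cont|exact: chart_fwd_continuous (atlasP c)|by move=> y [_ []]].
    have fwd2 : {within setT `*` setT `&` dom (val c) `*` dom (val c),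
        continuous (fun z : T * T => fwd (val c) z.2)}.
      apply: (within_continuous_comp (B := dom (val c)));
        [by within_cont|exact: chart_fwd_continuous (atlasP c)|by move=> y [_ []]].
    by within_cont.
  + exact: ext_in_continuous.
  + by move=> y [_ [y1 y2]]; have [] := unit_arrow (mul1r 1) y2 y1.
- split=> //=.
  + by move=> p _; rewrite ext_src_one // ext_tgt_one.
  + move=> g' g /ext_fiber_composable gg.
    by rewrite ext_src_comp // ext_tgt_comp.
- exact: homeomorphism_id.
Qed.

Lemma ext_units_iso :
  is_iso (ext_units M)
    (prod_groupoid (pair_groupoid [set: T]) (trivial_groupoid (@units K)))
    id (fun g => ((ext_tgt g).1, (ext_src g).1, (ext_src g).2)).
Proof.
split.
- split=> //=.
  + by move=> x [_ [_ ?]].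
  + by move=> g [_ [_ ?] _].
  + by move=> g _; rewrite -surjective_pairing.
  + by move=> g _; rewrite -ext_src_tgt2 -surjective_pairing.
  + by move=> x _; rewrite ext_src_one // ext_tgt_one.
  + move=> g' g [_ _ /= gg]; have hc : composable (ext_groupoid M) (g', g) by [].
    by rewrite ext_src_comp // ext_tgt_comp // gg ext_src_tgt2.
- split; [by move=> x [_ [_ ux]]|by move=> x y _ _|].
  by move=> x [_ ux]; exists x.
- split.
  + by move=> g [_ [_ ?] _].
  + move=> g h /set_mem [_ [_ ug] _] _ [et es es2]; apply: ext_unit_inj => //.
      by rewrite [LHS]surjective_pairing es es2 -surjective_pairing.
    rewrite [LHS]surjective_pairing [RHS]surjective_pairing et.
    by rewrite !ext_src_tgt2 es2.
  + move=> [[q p] t] /= [_ ut]; have [s [st _]] := ut.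
    have [c [cp cq _]] := common_chart M_common p q q.
    have [_ es et] := unit_arrow st cp cq; move: es et; set g := ext_in _ _ => es et.
    by exists g; [split=> //=; rewrite ?es ?et; split|rewrite es et].
Qed.

End PairGroupoid.

(** * Morphisms of the first kind *)

Section InducedMap.
Variables (K : topRingType) (V W : rightTopModType K) (TM TN : topologicalType).
Hypothesis units_dense : dense (@units K).
Hypotheses (V_hausdorff : hausdorff_space V) (W_hausdorff : hausdorff_space W).
Variables (M : manifold V TM) (N : manifold W TN) (f : TM -> TN).
Implicit Types (c : atlas M) (d : atlas N) (g : ext M) (h : ext N) (a b : V * V * K).

Let MG : is_gluing (ext_gluing M) := ext_gluingP units_dense V_hausdorff M.
Let srcM_in := ext_src_in units_dense V_hausdorff (M := M).
Let tgtM_in := ext_tgt_in units_dense V_hausdorff (M := M).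
Let srcN_in := ext_src_in units_dense W_hausdorff (M := N).
Let tgtN_in := ext_tgt_in units_dense W_hausdorff (M := N).

Notation fdom c d := (local_dom f (val c) (val d)).
Notation fmap c d := (local_map f (val c) (val d)).

Let fdomE c d : fdom c d = cod (val c) `&` [set x | dom (val d) (f (bwd (val c) x))].
Proof. exact: local_domE (atlasP c). Qed.

(** The graph of [f^{1}], formed only from those pairs of charts in which [f] is C^1; other pairs
    contribute nothing. *)
Definition ext_related g h : Prop := exists c d a,
  [/\ C1_on (fdom c d) (fmap c d), ext1 (fdom c d) a, g = ext_in c a &
      h = ext_in d (tangent1 (fdom c d) (fmap c d) a)].

Definition ext_map g : ext N :=
  xget (ext_one N (f (ext_src g).1, 0)) (ext_related g).

Lemma local_map_cod c d : set_fun (fdom c d) (cod (val d)) (fmap c d).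
Proof. by rewrite fdomE => x [_ dx]; exact: chart_fwd (atlasP d) dx. Qed.

Lemma local_dom_sub c d : fdom c d `<=` cod (val c).
Proof. by rewrite fdomE => x []. Qed.

Hypothesis f_continuous : continuous f.

Lemma local_dom_atlas_open c d : open (fdom c d).
Proof. exact: local_dom_open (atlasP c) (atlasP d) f_continuous. Qed.

(** Changing chart in [M] and then applying [f], or applying [f] and then changing chart in [N], is
    the same map near the representative; the chain rule transfers this to the extensions. *)
Lemma ext_related_fun g h h' : ext_related g h -> ext_related g h' -> h = h'.
Proof.
move=> [c [d [a [fC ha ga ->]]]] [c' [d' [a' [fC' ha' ga' ->]]]].
have ca := ext1_sub (@local_dom_sub c d) ha.
have ca' := ext1_sub (@local_dom_sub c' d') ha'.
have [cca' aE] := (ext_inP units_dense V_hausdorff ca ca').1 (etrans (esym ga) ga').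
have cP := atlasP c; have cP' := atlasP c'; have dP := atlasP d; have dP' := atlasP d'.
(* Points of chart [c'] that [c] also sees and whose images lie in both [d] and [d']. Openness uses
   continuity of [f]. *)
pose O := overlap (val c) (val c') `&` fdom c' d' `&` fdom c' d.
have Oo : open O.
  by apply: openI; [apply: openI; [exact: overlap_atlas_open|]|];
    exact: local_dom_atlas_open.
have transO : set_fun O (fdom c d) (transition (val c) (val c')).
  move=> x [[ccx _]]; rewrite !fdomE => -[_ /= dx].
  split; first by exact: overlap_sub (transition_overlap ccx).
  by rewrite /= bwd_transition.
have fO : set_fun O (overlap (val d) (val d')) (fmap c' d').
  move=> x [[_ fx]]; rewrite (fdomE c' d) => -[_ /= dx].
  rewrite (overlapE _ dP'); split; first exact: local_map_cod.
  by move: fx; rewrite fdomE /= => -[_ dx']; rewrite chart_fwdK.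
have Oa' : ext1 O a'.
  rewrite !ext1I; split=> //; rewrite fdomE.
  split; split; try by case: ca'.
    rewrite /=; have [<- _] := bwd_tangent_transition cca'; rewrite aE.
    by case: (ha) => + _; rewrite fdomE => -[].
  have [_ e] := bwd_tangent_transition cca'.
  rewrite /= -/(ext1_end a') -e aE.
  by case: (ha) => _; rewrite fdomE => -[].
(* The common value of both routes from [c'] to [d]; each route is compared with the extension of
   [k] on [O]. *)
pose k x := fmap c d (transition (val c) (val c') x).
have kC : C1_on O k.
  apply: C1_on_comp fC transO; apply: C1_on_sub (transitionC1 c c').
  by move=> x [[]].
have fa' : ext1 (overlap (val d) (val d')) (tangent1 (fdom c' d') (fmap c' d') a').
  case: Oa' => Ox Oy; split; first exact: fO.
  by rewrite -/(ext1_end (tangent1 _ _ _)) tangent1_end //; exact: fO.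
apply/(ext_inP units_dense W_hausdorff).
- by apply: ext1_tangent1 ha => //; exact: local_map_cod.
- by apply: ext1_tangent1 ha' => //; exact: local_map_cod.
split=> //; transitivity (tangent1 O k a'); last first.
  rewrite -aE; apply: (tangent1_comp units_dense W_hausdorff Oo) Oa' => //.
    by move=> x [[]].
  exact: transitionC1.
apply/esym; apply: (tangent1_comp units_dense W_hausdorff Oo) Oa' => //.
- by move=> x [[]].
- exact: transitionC1.
move=> x [[ccx fx] fx']; rewrite /k /local_map /transition /=.
rewrite -/(transition _ _ _) (chart_fwdK cP); last first.
  by move: ccx; rewrite (overlapE _ cP') => -[].
by rewrite chart_fwdK //; move: fx; rewrite fdomE => -[].
Qed.

Lemma ext_map_in c d a : C1_on (fdom c d) (fmap c d) -> ext1 (fdom c d) a ->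
  ext_map (ext_in c a) = ext_in d (tangent1 (fdom c d) (fmap c d) a).
Proof.
move=> fC ha; have rel : ext_related (ext_in c a)
  (ext_in d (tangent1 (fdom c d) (fmap c d) a)) by exists c, d, a.
exact: ext_related_fun (xgetPex _ (ex_intro _ _ rel)) rel.
Qed.

Section FirstKind.
(** Asked of one pair of charts around any three points, not of all pairs. For the projections of a
    product this can be checked directly in product charts. *)
Hypothesis f_C1 : forall p q r, exists c d,
  [/\ dom (val c) p, dom (val c) q & dom (val c) r] /\
  [/\ dom (val d) (f p), dom (val d) (f q), dom (val d) (f r) &
      C1_on (fdom c d) (fmap c d)].

Lemma ext_map_chart g : exists c d a,
  [/\ C1_on (fdom c d) (fmap c d), ext1 (fdom c d) a & g = ext_in c a].
Proof.
have [c [d [[cp cq _] [dp dq _ fC]]]] := f_C1 (ext_src g).1 (ext_tgt g).1 (ext_tgt g).1.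
have [a ca ga] := ext_in_chart units_dense V_hausdorff cp cq.
exists c, d, a; split=> //; case: (ca) => cx cy; rewrite fdomE.
by split; split=> //; [move: dp|move: dq]; rewrite ga ?srcM_in ?tgtM_in.
Qed.

Lemma ext_map_continuous : {within setT, continuous ext_map}.
Proof.
apply: within_continuous_local => g _; have [c [d [a [fC ha ga]]]] := ext_map_chart g.
have lo := ext1_open (@local_dom_atlas_open c d).
have sub := ext1_sub (@local_dom_sub c d).
(* The arrows handled by the single pair [c], [d]: an open set on which [ext_map] is given by one
   continuous formula. *)
exists (@glued_in (ext_gluing M) c @` (ext1 (cod (val c)) `&` ext1 (fdom c d))); split.
- exact: glued_in_open.
- by exists a => //; split=> //; exact: sub.
apply: (glued_continuous MG) => k [_ [b [cb fb] <-]]; exists c; first by exists b.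
set A := _ `&` _; have AP b' : A b' -> ext1 (fdom c d) b'.
  move=> [cb' [_ [b'' [cb'' fb''] /(ext_in_inj units_dense V_hausdorff)]]].
  by move=> <-.
apply: (within_continuous_eq
    (f := fun b : V * V * K => ext_in d (tangent1 (fdom c d) (fmap c d) b))).
  by move=> b' /AP fb'; rewrite -/(ext_in c b') (ext_map_in fC fb').
apply: (within_continuous_comp (B := ext1 (cod (val d)))).
- by apply: continuous_subspaceW (tangent1_continuous fC).
- exact: ext_in_continuous.
- by move=> b' /AP fb'; apply: ext1_tangent1 fb' => //; exact: local_map_cod.
Qed.

Lemma ext_map_first_kind : first_kind f ext_map.
Proof.
have fE c d x : fdom c d x -> bwd (val d) (fmap c d x) = f (bwd (val c) x).
  by rewrite fdomE => -[_ dx]; rewrite chart_fwdK //; exact: atlasP.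
split; last first.
- exact: ext_map_continuous.
- apply: within_continuous_pair; last by within_cont.
  by apply: (within_continuousT_comp (g := f)) => //; within_cont.
split=> //=.
- move=> g _; have [c [d [a [fC fa ->]]]] := ext_map_chart g.
  have ca := ext1_sub (@local_dom_sub c d) fa.
  have da := ext1_tangent1 fC (@local_map_cod c d) fa.
  by rewrite (ext_map_in fC fa) srcN_in // srcM_in //= fE //; case: fa.
- move=> g _; have [c [d [a [fC fa ->]]]] := ext_map_chart g.
  have ca := ext1_sub (@local_dom_sub c d) fa.
  have da := ext1_tangent1 fC (@local_map_cod c d) fa.
  rewrite (ext_map_in fC fa) tgtN_in // tgtM_in //= tangent1_end //.
  by rewrite fE //; case: fa.
- move=> [p t] _; have [c [d [[cp _ _] [dp _ _ fC]]]] := f_C1 p p p.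
  have cP := atlasP c; have cx := chart_fwd cP cp.
  have fx : fdom c d (fwd (val c) p) by rewrite fdomE; split=> //=; rewrite chart_fwdK.
  rewrite -{1}(chart_fwdK cP cp) ext_one_in // (ext_map_in fC); last exact: ext1_0.
  rewrite /tangent1 (slope0 units_dense W_hausdorff (@local_dom_atlas_open c d) fC) //.
  rewrite -ext_one_in //; last exact: (@local_map_cod c d).
  by rewrite /= fE //= chart_fwdK.
move=> g' g [_ _ /= gg].
(* The pair [c], [d] contains source, middle point and target, so both arrows and their composite
   are mapped by one slope, and its additivity applies. *)
have [c [d [[cp cq cr] [dp dq dr fC]]]] :=
  f_C1 (ext_src g).1 (ext_tgt g).1 (ext_tgt g').1.
have [a ca ga] := ext_in_chart units_dense V_hausdorff cp cq.
rewrite -gg in cq dq.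
have [a' ca' ga'] := ext_in_chart units_dense V_hausdorff cq cr.
have fa : ext1 (fdom c d) a.
  rewrite gg in dq; case: (ca) => cx cy; rewrite fdomE.
  by split; split=> //; [move: dp|move: dq]; rewrite ga ?srcM_in ?tgtM_in.
have fa' : ext1 (fdom c d) a'.
  case: (ca') => cx cy; rewrite fdomE.
  by split; split=> //; [move: dq|move: dr]; rewrite ga' ?srcM_in ?tgtM_in.
have com : composable (local_groupoid (cod (val c))) (a', a).
  by apply/(ext_composable_in units_dense V_hausdorff ca' ca); rewrite -ga -ga'.
have fcom : composable (local_groupoid (fdom c d)) (a', a) by case: com.
have TP := tangent1_morphism units_dense W_hausdorff (@local_dom_atlas_open c d) fC.
rewrite ga ga' ext_comp_in // (ext_map_in fC); last exact: (comp_mor (local_groupoidP _) fcom).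
rewrite !(ext_map_in fC) // ext_comp_in //.
  by congr (ext_in d _); exact: (morph_comp TP fcom).
have [_ _ e] := fcom.
apply: (composableI (G := local_groupoid (cod (val d)))).
- by apply: ext1_tangent1 fa' => //; exact: local_map_cod.
- by apply: ext1_tangent1 fa => //; exact: local_map_cod.
exact (etrans (congr1 (fun z => (fmap c d z.1, z.2)) e) (esym (morph_tgt TP fa))).
Qed.

End FirstKind.

End InducedMap.

(** * From continuous morphisms of the first kind back to C^1 maps *)

Section FirstKindMorphism.
Variables (K : topRingType) (V W : rightTopModType K) (TM TN : topologicalType).
Hypothesis units_dense : dense (@units K).
Hypotheses (V_hausdorff : hausdorff_space V) (W_hausdorff : hausdorff_space W).
Variables (M : manifold V TM) (N : manifold W TN).
Implicit Types (c : atlas M) (d : atlas N) (g : ext M) (h : ext N) (a b : V * V * K).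
Implicit Types (f : TM -> TN) (F : ext M -> ext N).

Let srcM_in := ext_src_in units_dense V_hausdorff (M := M).
Let tgtM_in := ext_tgt_in units_dense V_hausdorff (M := M).
Let srcN_in := ext_src_in units_dense W_hausdorff (M := N).
Let tgtN_in := ext_tgt_in units_dense W_hausdorff (M := N).
Let NG : is_gluing (ext_gluing N) := ext_gluingP units_dense W_hausdorff N.

Lemma first_kind_continuous f F : first_kind f F -> continuous f.
Proof.
move=> [_ fc _]; apply/continuous_subspace_setT.
apply: (within_continuous_fst (f := fun p => (f p, 0 : K))).
apply: (within_continuous_comp (B := setT) (f := fun p : TM => (p, 0 : K))) fc _ => //.
by within_cont.
Qed.

(** Compatibility with the source fixes the base point and the level of [F] in charts; compatibility
    with the target is the factorizer identity for the remaining component. As the factorizer is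
    unique, [F] is forced in every pair of charts, which also yields [first_kind_unique]. *)
Lemma first_kind_local f F c d : first_kind f F ->
  let U := local_dom f (val c) (val d) in let fcd := local_map f (val c) (val d) in
  C1_on U fcd /\
  forall a, ext1 U a -> F (ext_in c a) = ext_in d (tangent1 U fcd a).
Proof.
move=> fF U fcd; have fc := first_kind_continuous fF; case: fF => Fmor _ Fc.
have FS g : ext_src (F g) = (f (ext_src g).1, (ext_src g).2) by exact: (morph_src Fmor).
have FT g : ext_tgt (F g) = (f (ext_tgt g).1, (ext_tgt g).2) by exact: (morph_tgt Fmor).
have cP := atlasP c; have dP := atlasP d.
have Uo : open U by exact: local_dom_open.
have UE : U = cod (val c) `&` [set x | dom (val d) (f (bwd (val c) x))].
  exact: local_domE.
have Uc a : ext1 U a -> ext1 (cod (val c)) a.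
  by apply: ext1_sub; rewrite UE => x [].
have UF a : ext1 U a -> glued_dom (D := ext_gluing N) d (F (ext_in c a)).
  move=> Ua; apply/(ext_domP units_dense W_hausdorff).
  rewrite FS FT /= srcM_in ?tgtM_in //=; try exact: Uc.
  by move: Ua; rewrite UE => -[[_ ?] [_ ?]].
pose Fcd a : W * W * K := glued_coord (D := ext_gluing N) d (F (ext_in c a)).
have FcdP a : ext1 U a -> ext1 (cod (val d)) (Fcd a) /\ ext_in d (Fcd a) = F (ext_in c a).
  by move=> /UF /glued_coordK.
have FcdE a : ext1 U a ->
    [/\ (Fcd a).1.1 = fcd a.1.1, ext1_end (Fcd a) = fcd (ext1_end a) & (Fcd a).2 = a.2].
  move=> Ua; have [dF eF] := FcdP a Ua; have ca := Uc a Ua.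
  have := FS (ext_in c a); rewrite -eF srcN_in // srcM_in //= => -[es et].
  have := FT (ext_in c a); rewrite -eF tgtN_in // tgtM_in //= => -[et' _].
  case: dF => dx dy; split=> //.
    by rewrite /fcd /local_map /= -es chart_bwdK.
  by rewrite /fcd /local_map /= -et' chart_bwdK.
have fact : continuous_factorizers U fcd (fun a => (Fcd a).1.2).
  split=> [x v t Ua|].
    have [e1 e2 e3] := FcdE _ Ua; rewrite /= in e1 e3.
    have /= <- := e2; rewrite -e1 /ext1_end e3.
    by rewrite addrC addKr.
  do 2![apply: within_continuous_fst || apply: within_continuous_snd].
  apply: (within_continuous_comp (B := glued_dom (D := ext_gluing N) d)
    (f := fun a => F (ext_in c a))) (glued_coord_continuous NG (i := d)) UF.
  apply: (within_continuous_comp (B := setT)) Fc _ => //.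
  apply: continuous_subspaceW (ext_in_continuous units_dense V_hausdorff (c := c)).
  exact: Uc.
have fC : C1_on U fcd by eexists; exact: fact.
split=> // a Ua; have [_ <-] := FcdP a Ua; congr (ext_in d _).
rewrite (tangent1_factorizer units_dense W_hausdorff Uo (@subset_refl _ U) fC
  (fun _ _ => erefl) fact Ua).
by have [<- _ <-] := FcdE a Ua; case: (Fcd a) => -[].
Qed.

Lemma first_kind_C1 f F : first_kind f F -> C1_map M N f.
Proof.
move=> fF; split; first exact: first_kind_continuous fF.
move=> c d Mc Nd.
by have [+ _] := @first_kind_local f F (SigSub (mem_set Mc)) (SigSub (mem_set Nd)) fF.
Qed.

Lemma first_kind_inj f f' F : first_kind f F -> first_kind f' F -> f = f'.
Proof.
move=> [fF _ _] [fF' _ _]; apply/funext => p.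
have [c cp] := atlas_at M p; have cx := chart_fwd (atlasP c) cp.
have := morph_src fF (g := ext_in c (fwd (val c) p, 0, 0)) I.
have /= -> := morph_src fF' (g := ext_in c (fwd (val c) p, 0, 0)) I.
by rewrite srcM_in /= ?chart_fwdK //; [move=> -[]|exact: atlasP|exact: ext1_0].
Qed.

Hypotheses (M_common : common_charts M) (N_common : common_charts N).

Lemma first_kind_unique f F F' : first_kind f F -> first_kind f F' -> F = F'.
Proof.
move=> fF fF'; apply/funext => g.
have [c [cp cq _]] := common_chart M_common (ext_src g).1 (ext_tgt g).1 (ext_tgt g).1.
have [d [dp dq _]] := common_chart N_common
  (f (ext_src g).1) (f (ext_tgt g).1) (f (ext_tgt g).1).
have [a ca ga] := ext_in_chart units_dense V_hausdorff cp cq.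
have fa : ext1 (local_dom f (val c) (val d)) a.
  case: (ca) => cx cy; rewrite (local_domE _ _ (atlasP c)).
  by split; split=> //; [move: dp|move: dq]; rewrite ga ?srcM_in ?tgtM_in.
rewrite ga; have [_ -> //] := first_kind_local c d fF.
by have [_ -> //] := first_kind_local c d fF'.
Qed.

Lemma C1_map_first_kind f : C1_map M N f -> first_kind f (@ext_map _ _ _ _ _ M N f).
Proof.
move=> [fc fC]; apply: ext_map_first_kind => // p q r.
have [c [cp cq cr]] := common_chart M_common p q r.
have [d [dp dq dr]] := common_chart N_common (f p) (f q) (f r).
exists c, d; split=> //; split=> //.
exact: fC (set_mem (valP c)) (set_mem (valP d)).
Qed.

End FirstKindMorphism.

(** * Common charts over a field *)

Lemma hausdorff_separated (X : topologicalType) (x y : X) :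
  hausdorff_space X -> x <> y ->
  exists A B, [/\ open A, open B, A x, B y & A `&` B = set0].
Proof.
rewrite open_hausdorff => Xh /eqP /Xh [[A B] /= [/set_mem Ax /set_mem By]].
by move=> [Ao Bo /eqP AB]; exists A, B.
Qed.

Lemma hausdorff_separated2 (X : topologicalType) (x y z : X) :
  hausdorff_space X -> z <> x -> z <> y ->
  exists A B, [/\ open A, open B, A x /\ A y, B z & A `&` B = set0].
Proof.
move=> Xh /nesym xz /nesym yz.
have [A [B [Ao Bo Ax Bz AB]]] := hausdorff_separated Xh xz.
have [A' [B' [Ao' Bo' Ay Bz' AB']]] := hausdorff_separated Xh yz.
exists (A `|` A'), (B `&` B'); split=> //; [exact: openU|exact: openI|by split; [left|right]|].
apply/seteqP; split=> // w [[Aw|Aw] [Bw Bw']].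
  by have : (A `&` B) w by []; rewrite AB.
by have : (A' `&` B') w by []; rewrite AB'.
Qed.

Section FieldCharts.
Variable K : topRingType.
Hypotheses (units_dense : dense (@units K)) (K_field : is_field K).
Hypothesis K_inversion : continuous_inversion K.

(** An arrow from one set to the other has [t <> 0], since at [t = 0] its ends would coincide. So
    [t] is a unit, the slope must be the quotient [quot], and this is continuous by [K_inversion].
    Arrows inside [U], inside [U'] and between them form three disjoint open sets, on each of which
    continuity is checked. *)
Lemma C1_on_disjoint_union (V W : rightTopModType K) (U U' : set V) (f : V -> W) :
  open U -> open U' -> U `&` U' = set0 -> C1_on U f -> C1_on U' f ->
  C1_on (U `|` U') f.
Proof.
move=> Uo Uo' UU' /slopeP fU /slopeP fU'; have [i [iP ic]] := K_inversion.
have disj x : U x -> U' x -> False by move=> Ux Ux'; have : (U `&` U') x by []; rewrite UU'.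
pose quot (a : V * V * K) := (f (ext1_end a) - f a.1.1) *^ i a.2.
pose f1 a := if `[< ext1 U a >] then slope U f a
  else if `[< ext1 U' a >] then slope U' f a else quot a.
have f1U a : ext1 U a -> f1 a = slope U f a by move=> h; rewrite /f1 asboolT.
have f1U' a : ext1 U' a -> f1 a = slope U' f a.
  move=> h; rewrite /f1 asboolF; last by case: h => h _ [] /disj /(_ h).
  by rewrite asboolT.
pose mixed := [set a | U a.1.1 /\ U' (ext1_end a)] `|` [set a | U' a.1.1 /\ U (ext1_end a)].
have f1m a : mixed a -> f1 a = quot a.
  by move=> [] [h h']; rewrite /f1 !asboolF // => -[g g']; (apply: disj; [exact: g|exact: h]) ||
    (apply: disj; [exact: h|exact: g]) || (apply: disj; [exact: g'|exact: h']) ||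
    (apply: disj; [exact: h'|exact: g']).
have unit_m a : mixed a -> units a.2.
  move=> ma; apply: K_field.2 => a0; move: ma.
  by rewrite /mixed /ext1_end /= a0 rscale0r addr0 => -[] [h h']; exact: (@disj a.1.1).
have cases a : ext1 (U `|` U') a -> [\/ ext1 U a, ext1 U' a | mixed a].
  by move=> [[h|h] [h'|h']]; [apply: Or31|apply: Or33; left|apply: Or33; right|apply: Or32].
exists f1; split.
  move=> x v t xvt; have [h|h|h] := cases _ xvt.
  - by rewrite f1U //; exact: fU.1.
  - by rewrite f1U' //; exact: fU'.1.
  by rewrite f1m // /quot rscaleA (iP _ (unit_m _ h)).1 rscale1r.
have endc : continuous (@ext1_end K V).
  by apply/continuous_subspace_setT; rewrite /ext1_end; within_cont.
have fstc : continuous (fun a : V * V * K => a.1.1).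
  by apply/continuous_subspace_setT; within_cont.
have mo : open mixed.
  have -> : mixed = ((fun a : V * V * K => a.1.1) @^-1` U `&` @ext1_end K V @^-1` U') `|`
     ((fun a : V * V * K => a.1.1) @^-1` U' `&` @ext1_end K V @^-1` U) by [].
  by apply: openU; apply: openI; (apply: open_comp; [by move=> ? _|by []]).
have fc : {within U `|` U', continuous f}.
  apply: within_continuous_local => x [Ux|Ux].
    exists U; split=> //; apply: continuous_subspaceW (factorizer_continuous fU).
    by move=> y [].
  exists U'; split=> //; apply: continuous_subspaceW (factorizer_continuous fU').
  by move=> y [].
apply: within_continuous_local => a /cases [h|h|h].
- exists (ext1 U); split=> //; first exact: ext1_open.
  apply: (within_continuous_eq (f := slope U f)); first by move=> b [_ /f1U].
  by apply: continuous_subspaceW fU.2 => b [].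
- exists (ext1 U'); split=> //; first exact: ext1_open.
  apply: (within_continuous_eq (f := slope U' f)); first by move=> b [_ /f1U'].
  by apply: continuous_subspaceW fU'.2 => b [].
exists mixed; split=> //; apply: (within_continuous_eq (f := quot)).
  by move=> b [_ /f1m].
apply: within_continuous_rscale; [apply: within_continuous_add|].
- apply: (within_continuous_comp (B := U `|` U')) fc _.
    exact: continuous_subspaceT.
  by move=> b [[]].
- apply: within_continuous_opp.
  apply: (within_continuous_comp (B := U `|` U')) fc _; first by within_cont.
  by move=> b [[]].
- apply: (within_continuous_comp (B := @units K)) ic _; first by within_cont.
  by move=> b [_ /unit_m].
Qed.

Lemma C1_on_translation (V : rightTopModType K) (U : set V) (u : V) :
  C1_on U (fun x => x + u).
Proof.
exists (fun a => a.1.2); split; last by within_cont.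
by move=> x v t _; rewrite opprD addrACA subrr addr0 addrC addKr.
Qed.

Section Module.
Variables (V : rightTopModType K) (V_hausdorff : hausdorff_space V).

(** If [V] had only two points, separating them would make the set of [0] alone open. Then
    [v *^ t = 0] for all [t] near [0], in particular for some unit, and [v] would vanish. *)
Lemma third_point (v : V) : v <> 0 -> forall x y : V, exists w, w <> x /\ w <> y.
Proof.
move=> v0 x y; apply: contrapT => noW.
have xy w : w = x \/ w = y.
  by apply: contrapT => h; apply: noW; exists w; split=> e; apply: h; [left|right].
have [A [B [Ao Bo Av B0 AB]]] := hausdorff_separated V_hausdorff v0.
have nBv : ~ B v by move=> Bv; have : (A `&` B) v by []; rewrite AB.
have Bsub w : B w -> w = 0.
  move=> Bw; apply: contrapT => w0.
  have wv : w <> v by move=> e; apply: nBv; rewrite -e.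
  by case: (xy w) => ew; case: (xy v) => ev; case: (xy 0) => e0; congruence.
have so : open (setT `&` (fun t : K => v *^ t) @^-1` B).
  by apply: within_preimage_open => //; [exact: openT|within_cont].
have [t [[_ /Bsub vt0] ut]] : (setT `&` (fun t : K => v *^ t) @^-1` B) `&` @units K !=set0.
  by apply: units_dense => //; exists 0; split=> //=; rewrite rscale0r.
by apply: v0; apply: (rscale_unit_inj ut); rewrite vt0 rscale0l.
Qed.

Variables (T : topologicalType) (M : manifold V T).
Implicit Types (c d e : chart T V).

Definition restrict_chart c (A : set T) : chart T V :=
  Chart (dom c `&` A) (cod c `&` bwd c @^-1` A) (fwd c) (bwd c).

Lemma restrict_chart_atlas c (A : set T) : atlas M c -> open A ->
  (dom c `&` A) !=set0 -> atlas M (restrict_chart c A).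
Proof.
move=> Mc Ao A0; have cP := atlas_chart Mc; apply: atlas_maximal.
  split=> //=.
  - by apply: openI => //; exact: chart_dom_open.
  - by apply: within_preimage_open => //; [exact: chart_cod_open|exact: chart_bwd_continuous].
  split=> /=.
  - by move=> p [cp Ap]; split; [exact: chart_fwd|rewrite /= chart_fwdK].
  - by move=> x [cx Ax]; split=> //; exact: chart_bwd.
  - by move=> p /set_mem [cp _]; exact: chart_fwdK.
  - by move=> x /set_mem [cx _]; exact: chart_bwdK.
  split.
    by apply: continuous_subspaceW (chart_fwd_continuous cP) => p [].
  by apply: continuous_subspaceW (chart_bwd_continuous cP) => x [].
move=> d Md; have [cd dc] := atlas_compatible Mc Md; split.
  apply: C1_on_sub cd => _ [p [[cp _] dp] <-]; by exists p.
by apply: C1_on_sub dc => _ [p [dp [cp _]] <-]; exists p.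
Qed.

Definition translate_chart c (u : V) : chart T V :=
  Chart (dom c) [set x | cod c (x - u)] (fun p => fwd c p + u)
    (fun x => bwd c (x - u)).

Lemma translate_chart_atlas c (u : V) : atlas M c -> atlas M (translate_chart c u).
Proof.
move=> Mc; have cP := atlas_chart Mc; apply: atlas_maximal.
  have subc (A : set V) : {within A, continuous (fun x => x - u)} by within_cont.
  split=> //=.
  - by case: cP.
  - exact: chart_dom_open.
  - have -> : [set x | cod c (x - u)] = setT `&` (fun x => x - u) @^-1` cod c.
      by rewrite setTI.
    by apply: within_preimage_open => //; [exact: openT|exact: chart_cod_open].
  split=> /=.
  - by move=> p cp; rewrite /= addrK; exact: chart_fwd.
  - by move=> x cx; exact: chart_bwd.
  - by move=> p /set_mem cp; rewrite addrK chart_fwdK.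
  - by move=> x /set_mem cx; rewrite chart_bwdK // subrK.
  split.
    apply: within_continuous_add; last by within_cont.
    exact: chart_fwd_continuous.
  apply: (within_continuous_comp (B := cod c)) (chart_bwd_continuous cP) _ => //.
move=> d Md; have [cd dc] := atlas_compatible Mc Md; split.
  exact: (C1_on_comp cd (C1_on_translation setT u)).
apply: (C1_on_comp (C1_on_translation _ (- u)) dc).
by move=> _ [p [dp cp] <-]; exists p => //=; rewrite addrK.
Qed.

Definition union_chart c d : chart T V :=
  Chart (dom c `|` dom d) (cod c `|` cod d)
    (fun p => if `[< dom c p >] then fwd c p else fwd d p)
    (fun x => if `[< cod c x >] then bwd c x else bwd d x).

(** Against any chart [e] of the atlas, the overlaps split into disjoint open parts coming from [c]
    and [d]: disjointness of the domains serves the transitions out of [e], disjointness of the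
    codomains those into [e]. Maximality then admits the union. *)
Lemma union_chart_atlas c d : atlas M c -> atlas M d ->
  dom c `&` dom d = set0 -> cod c `&` cod d = set0 -> atlas M (union_chart c d).
Proof.
move=> Mc Md dom0 cod0; have cP := atlas_chart Mc; have dP := atlas_chart Md.
have domN p : dom d p -> ~ dom c p.
  by move=> dp cp; have : (dom c `&` dom d) p by []; rewrite dom0.
have codN x : cod d x -> ~ cod c x.
  by move=> dx cx; have : (cod c `&` cod d) x by []; rewrite cod0.
have fwd1 p : dom c p -> fwd (union_chart c d) p = fwd c p.
  by move=> cp; rewrite /= asboolT.
have fwd2 p : dom d p -> fwd (union_chart c d) p = fwd d p.
  by move=> /domN cp; rewrite /= asboolF.
have bwd1 x : cod c x -> bwd (union_chart c d) x = bwd c x.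
  by move=> cx; rewrite /= asboolT.
have bwd2 x : cod d x -> bwd (union_chart c d) x = bwd d x.
  by move=> /codN cx; rewrite /= asboolF.
apply: atlas_maximal.
  split.
  - by case: cP => -[p cp] _ _ _; exists p; left.
  - by apply: openU; exact: chart_dom_open.
  - by apply: openU; exact: chart_cod_open.
  split.
  - by move=> p [cp|dp]; [rewrite fwd1 //; left|rewrite fwd2 //; right]; exact: chart_fwd.
  - by move=> x [cx|dx]; [rewrite bwd1 //; left|rewrite bwd2 //; right]; exact: chart_bwd.
  - move=> p /set_mem [cp|dp].
      by rewrite fwd1 // bwd1 ?chart_fwdK //; exact: chart_fwd.
    by rewrite fwd2 // bwd2 ?chart_fwdK //; exact: chart_fwd.
  - move=> x /set_mem [cx|dx].
      by rewrite bwd1 // fwd1 ?chart_bwdK //; exact: chart_bwd.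
    by rewrite bwd2 // fwd2 ?chart_bwdK //; exact: chart_bwd.
  split; apply: within_continuous_local.
    move=> p [cp|dp].
      exists (dom c); split=> //; first exact: chart_dom_open.
      apply: (within_continuous_eq (f := fwd c)); first by move=> q [_ /fwd1].
      by apply: continuous_subspaceW (chart_fwd_continuous cP) => q [].
    exists (dom d); split=> //; first exact: chart_dom_open.
    apply: (within_continuous_eq (f := fwd d)); first by move=> q [_ /fwd2].
    by apply: continuous_subspaceW (chart_fwd_continuous dP) => q [].
  move=> x [cx|dx].
    exists (cod c); split=> //; first exact: chart_cod_open.
    apply: (within_continuous_eq (f := bwd c)); first by move=> q [_ /bwd1].
    by apply: continuous_subspaceW (chart_bwd_continuous cP) => q [].
  exists (cod d); split=> //; first exact: chart_cod_open.
  apply: (within_continuous_eq (f := bwd d)); first by move=> q [_ /bwd2].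
  by apply: continuous_subspaceW (chart_bwd_continuous dP) => q [].
move=> e Me; have eP := atlas_chart Me.
have [ce ec] := atlas_compatible Mc Me; have [de ed] := atlas_compatible Md Me.
split.
  have -> : overlap (union_chart c d) e = overlap c e `|` overlap d e.
    apply/seteqP; split=> [_ [p [[cp|dp] ep] <-]|x [[p [cp ep] <-]|[p [dp ep] <-]]].
    - by left; exists p.
    - by right; exists p.
    - by exists p => //; split=> //; left.
    - by exists p => //; split=> //; right.
  apply: C1_on_disjoint_union; try exact: overlap_open.
  - rewrite !overlapE //; apply/seteqP; split=> // x [[_ /= cx] [_ /= dx]].
    exact: domN dx cx.
  - apply: C1_on_eq ce => x; rewrite overlapE // => -[_ /= cx].
    by rewrite /transition /comp /= asboolT.
  - apply: C1_on_eq de => x; rewrite overlapE // => -[_ /= dx].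
    by rewrite /transition /comp /= asboolF //; exact: domN.
have -> : overlap e (union_chart c d) = overlap e c `|` overlap e d.
  apply/seteqP; split=> [_ [p [ep [cp|dp]] <-]|x [[p [ep cp] <-]|[p [ep dp] <-]]].
  - by left; exists p => //; rewrite fwd1.
  - by right; exists p => //; rewrite fwd2.
  - by exists p; [split=> //; left|rewrite fwd1].
  - by exists p; [split=> //; right|rewrite fwd2].
apply: C1_on_disjoint_union; try exact: overlap_open.
- rewrite !overlapE //; apply/seteqP; split=> // x [[cx _] [dx _]].
  exact: codN dx cx.
- apply: C1_on_eq ec => x; rewrite overlapE // => -[cx _].
  by rewrite /transition /comp /= asboolT.
- apply: C1_on_eq ed => x; rewrite overlapE // => -[dx _].
  by rewrite /transition /comp /= asboolF //; exact: codN.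
Qed.

(** The points [p] and [q] may coincide. The two charts are shrunk until both their domains and
    their images are disjoint, separating [r] from [p] and [q] in [T], and the corresponding images
    in [V]. *)
Lemma join_charts c d p q r : hausdorff_space T -> (exists v : V, v <> 0) ->
  atlas M c -> atlas M d -> dom c p -> dom c q -> dom d r -> r <> p -> r <> q ->
  exists e, atlas M e /\ [/\ dom e p, dom e q & dom e r].
Proof.
move=> Th [v v0] Mc Md cp cq dr rp rq.
have cP := atlas_chart Mc.
have [w [wx wy]] := third_point v0 (fwd c p) (fwd c q).
(* The translation sends [r] to [w], a point different from the images of [p] and [q] under [c]. *)
pose d1 := translate_chart d (w - fwd d r).
have Md1 : atlas M d1 by exact: translate_chart_atlas.
have d1r : fwd d1 r = w by rewrite /= addrC subrK.
have dP1 := atlas_chart Md1; have d1dr : dom d1 r by [].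
have [A [B [Ao Bo [Ap Aq] Br AB]]] := hausdorff_separated2 Th rp rq.
have [A' [B' [Ao' Bo' [Ax Ay] Bw AB']]] := hausdorff_separated2 V_hausdorff wx wy.
have Br' : B' (fwd d1 r) by rewrite d1r.
pose c2 := restrict_chart c (A `&` (dom c `&` fwd c @^-1` A')).
pose d2 := restrict_chart d1 (B `&` (dom d1 `&` fwd d1 @^-1` B')).
have Mc2 : atlas M c2.
  apply: restrict_chart_atlas => //; last by exists p.
  apply: openI => //; apply: within_preimage_open => //; first exact: chart_dom_open.
  exact: chart_fwd_continuous.
have Md2 : atlas M d2.
  apply: restrict_chart_atlas => //; last by exists r.
  apply: openI => //; apply: within_preimage_open => //; first exact: chart_dom_open.
  exact: chart_fwd_continuous.
exists (union_chart c2 d2); split; last first.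
  split; [by left; do !split|by left; do !split|].
  by right.
apply: union_chart_atlas => //.
  apply/seteqP; split=> // x [[_ [Ax' _]] [_ [Bx' _]]].
  by have : (A `&` B) x by []; rewrite AB.
apply/seteqP; split=> // x [[cx [_ [_ Ax']]] [dx [_ [_ Bx']]]].
have : (A' `&` B') x; last by rewrite AB'.
split; first by move: Ax'; rewrite /preimage /= chart_bwdK.
by rewrite -(chart_bwdK dP1 dx).
Qed.

End Module.

End FieldCharts.

Lemma enough_charts_common (K : topRingType) (V : rightTopModType K)
    (T : topologicalType) (M : manifold V T) :
  dense (@units K) -> hausdorff_space V -> hausdorff_space T ->
  enough_charts M -> common_charts M.
Proof.
move=> Kd Vh Th [[Kf Ki Vn]|//] p q r.
have join := join_charts Kd Kf Ki Vh (M := M) Th Vn.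
have [c [Mc [cp cq]]] : exists c, atlas M c /\ (dom c p /\ dom c q).
  have [c [Mc cp]] := atlas_cover M p.
  have [->|qp] := pselect (q = p); first by exists c.
  have [d [Md dq]] := atlas_cover M q.
  (* Two points are joined as the degenerate triple [p], [p], [q]. *)
  by have [e [Me [ep _ eq]]] := join _ _ _ _ _ Mc Md cp cp dq qp qp; exists e.
have [->|rp] := pselect (r = p); first by exists c.
have [->|rq] := pselect (r = q); first by exists c.
have [d [Md dr]] := atlas_cover M r.
exact: join Mc Md cp cq dr rp rq.
Qed.

(** * Products *)

Lemma hausdorff_prod (X Y : topologicalType) :
  hausdorff_space X -> hausdorff_space Y -> hausdorff_space (X * Y)%type.
Proof.
move=> Xh Yh [x y] [x' y'] pq; congr (_, _).
  apply: Xh => A B Ax Bx.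
  have [||[a b] [Aa Ba]] := pq (fst @^-1` A) (fst @^-1` B); last by exists a.
    exact: (@cvg_fst _ _ (nbhs x) (nbhs y)).
  exact: (@cvg_fst _ _ (nbhs x') (nbhs y')).
apply: Yh => A B Ay By.
have [||[a b] [Ab Bb]] := pq (snd @^-1` A) (snd @^-1` B); last by exists b.
  exact: (@cvg_snd _ _ (nbhs x) (nbhs y)).
exact: (@cvg_snd _ _ (nbhs x') (nbhs y')).
Qed.

(** Two charts compatible with all of [A] need not be compatible with each other, so one cannot
    simply add all of them; a maximal compatible family comes from Zorn's lemma. *)
Lemma maximal_atlas (K : topRingType) (V : rightTopModType K) (T : topologicalType)
    (A : set (chart T V)) :
  (forall c, A c -> is_chart c) -> (forall p, exists c, A c /\ dom c p) ->
  (forall c d, A c -> A d -> C1_compatible c d) ->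
  exists M : manifold V T, A `<=` atlas M.
Proof.
move=> A_chart A_cover A_comp.
pose good (B : set (chart T V)) := (forall c, B c -> is_chart c) /\
  (forall c d, B c -> B d -> C1_compatible c d).
(* Zorn's lemma is applied to the [B] whose union with [A] is good, instead of to the good sets
   containing [A], so that the empty chain also has its union in the family. *)
have [F Fgood Ftot|B [Bgood Bmax]] := @Zorn_bigcup _ [set B | good (B `|` A)].
  split=> [c [[B FB Bc]|Ac]|c d]; first by have [h _] := Fgood _ FB; apply: h; left.
    exact: A_chart.
  move=> [[B FB Bc]|Ac] [[B' FB' Bd]|Ad].
  - have [BB'|BB'] := Ftot _ _ FB FB'.
      by have [_ h] := Fgood _ FB'; apply: h; left => //; exact: BB'.
    by have [_ h] := Fgood _ FB; apply: h; left => //; exact: BB'.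
  - by have [_ h] := Fgood _ FB; apply: h; [left|right].
  - by have [_ h] := Fgood _ FB'; apply: h; [right|left].
  - exact: A_comp.
have compS c d : C1_compatible c d -> C1_compatible d c by case.
have B_maximal c : is_chart c -> (forall d, (B `|` A) d -> C1_compatible c d) ->
    (B `|` A) c.
  move=> cP cc; apply: contrapT => nc; apply: (Bmax (B `|` [set c])).
    split; first by move=> d Bd; left.
    by move=> h; apply: nc; left; apply: h; right.
  have cself : C1_compatible c c.
    have h : C1_on (overlap c c) (transition c c).
      apply: C1_on_eq (@C1_on_id _ _ _) => x.
      by rewrite overlapE // => -[cx _]; rewrite /transition /= chart_bwdK.
    by split.
  split=> [d [[Bd|->]|Ad]|d d' hd hd'] //.
  - by apply: Bgood.1; left.
  - by apply: Bgood.1; right.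
  have hE e : ((B `|` [set c]) `|` A) e -> (B `|` A) e \/ e = c.
    by move=> [[Be|->]|Ae]; [left; left|right|left; right].
  case: (hE _ hd) => [{}hd|->]; case: (hE _ hd') => [{}hd'|->].
  - exact: Bgood.2.
  - exact: compS (cc _ hd).
  - exact: cc.
  - exact: cself.
have cover p : exists c, (B `|` A) c /\ dom c p.
  by have [c [Ac cp]] := A_cover p; exists c; split=> //; right.
by exists (Manifold Bgood.1 cover Bgood.2 B_maximal) => c Ac; right.
Qed.

Section ProductCharts.
Variables (K : topRingType) (V W : rightTopModType K) (TM TN : topologicalType).
Implicit Types (c : chart TM V) (d : chart TN W).

Lemma prod_chartP c d : is_chart c -> is_chart d -> is_chart (prod_chart c d).
Proof.
move=> cP dP; split=> /=.
- by have [[p cp] _ _ _] := cP; have [[q dq] _ _ _] := dP; exists (p, q).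
- by apply: open_setX; exact: chart_dom_open.
- by apply: open_setX; exact: chart_cod_open.
split=> /=.
- by move=> [p q] [/= cp dq]; split; exact: chart_fwd.
- by move=> [x y] [/= cx dy]; split; exact: chart_bwd.
- by move=> [p q] /set_mem [/= cp dq]; rewrite !chart_fwdK.
- by move=> [x y] /set_mem [/= cx dy]; rewrite !chart_bwdK.
split; apply: within_continuous_pair.
- apply: (within_continuous_comp (B := dom c)) (chart_fwd_continuous cP) _.
    by within_cont.
  by move=> p [].
- apply: (within_continuous_comp (B := dom d)) (chart_fwd_continuous dP) _.
    by within_cont.
  by move=> p [].
- apply: (within_continuous_comp (B := cod c)) (chart_bwd_continuous cP) _.
    by within_cont.
  by move=> p [].
- apply: (within_continuous_comp (B := cod d)) (chart_bwd_continuous dP) _.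
    by within_cont.
  by move=> p [].
Qed.

Lemma prod_chart_C1 c d c' d' :
  C1_on (overlap c c') (transition c c') -> C1_on (overlap d d') (transition d d') ->
  C1_on (overlap (prod_chart c d) (prod_chart c' d'))
    (transition (prod_chart c d) (prod_chart c' d')).
Proof.
move=> cC dC; apply: C1_on_sub (C1_on_prod cC dC).
by move=> _ [[p q] [[/= ? ?] [/= ? ?]] <-]; split; [exists p|exists q].
Qed.

Lemma product_manifold_exists (M : manifold V TM) (N : manifold W TN) :
  exists P, is_product_manifold M N P.
Proof.
pose A := [set e | exists c d, [/\ atlas M c, atlas N d & e = prod_chart c d]].
have [|||P AP] := @maximal_atlas K (V * W)%type (TM * TN)%type A.
- by move=> _ [c [d [Mc Nd ->]]]; apply: prod_chartP;
    [exact: atlas_chart Mc|exact: atlas_chart Nd].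
- move=> [p q]; have [c [Mc cp]] := atlas_cover M p; have [d [Nd dq]] := atlas_cover N q.
  by exists (prod_chart c d); split=> //; exists c, d.
- move=> _ _ [c [d [Mc Nd ->]]] [c' [d' [Mc' Nd' ->]]].
  have [? ?] := atlas_compatible Mc Mc'; have [? ?] := atlas_compatible Nd Nd'.
  by split; exact: prod_chart_C1.
by exists P => c d Mc Nd; apply: AP; exists c, d.
Qed.

End ProductCharts.

(** * The extension of a product as a fibre product over [K] *)

Section ProductExtension.
Variables (K : topRingType) (V W : rightTopModType K) (TM TN : topologicalType).
Hypothesis units_dense : dense (@units K).
Hypotheses (V_hausdorff : hausdorff_space V) (W_hausdorff : hausdorff_space W).
Variables (M : manifold V TM) (N : manifold W TN).
Hypotheses (M_common : common_charts M) (N_common : common_charts N).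
Variable P : manifold (V * W)%type (TM * TN)%type.
Hypothesis P_product : is_product_manifold M N P.
Implicit Types (c : atlas M) (d : atlas N) (e : atlas P).

Let VW_hausdorff : hausdorff_space (V * W)%type := hausdorff_prod V_hausdorff W_hausdorff.
Let MG : is_gluing (ext_gluing M) := ext_gluingP units_dense V_hausdorff M.
Let NG : is_gluing (ext_gluing N) := ext_gluingP units_dense W_hausdorff N.
Let srcM_in := ext_src_in units_dense V_hausdorff (M := M).
Let srcN_in := ext_src_in units_dense W_hausdorff (M := N).

Lemma product_atlas c d : exists e, val e = prod_chart (val c) (val d).
Proof.
by apply: atlas_pick; apply: P_product; [exact: set_mem (valP c)|exact: set_mem (valP d)].
Qed.

Lemma product_chart_at (p q r : TM * TN) : exists c d e,
  [/\ val e = prod_chart (val c) (val d), dom (val e) p, dom (val e) q & dom (val e) r].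
Proof.
have [c [cp cq cr]] := common_chart M_common p.1 q.1 r.1.
have [d [dp dq dr]] := common_chart N_common p.2 q.2 r.2.
by have [e eE] := product_atlas c d; exists c, d, e; rewrite eE.
Qed.

Lemma C1_on_fst (U : set (V * W)) : C1_on U fst.
Proof.
exists (fun a : (V * W) * (V * W) * K => a.1.2.1); split; last by within_cont.
by move=> x v t _; rewrite /= addrC addKr.
Qed.

Lemma C1_on_snd (U : set (V * W)) : C1_on U snd.
Proof.
exists (fun a : (V * W) * (V * W) * K => a.1.2.2); split; last by within_cont.
by move=> x v t _; rewrite /= addrC addKr.
Qed.

Section ProductChart.
Variables (c : atlas M) (d : atlas N) (e : atlas P).
Hypothesis eE : val e = prod_chart (val c) (val d).

Let cP := atlasP c.
Let dP := atlasP d.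
Let eP := atlasP e.

Lemma local_dom_fst : local_dom fst (val e) (val c) = cod (val e).
Proof.
rewrite (local_domE _ _ eP); apply: setIidl => x ex.
by move: ex; rewrite /mkset eE => -[cx _]; exact: (chart_bwd cP cx).
Qed.

Lemma local_dom_snd : local_dom snd (val e) (val d) = cod (val e).
Proof.
rewrite (local_domE _ _ eP); apply: setIidl => x ex.
by move: ex; rewrite /mkset eE => -[_ dx]; exact: (chart_bwd dP dx).
Qed.

Lemma local_map_fst x : cod (val e) x -> x.1 = local_map fst (val e) (val c) x.
Proof. by rewrite eE => -[cx _]; rewrite /local_map /= chart_bwdK. Qed.

Lemma local_map_snd x : cod (val e) x -> x.2 = local_map snd (val e) (val d) x.
Proof. by rewrite eE => -[_ dx]; rewrite /local_map /= chart_bwdK. Qed.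

Lemma local_C1_fst :
  C1_on (local_dom fst (val e) (val c)) (local_map fst (val e) (val c)).
Proof. by rewrite local_dom_fst; apply: C1_on_eq (@C1_on_fst _); exact: local_map_fst. Qed.

Lemma local_C1_snd :
  C1_on (local_dom snd (val e) (val d)) (local_map snd (val e) (val d)).
Proof. by rewrite local_dom_snd; apply: C1_on_eq (@C1_on_snd _); exact: local_map_snd. Qed.

End ProductChart.

Lemma fst_continuous : continuous (fst : TM * TN -> TM).
Proof. by move=> p; exact: cvg_fst. Qed.

Lemma snd_continuous : continuous (snd : TM * TN -> TN).
Proof. by move=> p; exact: cvg_snd. Qed.

(** Built from the extensions of the two projections, so that continuity and compatibility with the
    groupoid structures come from [ext_map_first_kind]. *)
Definition ext_split (g : ext P) : ext M * ext N :=
  (@ext_map _ _ _ _ _ P M fst g, @ext_map _ _ _ _ _ P N snd g).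

Lemma ext_split_in c d e a : val e = prod_chart (val c) (val d) -> ext1 (cod (val e)) a ->
  ext_split (ext_in e a) =
    (ext_in c (a.1.1.1, a.1.2.1, a.2), ext_in d (a.1.1.2, a.1.2.2, a.2)).
Proof.
move=> eE ea; have co := chart_cod_open (atlasP e).
have f1 := local_C1_fst eE; have f2 := local_C1_snd eE.
rewrite /ext_split (ext_map_in units_dense VW_hausdorff V_hausdorff fst_continuous f1);
  last by rewrite (local_dom_fst eE).
rewrite (ext_map_in units_dense VW_hausdorff W_hausdorff snd_continuous f2);
  last by rewrite (local_dom_snd eE).
congr (ext_in c _, ext_in d _).
  rewrite (local_dom_fst eE) in f1 *.
  apply: (tangent1_factorizer units_dense V_hausdorff (g := fst)
    (g1 := fun a => a.1.2.1) co _ f1 _ _ ea) => //.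
    by move=> x /(local_map_fst eE).
  split; last by within_cont.
  by move=> x v t _; rewrite /= addrC addKr.
rewrite (local_dom_snd eE) in f2 *.
apply: (tangent1_factorizer units_dense W_hausdorff (g := snd)
  (g1 := fun a => a.1.2.2) co _ f2 _ _ ea) => //.
  by move=> x /(local_map_snd eE).
split; last by within_cont.
by move=> x v t _; rewrite /= addrC addKr.
Qed.

(** Any three points of the product lie in one product chart, where the projection is linear. In the
    other charts of [P] nothing is known about it yet. *)
Lemma ext_fst_first_kind :
  first_kind fst (@ext_map _ _ _ _ _ P M fst).
Proof.
apply: (ext_map_first_kind units_dense VW_hausdorff V_hausdorff fst_continuous) => p q r.
have [c [d [e [eE ep eq er]]]] := product_chart_at p q r.
have h x : dom (val e) x -> dom (val c) x.1 by rewrite eE => -[].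
by exists e, c; split=> //; split; try exact: h; exact: local_C1_fst eE.
Qed.

Lemma ext_snd_first_kind :
  first_kind snd (@ext_map _ _ _ _ _ P N snd).
Proof.
apply: (ext_map_first_kind units_dense VW_hausdorff W_hausdorff snd_continuous) => p q r.
have [c [d [e [eE ep eq er]]]] := product_chart_at p q r.
have h x : dom (val e) x -> dom (val d) x.2 by rewrite eE => -[].
by exists e, d; split=> //; split; try exact: h; exact: local_C1_snd eE.
Qed.

Lemma ext_split_continuous : {within setT, continuous ext_split}.
Proof.
by apply: within_continuous_pair;
  [have [_ _] := ext_fst_first_kind|have [_ _] := ext_snd_first_kind].
Qed.

Lemma ext_split_src g :
  ext_src (ext_split g).1 = ((ext_src g).1.1, (ext_src g).2) /\
  ext_src (ext_split g).2 = ((ext_src g).1.2, (ext_src g).2).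
Proof.
have [F1 _ _] := ext_fst_first_kind; have [F2 _ _] := ext_snd_first_kind.
by split; [exact: (morph_src F1)|exact: (morph_src F2)].
Qed.

Lemma ext_split_tgt g :
  ext_tgt (ext_split g).1 = ((ext_tgt g).1.1, (ext_tgt g).2) /\
  ext_tgt (ext_split g).2 = ((ext_tgt g).1.2, (ext_tgt g).2).
Proof.
have [F1 _ _] := ext_fst_first_kind; have [F2 _ _] := ext_snd_first_kind.
by split; [exact: (morph_tgt F1)|exact: (morph_tgt F2)].
Qed.

(** Equal images force equal ends, so both arrows lie in one product chart, where [ext_split] merely
    rearranges coordinates. *)
Lemma ext_split_inj : injective ext_split.
Proof.
move=> g g' gg.
have es : ext_src g = ext_src g'.
  have [s1 s2] := ext_split_src g; have [s1' s2'] := ext_split_src g'.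
  move: s1 s2; rewrite gg s1' s2' => -[e1 e2] [e3 _].
  by move: e1 e2 e3; case: (ext_src g) (ext_src g') => [[? ?] ?] [[? ?] ?] /= -> -> ->.
have et : ext_tgt g = ext_tgt g'.
  have [s1 s2] := ext_split_tgt g; have [s1' s2'] := ext_split_tgt g'.
  move: s1 s2; rewrite gg s1' s2' => -[e1 e2] [e3 _].
  by move: e1 e2 e3; case: (ext_tgt g) (ext_tgt g') => [[? ?] ?] [[? ?] ?] /= -> -> ->.
have [c [d [e [eE ep eq _]]]] := product_chart_at (ext_src g).1 (ext_tgt g).1 (ext_tgt g).1.
have [a ea ga] := ext_in_chart units_dense VW_hausdorff ep eq.
rewrite es in ep; rewrite et in eq.
have [b eb gb] := ext_in_chart units_dense VW_hausdorff ep eq.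
rewrite ga gb; congr (ext_in e _).
move: gg; rewrite ga gb !(ext_split_in eE) // => /pair_equal_spec [h1 h2].
have [ca da] : ext1 (cod (val c)) (a.1.1.1, a.1.2.1, a.2) /\
    ext1 (cod (val d)) (a.1.1.2, a.1.2.2, a.2).
  by move: ea; rewrite eE => -[[? ?] [? ?]].
have [cb db] : ext1 (cod (val c)) (b.1.1.1, b.1.2.1, b.2) /\
    ext1 (cod (val d)) (b.1.1.2, b.1.2.2, b.2).
  by move: eb; rewrite eE => -[[? ?] [? ?]].
move: (ext_in_inj units_dense V_hausdorff ca cb h1) (ext_in_inj units_dense W_hausdorff da db h2).
by case: (a) (b) => [[[? ?] [? ?]] ?] [[[? ?] [? ?]] ?] /= [-> -> ->] [-> ->].
Qed.

Definition fibre_product : set (ext M * ext N) :=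
  [set g | (ext_src g.1).2 = (ext_src g.2).2].

(** The level is read from the first factor; on [fibre_product] the second factor has the same
    one. *)
Definition product_coord c d (z : ext M * ext N) : (V * W) * (V * W) * K :=
  let a := @glued_coord (ext_gluing M) c z.1 in
  let b := @glued_coord (ext_gluing N) d z.2 in
  ((a.1.1, b.1.1), (a.1.2, b.1.2), a.2).

Lemma product_coordP c d e z : val e = prod_chart (val c) (val d) ->
  fibre_product z -> @glued_dom (ext_gluing M) c z.1 ->
  @glued_dom (ext_gluing N) d z.2 ->
  ext1 (cod (val e)) (product_coord c d z) /\
  ext_split (ext_in e (product_coord c d z)) = z.
Proof.
case: z => g h eE /=; rewrite /fibre_product /product_coord /= => gh.
move=> /glued_coordK [] + + /glued_coordK [].
move: (@glued_coord (ext_gluing M) c g) (@glued_coord (ext_gluing N) d h).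
move=> [[x v] t] [[y w] s] /= ca gE db hE.
move: gh; rewrite -gE -hE -/(ext_in c _) -/(ext_in d _) srcM_in // srcN_in //= => ts.
subst s; have ea : ext1 (cod (val e)) ((x, y), (v, w), t).
  by rewrite eE; case: ca db => ? ? [? ?]; do !split.
by rewrite (ext_split_in eE).
Qed.

Lemma product_charts_at (z : ext M * ext N) : exists cde : atlas M * atlas N * atlas P,
  [/\ val cde.2 = prod_chart (val cde.1.1) (val cde.1.2),
      @glued_dom (ext_gluing M) cde.1.1 z.1 & @glued_dom (ext_gluing N) cde.1.2 z.2].
Proof.
have [c [cp cq _]] := common_chart M_common (ext_src z.1).1 (ext_tgt z.1).1 (ext_tgt z.1).1.
have [d [dp dq _]] := common_chart N_common (ext_src z.2).1 (ext_tgt z.2).1 (ext_tgt z.2).1.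
have [e eE] := product_atlas c d; exists (c, d, e); split=> //.
  exact/(ext_domP units_dense V_hausdorff).
exact/(ext_domP units_dense W_hausdorff).
Qed.

Definition ext_join (z : ext M * ext N) : ext P :=
  let cde := sval (cid (product_charts_at z)) in
  ext_in cde.2 (product_coord cde.1.1 cde.1.2 z).

Lemma ext_joinK z : fibre_product z -> ext_split (ext_join z) = z.
Proof.
rewrite /ext_join; case: cid => -[[c d] e] /= [eE cz dz] zz.
by have [] := product_coordP eE zz cz dz.
Qed.

Lemma ext_splitP g : fibre_product (ext_split g).
Proof. by rewrite /fibre_product /mkset (ext_split_src g).1 (ext_split_src g).2. Qed.

Lemma ext_splitK g : ext_join (ext_split g) = g.
Proof. by apply: ext_split_inj; rewrite ext_joinK //; exact: ext_splitP. Qed.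

Lemma ext_join_continuous : {within fibre_product, continuous ext_join}.
Proof.
apply: within_continuous_local => z _; have [[[c d] e] /= [eE cz dz]] := product_charts_at z.
exists (@glued_dom (ext_gluing M) c `*` @glued_dom (ext_gluing N) d); split=> //.
  by apply: open_setX; exact: glued_dom_open.
apply: (within_continuous_eq (f := fun z => ext_in e (product_coord c d z))).
  (* Injectivity of [ext_split] shows that the charts chosen in [ext_join] do not matter, so [c],
     [d] and [e] can be kept fixed near [z]. *)
  move=> y [yy [cy dy]]; apply: ext_split_inj; rewrite ext_joinK //.
  by have [] := product_coordP eE yy cy dy.
apply: (within_continuous_comp (B := ext1 (cod (val e)))).
- set B := _ `&` _.
  have c1 : {within B, continuous (fun z => @glued_coord (ext_gluing M) c z.1)}.
    apply: (within_continuous_comp (B := @glued_dom (ext_gluing M) c)).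
    + by within_cont.
    + exact: (glued_coord_continuous MG).
    + by move=> y [_ []].
  have c2 : {within B, continuous (fun z => @glued_coord (ext_gluing N) d z.2)}.
    apply: (within_continuous_comp (B := @glued_dom (ext_gluing N) d)).
    + by within_cont.
    + exact: (glued_coord_continuous NG).
    + by move=> y [_ []].
  by rewrite /product_coord; within_cont.
- exact: (ext_in_continuous units_dense VW_hausdorff).
- by move=> y [yy [cy dy]]; have [] := product_coordP eE yy cy dy.
Qed.

Lemma ext_split_homeomorphism : homeo_pair setT fibre_product ext_split ext_join.
Proof.
split.
- by move=> g _; exact: ext_splitP.
- by [].
- by move=> g _; exact: ext_splitK.
- by move=> z /set_mem; exact: ext_joinK.
- split; [exact: ext_split_continuous|exact: ext_join_continuous].
Qed.

Lemma ext_split_fiber_iso t :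
  is_continuous_iso (ext_fiber P t)
    (prod_groupoid (ext_fiber M t) (ext_fiber N t)) id ext_split.
Proof.
have [F1 _ _] := ext_fst_first_kind; have [F2 _ _] := ext_snd_first_kind.
have sP g := ext_split_src g; have tP g := ext_split_tgt g.
split.
- split=> //=.
  + by move=> g gt; split; rewrite /= ?(sP g).1 ?(sP g).2.
  + by move=> g gt; rewrite (sP g).1 (sP g).2 /= -surjective_pairing.
  + by move=> g gt; rewrite (tP g).1 (tP g).2 /= -surjective_pairing.
  + move=> p _; congr (_, _); first exact: (morph_one F1 (x := (p, t)) I).
    exact: (morph_one F2 (x := (p, t)) I).
  + move=> g' g /ext_fiber_composable gg.
    by congr (_, _); [exact: (morph_comp F1 gg)|exact: (morph_comp F2 gg)].
- suff -> : obj (prod_groupoid (ext_fiber M t) (ext_fiber N t)) = obj (ext_fiber P t).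
    exact: homeomorphism_id.
  by apply/seteqP; split.
exists ext_join; split.
- by move=> g gt; split; rewrite /= ?(sP g).1 ?(sP g).2.
- move=> z [/= z1 z2]; have zz : fibre_product z by rewrite /fibre_product /mkset z1 z2.
  by have [] := sP (ext_join z); rewrite ext_joinK // => + _ => e; rewrite -z1 e.
- by move=> g _; exact: ext_splitK.
- by move=> z /set_mem [/= z1 z2]; apply: ext_joinK; rewrite /fibre_product /mkset z1 z2.
split; first by apply: continuous_subspaceW ext_split_continuous.
apply: continuous_subspaceW ext_join_continuous => z [/= z1 z2].
by rewrite /fibre_product /mkset z1 z2.
Qed.

End ProductExtension.

Theorem theorem2p11 (K : topRingType) (V W : rightTopModType K)
    (TM TN : topologicalType) (M : manifold V TM) (N : manifold W TN)
    (K_dense : dense (@units K))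
    (V_hausdorff : hausdorff_space V) (W_hausdorff : hausdorff_space W)
    (M_hausdorff : hausdorff_space TM) (N_hausdorff : hausdorff_space TN) :
  [/\ (* (1) *)
      forall (U : set V) (f : V -> W), open U -> C1_on U f ->
        [/\ is_groupoid (local_groupoid U),
            is_groupoid (local_groupoid [set: W])
          & is_morphism (local_groupoid U) (local_groupoid [set: W])
              (fun p : V * K => (f p.1, p.2)) (tangent1 U f)],
      enough_charts M ->
      [/\ (* (2) *)
          continuous_groupoid (ext_groupoid M) /\
          (forall c : atlas M,
            is_morphism (local_groupoid (cod (val c))) (ext_groupoid M)
              (fun p : V * K => (bwd (val c) p.1, p.2)) (ext_in c)),
          (* (3) *)
          is_iso (ext_groupoid M) (bundle_total (ext_fiber M)) id
            (fun g => (g, (ext_src g).2)) /\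
          (forall t : K, continuous_groupoid (ext_fiber M t)),
          (* (4), tangent bundle *)
          is_group_bundle (tb_groupoid M) /\
          (exists theta : tangent_bundle M -> ext M,
            [/\ forall (c : atlas M) x v, cod (val c) x ->
                  theta (tb_in c (x, v)) = ext_in c (x, v, 0),
                is_continuous_iso (tb_groupoid M) (ext_fiber M 0) id theta
              & is_field K ->
                is_iso (sum_groupoid (ext_units M) (tb_groupoid M))
                  (ext_groupoid M)
                  (fun x => match x with inl p => p | inr p => (p, 0) end)
                  (fun g => match g with inl h => h | inr h => theta h end)])
        & (* (4), pair groupoid *)
          is_continuous_iso (ext_fiber M 1) (pair_groupoid [set: TM]) id
            (fun g => ((ext_tgt g).1, (ext_src g).1)) /\
          is_iso (ext_units M)
            (prod_groupoid (pair_groupoid [set: TM]) (trivial_groupoid (@units K)))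
            id (fun g => ((ext_tgt g).1, (ext_src g).1, (ext_src g).2))]
    & enough_charts M -> enough_charts N ->
      [/\ (* (5) *)
          forall f : TM -> TN,
            C1_map M N f <-> exists F : ext M -> ext N, first_kind f F,
          (forall f : TM -> TN, C1_map M N f ->
            exists! F : ext M -> ext N, first_kind f F) /\
          (forall F : ext M -> ext N, (exists f, first_kind f F) ->
            exists! f : TM -> TN, C1_map M N f /\ first_kind f F),
          (* (6) *)
          exists P, is_product_manifold M N P
        & forall P, is_product_manifold M N P ->
          exists h : ext P -> ext M * ext N,
            [/\ forall (c : atlas M) (d : atlas N) (e : atlas P) x y v w t,
                  val e = prod_chart (val c) (val d) ->
                  ext1 (cod (val c)) (x, v, t) -> ext1 (cod (val d)) (y, w, t) ->
                  h (ext_in e ((x, y), (v, w), t)) =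
                    (ext_in c (x, v, t), ext_in d (y, w, t)),
                homeomorphism setT
                  [set g | (ext_src g.1).2 = (ext_src g.2).2] h,
                forall g, ext_src g =
                  ((ext_src (h g).1).1, (ext_src (h g).2).1, (ext_src (h g).1).2),
                forall g, ext_tgt g =
                  ((ext_tgt (h g).1).1, (ext_tgt (h g).2).1, (ext_tgt (h g).1).2)
              & forall t : K,
                  is_continuous_iso (ext_fiber P t)
                    (prod_groupoid (ext_fiber M t) (ext_fiber N t)) id h]]].
Proof.
have M_comm := enough_charts_common K_dense V_hausdorff M_hausdorff (M := M).
have N_comm := enough_charts_common K_dense W_hausdorff N_hausdorff (M := N).
split.
- move=> U f Uo fC; split; [exact: local_groupoidP|exact: local_groupoidP|].
  exact (tangent1_morphism K_dense W_hausdorff Uo fC).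
- move=> /M_comm Mc; split.
  + split; first exact: ext_continuous_groupoid.
    by move=> c; exact: ext_in_morphism.
  + by split; [exact: ext_bundle_iso|move=> t; exact: ext_fiber_continuous].
  + split; first exact: tb_group_bundle.
    exists (@tb_arrow _ _ _ M); split.
    * by move=> c x v cx; exact: tb_arrow_in.
    * exact: tb_arrow_iso.
    * by move=> Kf; exact: units_tangent_sum.
  + by split; [exact: fiber1_pair_iso|exact: ext_units_iso].
move=> /M_comm Mc /N_comm Nc; split.
- move=> f; split=> [fC|[F fF]].
    by eexists; exact: (C1_map_first_kind K_dense V_hausdorff W_hausdorff Mc Nc fC).
  exact (first_kind_C1 K_dense V_hausdorff W_hausdorff fF).
- split=> [f fC|F [f fF]].
    have fF := C1_map_first_kind K_dense V_hausdorff W_hausdorff Mc Nc fC.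
    eexists; split; first exact: fF.
    by move=> F; exact (first_kind_unique K_dense V_hausdorff W_hausdorff Mc Nc fF).
  exists f; split; first by split=> //; exact (first_kind_C1 K_dense V_hausdorff W_hausdorff fF).
  by move=> f' [_ fF']; exact (first_kind_inj K_dense V_hausdorff fF fF').
- exact: product_manifold_exists.
move=> P PP; exists (@ext_split _ _ _ _ _ M N P); split.
- move=> c d e x y v w t eE cx dy.
  rewrite (ext_split_in K_dense V_hausdorff W_hausdorff eE) //.
  by rewrite eE; case: cx dy => ? ? [? ?]; do !split.
- by eexists; exact (ext_split_homeomorphism K_dense V_hausdorff W_hausdorff Mc Nc PP).
- move=> g; have [-> ->] := ext_split_src K_dense V_hausdorff W_hausdorff Mc Nc PP g.
  by case: (ext_src g) => -[].
- move=> g; have [-> ->] := ext_split_tgt K_dense V_hausdorff W_hausdorff Mc Nc PP g.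
  by case: (ext_tgt g) => -[].
- by move=> t; exact: ext_split_fiber_iso.
Qed.
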